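(* Let $\mathbb{F}\in\{\mathbb{R},\mathbb{C}\}$, $q\ge2$, let $\{O_i\}_{i=1}^n$ be a fixed complete design of self-adjoint $q\times q$ matrices over $\mathbb{F}$, and let $K:\mathbb{R}\times\mathbb{R}\to\mathbb{F}$ be a reproducing kernel such that $|K|^2$ is strictly positive definite. Let $\rho$ be a density matrix and let $\hat\rho^K$ be the QUARK estimator based on $r$ measurements of each observable. Then, as $r\to\infty$, $$\sqrt r\,(\hat\rho^K-\rho)\ \xrightarrow{d}\ N\big(0,\ \mathfrak{A}_K\mathfrak{S}_{K,\rho}\mathfrak{A}_K\big),$$ a centered Gaussian on the Euclidean space $\mathbb{F}^{q\times q}_{sa}$ with covariance operator $\mathfrak{A}_K\mathfrak{S}_{K,\rho}\mathfrak{A}_K$.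
   Context: $\mathbb{F}^{q\times q}_{sa}$ is the real vector space of self-adjoint (symmetric/Hermitian) $q\times q$ matrices with Frobenius inner product $\langle A,B\rangle_2=\mathrm{Tr}[AB]$. For $M\in\mathbb{F}^{q\times q}_{sa}$, $M^{\otimes2}$ is the map $S\mapsto\langle S,M\rangle_2M$. A density matrix is a non-negative definite trace-one element of $\mathbb{F}^{q\times q}_{sa}$. Each $O_i=\sum_{k=1}^{q_i}\lambda_{ik}\Pi_{ik}$ with distinct real eigenvalues, orthogonal eigenprojections $\Pi_{ik}$, $q_i\ge2$; $d_{ik}[S]=\mathrm{Tr}[S\Pi_{ik}]$. The collection is a complete design if for every traceless $\Delta\in\mathbb{F}^{q\times q}_{sa}$: $d_{ik}[\Delta]=0$ for all $i,k$ if and only if $\Delta=0$. Given $\rho$, the outcomes $Y_{ij}$ ($1\le i\le n$, $1\le j\le r$) are independent with $\mathbb{P}(Y_{ij}=\lambda_{ik}\mid\rho)=d_{ik}[\rho]$; $p_{ik}=\#\{j:Y_{ij}=\lambda_{ik}\}/r$. A reproducing kernel has non-negative definite finite Gram matrices; $|K|^2$ is strictly positive definite if $[|K(x_a,x_b)|^2]_{a,b}$ is positive definite for any finitely many distinct points. With $[\Omega_i]_{kk'}=|K(\lambda_{ik},\lambda_{ik'})|^2$, define $\mathfrak{H}_K[S]=\frac1n\sum_{i=1}^n\sum_{k,k'=1}^{q_i}[\Omega_i]_{kk'}\mathrm{Tr}[S\Pi_{ik}]\Pi_{ik'}$ on $\mathbb{F}^{q\times q}_{sa}$ (invertible under these hypotheses),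 $P_K=\frac1n\sum_{i=1}^n\sum_{k,k'=1}^{q_i}[\Omega_i]_{kk'}p_{ik}\Pi_{ik'}$, and $M_{ik}^K=\sum_{k'}[\Omega_i]_{kk'}\Pi_{ik'}$. The QUARK estimator is $$\hat\rho^{K}=\mathfrak{H}_K^{-1}(P_K)+\big(1-\mathrm{Tr}[\mathfrak{H}_K^{-1}(P_K)]\big)\frac{\mathfrak{H}_K^{-1}(I_q)}{\mathrm{Tr}[\mathfrak{H}_K^{-1}(I_q)]}$$ (the unique minimizer over trace-one $S\in\mathbb{F}^{q\times q}_{sa}$ of $\sum_{i}\sum_{k,k'}[\Omega_i]_{kk'}(d_{ik}[S]-p_{ik})(d_{ik'}[S]-p_{ik'})$). The scaled covariance superoperator is $$\mathfrak{S}_{K,\rho}=\frac1{n^2}\sum_{i=1}^n\Big[\sum_{k}d_{ik}[\rho](M_{ik}^K)^{\otimes2}-\Big(\sum_{k}d_{ik}[\rho]M_{ik}^K\Big)^{\otimes2}\Big],$$ and the kernel centered-inversion superoperator is $\mathfrak{A}_K=\mathfrak{H}_K^{-1}\mathfrak{C}_K^*$ with $\mathfrak{C}_K^*[S]=S-\frac{\mathrm{Tr}[\mathfrak{H}_K^{-1}(S)]}{\mathrm{Tr}[\mathfrak{H}_K^{-1}(I_q)]}I_q$; $\mathfrak{A}_K$ is self-adjoint. *)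

(* Defs.v *)
From HB Require Import structures.
From mathcomp Require Import all_boot all_order all_algebra.
From mathcomp Require Import all_classical all_reals all_analysis.
From mathcomp Require Export complex.

Set Implicit Arguments.
Unset Strict Implicit.
Unset Printing Implicit Defensive.

Import Order.TTheory GRing.Theory Num.Theory.
Import numFieldNormedType.Exports.

Local Open Scope classical_set_scope.
Local Open Scope ring_scope.

Inductive field_kind := RealField | ComplexField.

(* As a [numFieldType], [rcfld R k] carries the norm, the order (for which
   [0 <= z] means "z is real and nonnegative") and the usual topology. *)
Definition rcfld (R : realType) (k : field_kind) : numFieldType :=
  match k with
  | RealField => R
  | ComplexField => R[i]
  end.

Definition rc_of_real (R : realType) (k : field_kind) : R -> rcfld R k :=
  match k with
  | RealField => id
  | ComplexField => fun x => Complex x 0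
  end.

Definition rc_re (R : realType) (k : field_kind) : rcfld R k -> R :=
  match k with
  | RealField => id
  | ComplexField => fun z => complex.Re z
  end.

Definition rc_conj (R : realType) (k : field_kind) :
    rcfld R k -> rcfld R k :=
  match k with
  | RealField => id
  | ComplexField => fun z => conjc z
  end.

Definition adjmx (R : realType) (k : field_kind) (m n : nat)
    (A : 'M[rcfld R k]_(m, n)) : 'M[rcfld R k]_(n, m) :=
  map_mx (@rc_conj R k) A^T.

Definition selfadj (R : realType) (k : field_kind) (q : nat) :
    set 'M[rcfld R k]_q :=
  [set A | adjmx A = A].
Arguments selfadj : clear implicits.

Definition nneg_definite (R : realType) (k : field_kind) (m : nat)
    (A : 'M[rcfld R k]_m) : Prop :=
  selfadj R k m A /\
  forall c : 'cV[rcfld R k]_m, 0 <= (adjmx c *m A *m c) 0 0.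

Definition pos_definite (R : realType) (m : nat) (A : 'M[R]_m) : Prop :=
  A^T = A /\ forall c : 'cV[R]_m, c != 0 -> 0 < (c^T *m A *m c) 0 0.

Definition density_matrix (R : realType) (k : field_kind) (q : nat)
    (rho : 'M[rcfld R k]_q) : Prop :=
  nneg_definite rho /\ \tr rho = 1.

(* The Frobenius inner product of self-adjoint matrices. For self-adjoint [A]
   and [B] the trace of [A *m B] is real; [rc_re] only changes its type. *)
Definition frob (R : realType) (k : field_kind) (q : nat)
    (A B : 'M[rcfld R k]_q) : R :=
  rc_re (\tr (A *m B)).

Definition tensor_square (R : realType) (k : field_kind) (q : nat)
    (M : 'M[rcfld R k]_q) (S : 'M[rcfld R k]_q) : 'M[rcfld R k]_q :=
  rc_of_real k (frob S M) *: M.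

(* [obs_proj j] is the orthogonal projection (self-adjoint idempotent) onto the
   eigenspace of [obs_val j]. [eigenspace] is a space of row vectors; since
   [obs_mx] and [obs_proj j] are self-adjoint and [obs_val j] is real, having
   this row space is the same as projecting onto the space of column
   eigenvectors. *)
Record observable (R : realType) (k : field_kind) (q : nat) := Observable {
  obs_mx : 'M[rcfld R k]_q;
  obs_num : nat;
  obs_val : 'I_obs_num -> R;
  obs_proj : 'I_obs_num -> 'M[rcfld R k]_q;
  obs_selfadj : selfadj R k q obs_mx;
  obs_num_ge2 : (2 <= obs_num)%N;
  obs_val_inj : injective obs_val;
  obs_eigenvalue : forall a : rcfld R k,
    eigenvalue obs_mx a <-> exists j, a = rc_of_real k (obs_val j);
  obs_proj_selfadj : forall j, selfadj R k q (obs_proj j);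
  obs_proj_idem : forall j, obs_proj j *m obs_proj j = obs_proj j;
  obs_proj_eigenspace : forall j,
    (obs_proj j :=: eigenspace obs_mx (rc_of_real k (obs_val j)))%MS;
  obs_spectral : obs_mx = \sum_j rc_of_real k (obs_val j) *: obs_proj j
}.
Arguments obs_val {R k q}.
Arguments obs_proj {R k q}.

Definition outcome_prob (R : realType) (k : field_kind) (q : nat)
    (O : observable R k q) (j : 'I_(obs_num O)) (S : 'M[rcfld R k]_q) : R :=
  frob S (obs_proj O j).
Arguments outcome_prob {R k q}.

Definition complete_design (R : realType) (k : field_kind) (q n : nat)
    (O : 'I_n -> observable R k q) : Prop :=
  forall D : 'M[rcfld R k]_q, selfadj R k q D -> \tr D = 0 ->
    (forall i j, outcome_prob (O i) j D = 0) <-> D = 0.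

Definition reproducing_kernel (R : realType) (k : field_kind)
    (K : R -> R -> rcfld R k) : Prop :=
  forall (m : nat) (x : 'I_m -> R),
    nneg_definite (\matrix_(a, b) K (x a) (x b)).

(* [`|z|] is an element of [rcfld R k], real and nonnegative. *)
Definition abs_sq_kernel (R : realType) (k : field_kind)
    (K : R -> R -> rcfld R k) (x y : R) : R :=
  rc_re (`|K x y| ^+ 2).

Definition strictly_pos_definite (R : realType) (L : R -> R -> R) : Prop :=
  forall (m : nat) (x : 'I_m -> R), injective x ->
    pos_definite (\matrix_(a, b) L (x a) (x b)).

Definition kernel_Omega (R : realType) (k : field_kind) (q : nat)
    (K : R -> R -> rcfld R k) (O : observable R k q) : 'M[R]_(obs_num O) :=
  \matrix_(j, j') abs_sq_kernel K (obs_val O j) (obs_val O j').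

Section Quark.
Variables (R : realType) (k : field_kind) (q n : nat).
Variables (O : 'I_n -> observable R k q) (K : R -> R -> rcfld R k).

Definition kernel_H (S : 'M[rcfld R k]_q) : 'M[rcfld R k]_q :=
  n%:R^-1 *: \sum_i \sum_j \sum_j'
    rc_of_real k (kernel_Omega K (O i) j j' * outcome_prob (O i) j S)
      *: obs_proj (O i) j'.

(* [kernel_H] is inverted on the space of self-adjoint matrices only: on the
   whole of ['M_q] over the reals it is not injective. *)
Definition kernel_Hinv : 'M[rcfld R k]_q -> 'M[rcfld R k]_q :=
  'pinv_(fun=> 0) (selfadj R k q) kernel_H.

Definition kernel_P (p : forall i, 'I_(obs_num (O i)) -> R) :
    'M[rcfld R k]_q :=
  n%:R^-1 *: \sum_i \sum_j \sum_j'
    rc_of_real k (kernel_Omega K (O i) j j' * p i j) *: obs_proj (O i) j'.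

Definition quark (p : forall i, 'I_(obs_num (O i)) -> R) :
    'M[rcfld R k]_q :=
  let S := kernel_Hinv (kernel_P p) in
  let J := kernel_Hinv 1%:M in
  S + ((1 - \tr S) / \tr J) *: J.

Definition kernel_M (i : 'I_n) (j : 'I_(obs_num (O i))) : 'M[rcfld R k]_q :=
  \sum_j' rc_of_real k (kernel_Omega K (O i) j j') *: obs_proj (O i) j'.
Arguments kernel_M : clear implicits.

Definition covariance_superop (rho S : 'M[rcfld R k]_q) :
    'M[rcfld R k]_q :=
  (n%:R ^+ 2)^-1 *: \sum_i
    (\sum_j rc_of_real k (outcome_prob (O i) j rho)
         *: tensor_square (kernel_M i j) S
     - tensor_square
         (\sum_j rc_of_real k (outcome_prob (O i) j rho) *: kernel_M i j) S).


Definition centering_adj (S : 'M[rcfld R k]_q) : 'M[rcfld R k]_q :=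
  S - (\tr (kernel_Hinv S) / \tr (kernel_Hinv 1%:M)) *: 1%:M.

Definition centered_inversion (S : 'M[rcfld R k]_q) : 'M[rcfld R k]_q :=
  kernel_Hinv (centering_adj S).

End Quark.
Arguments quark {R k q n}.

Definition mutually_independent d (T : measurableType d) (R : realType)
    (P : probability T R) (I : finType) (X : I -> {RV P >-> R}) : Prop :=
  forall (J : {set I}) (A : I -> set R), (forall i, measurable (A i)) ->
    P (\bigcap_(i in [set` J]) (X i @^-1` A i)) =
    (\prod_(i in J) P (X i @^-1` A i))%E.

Definition measurements (R : realType) (k : field_kind) (q n : nat)
    (O : 'I_n -> observable R k q) (rho : 'M[rcfld R k]_q)
    d (T : measurableType d) (P : probability T R) (r : nat)
    (Y : 'I_n -> 'I_r -> {RV P >-> R}) : Prop :=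
  mutually_independent (fun ij : 'I_n * 'I_r => Y ij.1 ij.2) /\
  forall i l (j : 'I_(obs_num (O i))),
    P (Y i l @^-1` [set obs_val (O i) j]) = (outcome_prob (O i) j rho)%:E.

Definition outcome_freq (R : realType) (k : field_kind) (q n : nat)
    (O : 'I_n -> observable R k q) (T : Type) (r : nat)
    (Y : 'I_n -> 'I_r -> T -> R) (w : T) (i : 'I_n)
    (j : 'I_(obs_num (O i))) : R :=
  #|[pred l | Y i l w == obs_val (O i) j]|%:R / r%:R.
Arguments outcome_freq {R k q n} O {T r}.

(* Laws on the space of self-adjoint matrices are Borel probability measures
   on ['M_q] that give this closed subspace mass 1. *)
Notation borelMx R k q :=
  (g_sigma_algebraType (@open 'M[rcfld R k]_q)).

(* [normal_prob m s] is not the Dirac mass for [s = 0]. *)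
Definition normal_law (R : realType) (m v : R) (B : set R) : \bar R :=
  if v == 0 then \d_m B else normal_prob m (Num.sqrt v) B.

(* mu is N(0, Sigma) on the Euclidean space of self-adjoint matrices: Sigma
   is a self-adjoint endomorphism and <., A> has law N(0, <A, Sigma A>)
   for each A. *)
Definition centered_gaussian (R : realType) (k : field_kind) (q : nat)
    (Sigma : 'M[rcfld R k]_q -> 'M[rcfld R k]_q)
    (mu : probability (borelMx R k q) R) : Prop :=
  [/\ mu (selfadj R k q) = 1%E,
      forall A, selfadj R k q A -> selfadj R k q (Sigma A),
      forall A B, selfadj R k q A -> selfadj R k q B ->
        frob (Sigma A) B = frob A (Sigma B) &
      forall A, selfadj R k q A -> 0 <= frob A (Sigma A) /\
        forall B : set R, measurable B ->
          mu ((fun S => frob S A) @^-1` B)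
          = normal_law 0 (frob A (Sigma A)) B].

(* Weak convergence of the laws of the self-adjoint random matrices [X r]
   to mu, tested on bounded continuous functions on the space of self-adjoint
   matrices. *)
Definition cvg_in_distribution (R : realType) (k : field_kind) (q : nat)
    (d : nat -> measure_display) (T : forall r, measurableType (d r))
    (P : forall r, probability (T r) R)
    (X : forall r, T r -> 'M[rcfld R k]_q)
    (mu : probability (borelMx R k q) R) : Prop :=
  (forall r w, selfadj R k q (X r w)) /\
  forall f : 'M[rcfld R k]_q -> R,
    {within selfadj R k q, continuous f} ->
    (exists C : R, forall S, selfadj R k q S -> `|f S| <= C) ->
    (fun r => \int[P r]_w (f (X r w))%:E)%E @ \oo -->
    (\int[mu]_(S in selfadj R k q) (f S)%:E)%E.

(* Main.v *)
Require Import Defs.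
From HB Require Import structures.
From mathcomp Require Import all_boot all_order all_algebra.
From mathcomp Require Import all_classical all_reals all_analysis.
From mathcomp Require Import measurable_realfun ring lra.

Set Implicit Arguments.
Unset Strict Implicit.
Unset Printing Implicit Defensive.

Import Order.TTheory GRing.Theory Num.Theory.
Import numFieldNormedType.Exports.

Local Open Scope classical_set_scope.
Local Open Scope ring_scope.

(* Proof idea. By linearity, sqrt r (rho^K - rho) is the image under a linear map
   L of r^(-1/2) times a sum of independent centered vectors, one for each
   measurement. The central limit theorem for these vectors is proved by the
   Lindeberg-Trotter replacement argument: one multinomial trial acts on test
   functions by an averaging operator which agrees with the Gaussian averaging
   operator of the same covariance up to O(c^3), c = r^(-1/2), on functions with a
   third-order Taylor bound; both operators contract the sup norm, so the errors of
   the n r replacements add up to O(r^(-1/2)). The Gaussian operators compose to a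
   fixed Gaussian law because N(0, s^2) * N(0, t^2) = N(0, s^2 + t^2). A bounded
   continuous test function is reduced to Taylor-bounded ones by cubic-spline
   quasi-interpolation on a large box. The covariance of the image under L is
   A S A because A = H^-1 C^* is self-adjoint and kills the identity, which accounts
   for both the centering and the trace constraint. *)

(** * Normal laws *)

(** The measurements for different r live on unrelated probability spaces, so the comparison takes
    place between operators on test functions; probability returns only when [expectation_titer]
    reads an expectation as an iterate of averaging operators. Averaging keeps every Taylor bound
    with the same constant, so a replacement costs the same however many trials have already been
    averaged. The frequencies of one observable add up to 1, so the limiting covariance is
    degenerate in outcome coordinates. The limit is therefore built as the law of a sum of
    independent standard normal multiples of fixed vectors, and only one-dimensional densities
    occur. A bounded continuous function need not be uniformly close to a Taylor-bounded one on the
    whole space. The error has the form C (1 - chi) + e with a Taylor-bounded cutoff chi: this form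
    survives averaging, and convergence for chi itself transfers the tightness of the Gaussian law
    to the laws of the trials. *)

Section density.
Context d (T : measurableType d) (R : realType).
Variables (mu nu : {measure set T -> \bar R}) (p : T -> R).
Hypotheses (mp : measurable_fun setT p) (p0 : forall x, 0 <= p x).
Hypothesis nuE : forall A, measurable A -> nu A = (\int[mu]_(x in A) (p x)%:E)%E.

Import HBNNSimple.

Let integral_density_nnsfun (h : {nnsfun T >-> R}) :
  (\int[nu]_x (h x)%:E = \int[mu]_x ((h x)%:E * (p x)%:E))%E.
Proof.
transitivity (\int[nu]_x (\sum_(r \in range h)
    (r * \1_(h @^-1` [set r]) x)%:E))%E.
  by apply: eq_integral => x _; rewrite fsumEFin// -fimfunE.
rewrite ge0_integral_fsum//; last 2 first.
- by move=> r; exact/measurable_EFinP/measurable_funM.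
- by move=> r x _; rewrite nnfun_muleindic_ge0.
transitivity (\int[mu]_x (\sum_(r \in range h)
    (r * \1_(h @^-1` [set r]) x * p x)%:E))%E; last first.
  apply: eq_integral => x _; rewrite fsumEFin// -EFinM; congr EFin.
  rewrite [in RHS]fimfunE !fsbig_finite//= mulr_suml.
  by [].
rewrite ge0_integral_fsum//; last 2 first.
- move=> r; apply/measurable_EFinP; apply: measurable_funM => //.
  exact: measurable_funM.
- move=> r x _; rewrite EFinM mule_ge0//; first by rewrite nnfun_muleindic_ge0.
  by rewrite lee_fin.
apply: eq_fsbigr => r /[!inE] -[t _ htr].
have r0 : 0 <= r by rewrite -htr.
have mr : measurable (h @^-1` [set r]) by exact: measurable_sfunP.
transitivity (r%:E * nu (h @^-1` [set r]))%E.
  under eq_integral do rewrite EFinM.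
  rewrite ge0_integralZl//; last exact/measurable_EFinP/measurable_indic.
  by rewrite integral_indic// setIT.
rewrite nuE// integral_mkcond/=.
rewrite -ge0_integralZl//; first last.
- by move=> x _; rewrite patchE; case: ifP => // _; rewrite lee_fin.
- apply/(measurable_restrictT _ _).1 => //.
  by apply/measurable_EFinP; exact: measurable_funTS.
apply: eq_integral => x _; rewrite patchE indicE.
case: ifP => _; last by rewrite mulr0 mul0r mule0. by rewrite mulr1 EFinM.
Qed.

(** Turns integrals against a normal law into Lebesgue integrals against its density; simple
    functions first, then monotone convergence. *)
Lemma ge0_integral_density (f : T -> \bar R) :
  measurable_fun setT f -> (forall x, 0 <= f x)%E ->
  (\int[nu]_x f x = \int[mu]_x (f x * (p x)%:E))%E.
Proof.
move=> mf f0; pose h := nnsfun_approx measurableT mf.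
have hf x : (h n x)%:E @[n --> \oo] --> f x by exact: cvg_nnsfun_approx.
have hnd x : {homo (fun n => h n x) : a b / (a <= b)%N >-> a <= b}.
  by move=> a b ab; exact/lefP/nd_nnsfun_approx.
transitivity (limn (fun n => \int[nu]_x (h n x)%:E))%E.
  rewrite -monotone_convergence//.
  - by apply: eq_integral => x _; apply/esym/cvg_lim.
  - by move=> n; exact/measurable_EFinP.
  - by move=> n x _; rewrite lee_fin.
  - by move=> x _ a b ab; rewrite lee_fin hnd.
transitivity (limn (fun n => \int[mu]_x ((h n x)%:E * (p x)%:E)))%E.
  by congr (limn _); apply/funext => n; exact: integral_density_nnsfun.
rewrite -monotone_convergence//.
- apply: eq_integral => x _; apply/cvg_lim => //.
  by apply: cvgeZr.
- by move=> n; apply: emeasurable_funM; exact/measurable_EFinP.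
- by move=> n x _; rewrite mule_ge0// lee_fin.
- by move=> x _ a b ab; rewrite lee_wpmul2r ?lee_fin ?hnd.
Qed.

End density.

Section lebesgue_affine.
Context {R : realType}.
Local Notation mu := (@lebesgue_measure R).
Variables (s c : R).
Hypothesis s0 : s != 0.

Definition affine_fun (x : R) : R := s * x + c.

Lemma measurable_affine_fun : measurable_fun [set: R] affine_fun.
Proof. by apply: measurable_funD => //; exact: measurable_funM. Qed.

Let scaled_pushforwardP : exists2 m1 : {measure set (measurableTypeR R) -> \bar R},
    forall A, m1 A = (`|s|%:E * mu (affine_fun @^-1` A))%E &
    forall f : R -> \bar R, measurable_fun [set: R] f -> (forall x, 0 <= f x)%E ->
      (\int[m1]_x f x = `|s|%:E * \int[mu]_x f (affine_fun x))%E.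
Proof.
have ms : measurable_fun [set: measurableTypeR R]
  (affine_fun : measurableTypeR R -> measurableTypeR R).
  exact: measurable_affine_fun.
pose m0 : {measure set (measurableTypeR R) -> \bar R} :=
  measure_function_pushforward__canonical__measure_function_Measure mu ms.
exists (mscale (NngNum (normr_ge0 s)) m0) => //.
move=> f mf f0.
by rewrite ge0_integral_mscale// ge0_integral_pushforward.
Qed.

Lemma lebesgue_measure_affine (A : set R) : measurable A ->
  mu A = (`|s|%:E * mu (affine_fun @^-1` A))%E.
Proof.
move=> mA.
have [m1 m1E _] := scaled_pushforwardP.
rewrite -m1E; apply: lebesgue_measure_unique mA.
move=> _ [[a b]] _ <- /=; rewrite m1E.
have [s_gt0|s_lt0] := ltP 0 s.
  rewrite (_ : _ @^-1` _ = `](a - c) / s, (b - c) / s]%classic).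
    rewrite !lebesgue_measure_itv/= !lte_fin ltr_pM2r ?invr_gt0// ltrD2r.
    case: ifPn => ab; last by rewrite mule0.
    rewrite -!EFinD -EFinM gtr0_norm//; congr EFin.
    by field.
  apply/seteqP; split => x /=; rewrite !in_itv/= /affine_fun.
    by rewrite ler_pdivlMr// ltr_pdivrMr// lerBrDr ltrBlDr mulrC.
  by rewrite ler_pdivlMr// ltr_pdivrMr// lerBrDr ltrBlDr mulrC.
(* A negative slope exchanges the endpoints, so the preimage is closed on the left and open on the
   right; its length is the same. *)
have {}s_lt0 : s < 0 by rewrite lt_neqAle s0.
rewrite (_ : _ @^-1` _ = `[(b - c) / s, (a - c) / s[%classic).
  rewrite !lebesgue_measure_itv/= !lte_fin ltr_nM2r ?invr_lt0// ltrD2r.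
  case: ifPn => ab; last by rewrite mule0.
  rewrite -!EFinD -EFinM ltr0_norm//; congr EFin.
  by field.
by apply/seteqP; split => x /=; rewrite !in_itv/= /affine_fun;
  rewrite ler_ndivrMr// ltr_ndivlMr// lerBrDr ltrBlDr mulrC andbC.
Qed.

Lemma ge0_integral_affine (f : R -> \bar R) :
  measurable_fun [set: R] f -> (forall x, 0 <= f x)%E ->
  (\int[mu]_x f x = `|s|%:E * \int[mu]_x f (affine_fun x))%E.
Proof.
move=> mf f0.
have [m1 m1E <-//] := scaled_pushforwardP.
by apply: eq_measure_integral => A mA _; rewrite m1E; exact: lebesgue_measure_affine.
Qed.

End lebesgue_affine.

Section normal_affine.
Context {R : realType}.
Implicit Types m s t a c x y z : R.

Lemma normal_peakM a s : normal_peak (a * s) = `|a|^-1 * normal_peak s.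
Proof.
rewrite /normal_peak exprMn -mulrA -mulrnAr sqrtrM ?sqr_ge0// sqrtr_sqr.
by rewrite invfM.
Qed.

Lemma normal_pdf_affine m s a c z : s != 0 -> a != 0 ->
  normal_pdf (a * m + c) (a * s) (a * z + c) = `|a|^-1 * normal_pdf m s z.
Proof.
move=> s0 a0; rewrite !normal_pdfE ?mulf_neq0// normal_peakM -mulrA.
congr (_ * (_ * expR _)).
by field; rewrite s0 a0.
Qed.

Lemma normal_prob_affine m s a c (B : set R) : s != 0 -> a != 0 ->
  measurable B ->
  normal_prob m s ((fun z => a * z + c) @^-1` B) = normal_prob (a * m + c) (a * s) B.
Proof.
move=> s0 a0 mB; rewrite /normal_prob.
rewrite integral_mkcond [RHS]integral_mkcond [RHS](ge0_integral_affine c a0).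
- rewrite -ge0_integralZl//.
  + apply: eq_integral => z _; rewrite !patchE.
    rewrite (_ : (z \in _ @^-1` B) = (affine_fun a c z \in B)); last first.
      by apply/idP/idP; rewrite !inE.
    case: ifP => _; last by rewrite mule0.
    rewrite /affine_fun normal_pdf_affine// -EFinM mulrA divff ?mul1r//.
    by rewrite normr_eq0.
  + apply: measurableT_comp; last exact: measurable_affine_fun.
    apply/(measurable_restrictT _ _).1 => //.
    by apply/measurable_EFinP/measurable_funTS; exact: measurable_normal_pdf.
  + by move=> x _; rewrite patchE; case: ifP => // _; rewrite lee_fin normal_pdf_ge0.
- apply/(measurable_restrictT _ _).1 => //.
  by apply/measurable_EFinP/measurable_funTS; exact: measurable_normal_pdf.
- by move=> x; rewrite patchE; case: ifP => // _; rewrite lee_fin normal_pdf_ge0.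
Qed.

Lemma normal_pdf_sqr m s t : s ^+ 2 = t ^+ 2 -> normal_pdf m s = normal_pdf m t.
Proof.
move=> st; have st0 : (s == 0) = (t == 0) by rewrite -[s == 0]sqrf_eq0 st sqrf_eq0.
(* At deviation 0 the density takes its default value; equal squares send both or neither of [s] and
   [t] there. *)
have [t0|t0] := eqVneq t 0.
  by apply/funext => x; rewrite /normal_pdf st0 t0 eqxx.
rewrite !normal_pdfE ?st0//.
by apply/funext => x; rewrite /normal_peak /normal_fun st.
Qed.

(** Completing the square, read as Bayes' formula: the joint density of X and X + Y is the density
    of the sum times the conditional density of X, with mean y s^2 / v and deviation s t / sqrt
    v. *)
Lemma normal_pdf_product s t x y : s != 0 -> t != 0 ->
  let v := s ^+ 2 + t ^+ 2 in
  normal_pdf 0 s x * normal_pdf x t y =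
  normal_pdf 0 (Num.sqrt v) y *
  normal_pdf (y * s ^+ 2 / v) (s * t / Num.sqrt v) x.
Proof.
move=> s0 t0 v.
have v_gt0 : 0 < v by rewrite addr_gt0// lt_neqAle eq_sym sqrf_eq0 ?s0 ?t0 sqr_ge0.
have sv0 : Num.sqrt v != 0 by rewrite gt_eqF// sqrtr_gt0.
rewrite !normal_pdfE ?mulf_neq0 ?invr_eq0// mulrACA [RHS]mulrACA; congr (_ * _).
  rewrite /normal_peak -!invfM; congr (_^-1); rewrite -!sqrtrM; first congr (Num.sqrt _).
  - rewrite exprMn exprVn sqr_sqrtr ?ltW//.
    by field; rewrite gt_eqF.
  - by rewrite mulrn_wge0// mulr_ge0 ?sqr_ge0 ?pi_ge0.
  - by rewrite mulrn_wge0// mulr_ge0 ?sqr_ge0 ?pi_ge0.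
rewrite /normal_fun -!expRD; congr expR.
rewrite [(s * t / _) ^+ 2]exprMn exprVn sqr_sqrtr ?ltW//.
by rewrite /v; field; rewrite s0 t0/= -/v gt_eqF.
Qed.
End normal_affine.

Section normal_convolution.
Context {R : realType}.
Local Notation mu := (@lebesgue_measure R).
Variables s t : R.
Hypotheses (s0 : s != 0) (t0 : t != 0).

Lemma normal_pdf_center (m x y : R) : t != 0 -> normal_pdf x t y = normal_pdf 0 t (y - x).
Proof. by move=> ?; rewrite !normal_pdfE// /normal_fun subr0. Qed.

(** Joint density of X and X + Y, cut to the event that the sum lies in [B]. *)
Let F (B : set R) (p : R * R) : \bar R :=
  ((\1_B p.2 * (normal_pdf 0 s p.1 * normal_pdf p.1 t p.2))%R)%:E.

Let mF B : measurable B -> measurable_fun [set: R * R] (F B).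
Proof.
move=> mB; apply/measurable_EFinP; apply: measurable_funM.
  by apply: measurableT_comp => //; exact: measurable_indic.
apply: measurable_funM.
  by apply: measurableT_comp => //; exact: measurable_normal_pdf.
under eq_fun do rewrite normal_pdf_center//.
apply: (@measurableT_comp _ _ _ _ _ _ (normal_pdf 0 t) _ (fun p : R * R => p.2 - p.1)).
  exact: measurable_normal_pdf.
exact: measurable_funB.
Qed.

Let F0 B p : (0 <= F B p)%E.
Proof. by rewrite lee_fin !mulr_ge0// normal_pdf_ge0. Qed.

Let normal_probE x B : measurable B ->
  (normal_prob x t B * (normal_pdf 0 s x)%:E = \int[mu]_y F B (x, y))%E.
Proof.
move=> mB; rewrite /normal_prob integral_mkcond muleC -ge0_integralZl//.
- apply: eq_integral => y _; rewrite patchE /F/= indicE.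
  case: ifP => _; last by rewrite mul0r mule0.
  by rewrite mul1r EFinM.
- apply/(measurable_restrictT _ _).1 => //.
  by apply/measurable_EFinP/measurable_funTS; exact: measurable_normal_pdf.
- by move=> y _; rewrite patchE; case: ifP => // _; rewrite lee_fin normal_pdf_ge0.
- by rewrite lee_fin normal_pdf_ge0.
Qed.

(** After Tonelli, the inner integral over x runs over the conditional density in
    [normal_pdf_product] and equals 1. *)
Lemma normal_prob_convolution (B : set R) : measurable B ->
  measurable_fun [set: R] (fun x => normal_prob x t B) ->
  (\int[normal_prob 0 s]_x normal_prob x t B =
   normal_prob 0 (Num.sqrt (s ^+ 2 + t ^+ 2)) B)%E.
Proof.
move=> mB mP.
rewrite (@ge0_integral_density _ _ R mu _ (normal_pdf 0 s))//; last first.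
  by move=> x; exact: normal_pdf_ge0.
  exact: measurable_normal_pdf.
under eq_integral do rewrite normal_probE//.
transitivity (\int[mu]_y \int[mu]_x F B (x, y))%E.
  by apply: fubini_tonelli; [exact: mF|exact: F0].
rewrite /normal_prob [RHS]integral_mkcond; apply: eq_integral => y _.
rewrite patchE /F/=; case: ifPn => yB; last first.
  by apply: integral0_eq => x _; rewrite indicE (negbTE yB) mul0r.
under eq_integral do rewrite indicE yB mul1r normal_pdf_product// EFinM.
rewrite ge0_integralZl//.
- by rewrite integral_normal_pdf mule1.
- by apply/measurable_EFinP; exact: measurable_normal_pdf.
- by move=> x _; rewrite lee_fin normal_pdf_ge0.
- by rewrite lee_fin normal_pdf_ge0.
Qed.

End normal_convolution.

(** * Bounded measurable functions and Fubini's theorem for them *)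

Section bounded_measurable.
Context {R : realType}.

(** Test functions are kept in this class: it is integrable for every probability measure and stable
    under partial integration, so no step needs an integrability argument of its own. *)
Definition bmeas d (T : measurableType d) (f : T -> R) :=
  measurable_fun setT f /\ exists C, forall x, `|f x| <= C.

Lemma bmeas_integrable d (T : measurableType d) (P : probability T R) (f : T -> R) :
  bmeas f -> P.-integrable setT (EFin \o f).
Proof.
move=> [mf [C fC]]; apply: (@le_integrable _ _ _ _ _ _ _ (EFin \o cst C)) => //.
- exact/measurable_EFinP.
- by move=> x _ /=; rewrite lee_fin (le_trans (fC x))// ler_norm.
- exact: finite_measure_integrable_cst.
Qed.

Lemma bmeas_comp d d' (T : measurableType d) (T' : measurableType d')
    (X : T -> T') (f : T' -> R) :
  measurable_fun setT X -> bmeas f -> bmeas (f \o X).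
Proof.
move=> mX [mf [C fC]]; split; first exact: measurableT_comp.
by exists C => x; exact: fC.
Qed.

Lemma bmeas_cst d (T : measurableType d) (c : R) : bmeas (fun _ : T => c).
Proof. by split; [exact: measurable_cst|exists `|c|]. Qed.

Lemma bmeasD d (T : measurableType d) (f g : T -> R) :
  bmeas f -> bmeas g -> bmeas (fun x => f x + g x).
Proof.
move=> [mf [C fC]] [mg [D gD]]; split; first exact: measurable_funD.
by exists (C + D) => x; rewrite (le_trans (ler_normD _ _))// lerD.
Qed.

Lemma bmeasZ d (T : measurableType d) (c : R) (f : T -> R) :
  bmeas f -> bmeas (fun x => c * f x).
Proof.
move=> [mf [C fC]]; split; first exact: measurable_funM.
by exists (`|c| * C) => x; rewrite normrM ler_wpM2l.
Qed.

Lemma bmeasB d (T : measurableType d) (f g : T -> R) :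
  bmeas f -> bmeas g -> bmeas (fun x => f x - g x).
Proof.
move=> bf bg; rewrite (_ : (fun x => _) = (fun x => f x + (-1) * g x)).
  by apply: bmeasD => //; exact: bmeasZ.
by apply/funext => x; rewrite mulN1r.
Qed.

Lemma EFin_Rintegral d (T : measurableType d) (P : {measure set T -> \bar R})
    (f : T -> R) : P.-integrable setT (EFin \o f) ->
  (\int[P]_x f x)%:E = (\int[P]_x (f x)%:E)%E.
Proof. by move=> fi; rewrite /Rintegral fineK//; exact: integrable_fin_num. Qed.

Lemma Rintegral_cst_prob d (T : measurableType d) (P : probability T R) (c : R) :
  \int[P]_x c = c.
Proof. by rewrite Rintegral_cst// [X in fine X]probability_setT mulr1. Qed.

Lemma le_norm_Rintegral_prob d (T : measurableType d) (P : probability T R)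
    (f : T -> R) (C : R) :
  bmeas f -> (forall x, `|f x| <= C) -> `|\int[P]_x f x| <= C.
Proof.
move=> bf fC.
rewrite (le_trans (le_normr_Rintegral _ _))//; first exact: bmeas_integrable.
rewrite -[leRHS](Rintegral_cst_prob P); apply: le_Rintegral => //.
- by apply: integrable_norm; exact: bmeas_integrable.
- exact: finite_measure_integrable_cst.
Qed.

Lemma Rintegral_law d d' (T : measurableType d) (T' : measurableType d')
    (P : probability T R) (Q : {measure set T' -> \bar R}) (X : T -> T') (f : T' -> R) :
  measurable_fun setT X ->
  (forall B, measurable B -> Q B = P (X @^-1` B)) -> bmeas f ->
  \int[Q]_y f y = \int[P]_x f (X x).
Proof.
move=> mX QE bf; have bfX := bmeas_comp mX bf.
pose PX : {measure set T' -> \bar R} :=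
  measure_function_pushforward__canonical__measure_function_Measure P mX.
congr fine; transitivity (\int[PX]_y (f y)%:E)%E.
  by apply: eq_measure_integral => A mA _; exact: QE.
rewrite integral_pushforward//; first by apply/measurable_EFinP; case: bf.
exact: bmeas_integrable bfX.
Qed.

Section fubini.
Context d1 d2 (T1 : measurableType d1) (T2 : measurableType d2).
Variables (P : probability T1 R) (Q : probability T2 R) (f : T1 * T2 -> R).
Hypothesis bf : bmeas f.

Lemma bmeas_section1 x : bmeas (fun y => f (x, y)).
Proof.
by apply: (@bmeas_comp _ _ _ _ (pair x)) => //.
Qed.

Lemma bmeas_section2 y : bmeas (fun x => f (x, y)).
Proof.
by apply: (@bmeas_comp _ _ _ _ (fun x => (x, y))) => //.
Qed.

Let fE : fubini_F Q (EFin \o f) = EFin \o (fun x => \int[Q]_y f (x, y)).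
Proof.
apply/funext => x; rewrite /fubini_F/= EFin_Rintegral//.
exact/bmeas_integrable/bmeas_section1.
Qed.

Lemma bmeas_Rintegral : bmeas (fun x => \int[Q]_y f (x, y)).
Proof.
split.
  apply/measurable_EFinP; rewrite -[X in measurable_fun _ X]fE.
  apply: (@measurable_fubini_F _ _ _ _ _ P Q (EFin \o f)).
  exact: bmeas_integrable.
have [_ [C fC]] := bf; exists C => x.
by apply: le_norm_Rintegral_prob => //; exact: bmeas_section1.
Qed.

Lemma Rintegral_prod : \int[(P \x Q)%E]_z f z = \int[P]_x \int[Q]_y f (x, y).
Proof.
by rewrite /Rintegral -integral12_prod_meas1 ?fE//; exact: bmeas_integrable.
Qed.

Lemma Rintegral_exchange :
  \int[P]_x \int[Q]_y f (x, y) = \int[Q]_y \int[P]_x f (x, y).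
Proof.
rewrite -Rintegral_prod /Rintegral -integral21_prod_meas1 ?fE//; last exact: bmeas_integrable.
congr fine; apply: eq_integral => y _; rewrite /fubini_G -EFin_Rintegral//.
exact/bmeas_integrable/bmeas_section2.
Qed.

End fubini.
End bounded_measurable.

(** * Scaling and convolution of the standard normal law *)

Section std_gaussian.
Context {R : realType}.
Local Notation gauss := (@normal_prob R 0 1).

Lemma gauss_scale (s : R) (B : set R) : s != 0 -> measurable B ->
  gauss ((fun z => s * z) @^-1` B) = normal_prob 0 s B.
Proof.
move=> s0 mB; have := @normal_prob_affine R 0 1 s 0 B (oner_neq0 _) s0 mB.
rewrite mulr0 add0r mulr1 => <-; congr normal_prob.
by apply/seteqP; split=> z /=; rewrite addr0.
Qed.

(** As an image of the standard law, N(0, s^2) also makes sense for s = 0, where [normal_prob 0 s]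
    is not a Dirac mass; negative scales are covered because only the square enters. *)
Lemma gauss_scale_sqr (s t : R) (B : set R) : s ^+ 2 = t ^+ 2 -> measurable B ->
  gauss ((fun z => s * z) @^-1` B) = gauss ((fun z => t * z) @^-1` B).
Proof.
move=> st mB; have [t0|t0] := eqVneq t 0.
  by move: st; rewrite t0 expr0n/= => /eqP; rewrite sqrf_eq0 => /eqP ->.
have s0 : s != 0 by rewrite -sqrf_eq0 st sqrf_eq0.
by rewrite (gauss_scale s0 mB) (gauss_scale t0 mB) /normal_prob (normal_pdf_sqr _ st).
Qed.

Let measurable_mulr (s : R) : measurable_fun [set: R] (fun z => s * z).
Proof. exact: measurable_funM. Qed.

Lemma measurable_lincomb (s t : R) :
  measurable_fun [set: R * R] (fun p => s * p.1 + t * p.2).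
Proof. by apply: measurable_funD; apply: measurable_funM. Qed.

Lemma gauss_convolution (s t : R) (B : set R) : measurable B ->
  (gauss \x gauss)%E ((fun p => s * p.1 + t * p.2) @^-1` B) =
  gauss ((fun z => Num.sqrt (s ^+ 2 + t ^+ 2) * z) @^-1` B).
Proof.
move=> mB.
rewrite /product_measure1/=.
have [s0|s0] := eqVneq s 0.
  under eq_integral => x _.
    rewrite (_ : xsection _ _ = (fun z => t * z) @^-1` B); last first.
      by apply/seteqP; split=> z; rewrite /xsection/= inE /= s0 mul0r add0r.
    over.
  rewrite integral_cst//= [X in (_ * X)%E]probability_setT mule1.
  by apply: gauss_scale_sqr => //; rewrite sqr_sqrtr ?addr_ge0 ?sqr_ge0// s0 expr0n add0r.
(* A zero coefficient leaves no Gaussian density in its variable: the section over x is everything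
   or nothing, according to whether s x lies in [B]. *)
have [t0|t0] := eqVneq t 0.
  under eq_integral => x _.
    rewrite (_ : xsection _ _ = if s * x \in B then setT else set0); last first.
      apply/seteqP; split=> z; rewrite /xsection/= inE /= t0 mul0r addr0.
        by move=> h; rewrite ifT// inE.
      by case: ifPn => //; rewrite inE.
    rewrite (_ : gauss _ = (\1_((fun z => s * z) @^-1` B) x)%:E); last first.
      rewrite indicE (_ : (x \in _) = (s * x \in B)); last first.
        by apply/idP/idP; rewrite !inE.
      by case: ifP => _; rewrite ?probability_setT ?measure0.
    over.
  rewrite integral_indic//; last first.
    by rewrite -[X in measurable X]setTI; exact: measurable_mulr.
  rewrite setIT; apply: gauss_scale_sqr => //.
  by rewrite sqr_sqrtr ?addr_ge0 ?sqr_ge0// t0 expr0n addr0.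
rewrite gauss_scale//; last first.
  by rewrite gt_eqF// sqrtr_gt0 ltr_pwDl ?sqr_ge0// lt_neqAle eq_sym sqrf_eq0 s0 sqr_ge0.
have E x : gauss (xsection ((fun p => s * p.1 + t * p.2) @^-1` B) x) =
    normal_prob (s * x) t B.
  have := @normal_prob_affine R 0 1 t (s * x) B (oner_neq0 _) t0 mB.
  rewrite mulr0 add0r mulr1 => <-; congr normal_prob.
  by apply/seteqP; split=> z; rewrite /xsection/= inE/= addrC.
have mE : measurable_fun [set: R] (fun x => normal_prob (s * x) t B).
  under eq_fun do rewrite -E.
  apply: measurable_fun_xsection; rewrite -[X in measurable X]setTI.
  exact: measurable_lincomb.
(* Sections give measurability in s x; composing with multiplication by the inverse of s gives it in
   x. *)
have mN : measurable_fun [set: R] (fun x => normal_prob x t B).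
  rewrite (_ : (fun x => _) =
    (fun x => normal_prob (s * x) t B) \o (fun z => s^-1 * z)).
    by apply: measurableT_comp => //; exact: measurable_mulr.
  by apply/funext => x; rewrite /comp (mulVKf s0).
rewrite -(normal_prob_convolution s0 t0 mB mN).
under eq_integral do rewrite E.
have ms : measurable_fun [set: measurableTypeR R]
  ((fun z => s * z) : measurableTypeR R -> measurableTypeR R).
  exact: measurable_mulr.
pose G : {measure set (measurableTypeR R) -> \bar R} :=
  measure_function_pushforward__canonical__measure_function_Measure gauss ms.
transitivity (\int[G]_x normal_prob x t B)%E.
  apply: esym; exact: ge0_integral_pushforward.
pose N : {measure set (measurableTypeR R) -> \bar R} := normal_prob 0 s.
have GE (A : set (measurableTypeR R)) : measurable A -> A `<=` setT -> G A = N A.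
  by move=> mA _; exact: (gauss_scale s0 mA).
by apply: (@eq_measure_integral _ _ R setT N G _ GE).
Qed.

Lemma Rintegral_gauss_convolution (s t : R) (f : R -> R) : bmeas f ->
  \int[gauss]_x \int[gauss]_y f (s * x + t * y) =
  \int[gauss]_z f (Num.sqrt (s ^+ 2 + t ^+ 2) * z).
Proof.
move=> bf.
pose g (p : R * R) := f (s * p.1 + t * p.2).
have bg : bmeas g.
  by apply: (@bmeas_comp _ _ _ _ _ (fun p : R * R => s * p.1 + t * p.2)) => //; exact: measurable_lincomb.
rewrite -[LHS](Rintegral_prod gauss gauss bg).
pose S : {measure set R -> \bar R} :=
  measure_function_pushforward__canonical__measure_function_Measure
    gauss (measurable_mulr (Num.sqrt (s ^+ 2 + t ^+ 2))).
transitivity (\int[S]_x f x).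
  apply/esym/Rintegral_law => //; first exact: measurable_lincomb.
  by move=> B mB; apply/esym; exact: gauss_convolution.
apply: Rintegral_law => //; exact: measurable_mulr.
Qed.

End std_gaussian.

(** * Moments of the standard normal law *)

Section gaussian_moments.
Context {R : realType}.
Local Notation gauss := (@normal_prob R 0 1).
Local Notation mu := (@lebesgue_measure R).

Let phi (z : R) : R := normal_pdf 0 1 z.

Let phiE z : phi z = normal_peak 1 * expR (- (z ^+ 2 / 2)).
Proof.
rewrite /phi normal_pdfE ?oner_neq0// /normal_fun subr0 expr1n.
by congr (_ * expR _); field.
Qed.

Let mphi : measurable_fun [set: R] phi.
Proof. exact: measurable_normal_pdf. Qed.

Let phi_ge0 z : 0 <= phi z. Proof. exact: normal_pdf_ge0. Qed.

Let gauss_ge0_integral (f : R -> \bar R) :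
  measurable_fun setT f -> (forall x, 0 <= f x)%E ->
  (\int[gauss]_x f x = \int[mu]_x (f x * (phi x)%:E))%E.
Proof. by move=> mf f0; exact: ge0_integral_density. Qed.

(** Dominates the third moment by a multiple of the density of N(0, 2), which is integrable. Half of
    the exponent is spent on 1 + |z|^3 <= 130 (1 + z^2/8)^2 <= 130 exp(z^2/4); the constant 130 is
    generous. *)
Let cube_pdf_bound (z : R) : (1 + `|z| ^+ 3) * phi z <=
  130 * normal_peak 1 / normal_peak (Num.sqrt 2) * normal_pdf 0 (Num.sqrt 2) z.
Proof.
have s2 : Num.sqrt 2 != 0 :> R by rewrite gt_eqF// sqrtr_gt0.
have p2 : normal_peak (Num.sqrt 2) != 0 :> R by rewrite gt_eqF// normal_peak_gt0.
rewrite phiE normal_pdfE// mulrA divfK// /normal_fun subr0 sqr_sqrtr//.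
set p := normal_peak 1.
rewrite [leLHS](_ : _ = p * ((1 + `|z| ^+ 3) * expR (- (z ^+ 2 / 4)) *
    expR (- (z ^+ 2 / 4)))); last first.
  by rewrite -!mulrA -expRD mulrCA; congr (_ * (_ * expR _)); field.
rewrite (_ : - z ^+ 2 / (2 *+ 2) = - (z ^+ 2 / 4)); last first.
  by field.
rewrite [130 * p]mulrC -[leRHS]mulrA ler_wpM2l ?normal_peak_ge0// ler_wpM2r ?expR_ge0//.
rewrite expRN ler_pdivrMr ?expR_gt0//.
set w := `|z|; have -> : z ^+ 2 = w ^+ 2 by rewrite /w real_normK// num_real.
have w0 : 0 <= w by rewrite /w.
have -> : w ^+ 2 / 4 = w ^+ 2 / 8 + w ^+ 2 / 8 by field.
rewrite expRD.
have h : 1 + w ^+ 2 / 8 <= expR (w ^+ 2 / 8) by exact: expR_ge1Dx.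
have h1 : 0 <= w ^+ 2 / 8 by rewrite divr_ge0// sqr_ge0.
apply: (@le_trans _ _ (130 * ((1 + w ^+ 2 / 8) * (1 + w ^+ 2 / 8)))); last first.
  by rewrite ler_wpM2l//; apply: ler_pM => //; rewrite addr_ge0.
have : 0 <= w ^+ 2 * (w - 1) ^+ 2 by rewrite mulr_ge0 ?sqr_ge0.
have : 0 <= (w ^+ 2 - 1) ^+ 2 by rewrite sqr_ge0.
nra.
Qed.

Lemma integrable_gauss_cube : gauss.-integrable setT (EFin \o (fun z : R => 1 + `|z| ^+ 3)).
Proof.
have m3 : measurable_fun [set: R] (fun z : R => 1 + `|z| ^+ 3).
  by apply: measurable_funD => //; apply: measurable_funX; exact: normr_measurable.
have p3 (z : R) : 0 <= 1 + `|z| ^+ 3 by rewrite addr_ge0// exprn_ge0.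
apply/integrableP; split; first exact/measurable_EFinP.
rewrite gauss_ge0_integral//; last first.
  by apply: measurableT_comp => //; exact/measurable_EFinP.
set c := 130 * normal_peak 1 / normal_peak (Num.sqrt 2) : R.
have c0 : 0 <= c by rewrite divr_ge0 ?mulr_ge0 ?normal_peak_ge0.
apply: (@le_lt_trans _ _ (\int[mu]_x (c * normal_pdf 0 (Num.sqrt 2) x)%:E)%E).
  apply: ge0_le_integral => //.
  - by move=> x _; rewrite mule_ge0// lee_fin.
  - apply: emeasurable_funM; last exact/measurable_EFinP.
    by apply: measurableT_comp => //; exact/measurable_EFinP.
  - apply/measurable_EFinP; apply: measurable_funM => //.
    exact: measurable_normal_pdf.
  - move=> x _; rewrite -EFinM lee_fin ger0_norm//.
under eq_integral do rewrite EFinM.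
rewrite ge0_integralZl//.
- by rewrite integral_normal_pdf mule1 ltry.
- by apply/measurable_EFinP; exact: measurable_normal_pdf.
- by move=> x _; rewrite lee_fin normal_pdf_ge0.
Qed.

Let integrable_gauss_dom (f : R -> R) : measurable_fun setT f ->
  (forall z, `|f z| <= 1 + `|z| ^+ 3) -> gauss.-integrable setT (EFin \o f).
Proof.
move=> mf fz; apply: (le_integrable _ _ _ integrable_gauss_cube) => //.
  exact/measurable_EFinP.
by move=> z _ /=; rewrite lee_fin [leRHS]ger0_norm ?addr_ge0// exprn_ge0.
Qed.

Let add_sqr_le_cube (w : R) : 0 <= w -> w + w ^+ 2 <= 1 + w ^+ 3.
Proof.
move=> w0; rewrite -subr_ge0.
have -> : 1 + w ^+ 3 - (w + w ^+ 2) = (w - 1) ^+ 2 * (w + 1) by ring.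
by rewrite mulr_ge0 ?sqr_ge0 ?addr_ge0.
Qed.

Lemma integrable_gauss_id : gauss.-integrable setT (EFin \o (fun z : R => z)).
Proof.
apply: integrable_gauss_dom => // z;
  have := add_sqr_le_cube (normr_ge0 z); have := sqr_ge0 `|z|; have := normr_ge0 z; lra.
Qed.

Lemma integrable_gauss_sqr : gauss.-integrable setT (EFin \o (fun z : R => z ^+ 2)).
Proof.
apply: integrable_gauss_dom; first exact: measurable_funX.
move=> z; rewrite normrX;
  have := add_sqr_le_cube (normr_ge0 z); have := sqr_ge0 `|z|; have := normr_ge0 z; lra.
Qed.

(** The law is invariant under reflection, the scales -1 and 1 having equal squares, so the mean is
    its own opposite. *)
Lemma Rintegral_gauss_id : \int[gauss]_z z = 0 :> R.
Proof.
have mN : measurable_fun [set: measurableTypeR R]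
    ((fun z : R => -1 * z) : measurableTypeR R -> measurableTypeR R).
  exact: measurable_funM.
pose G : {measure set (measurableTypeR R) -> \bar R} :=
  measure_function_pushforward__canonical__measure_function_Measure gauss mN.
pose N : {measure set (measurableTypeR R) -> \bar R} := gauss.
have GE (A : set (measurableTypeR R)) : measurable A -> A `<=` setT -> N A = G A.
  move=> mA _; have := @gauss_scale_sqr R (-1) 1 A; rewrite sqrrN => /(_ erefl mA) h.
  transitivity (gauss ((fun z : R => 1 * z) @^-1` A)); last exact: esym h.
  by congr normal_prob; apply/seteqP; split => z /=; rewrite mul1r.
have h : \int[gauss]_z z = \int[gauss]_z (- z).
  congr fine; transitivity (\int[G]_z z%:E)%E.
    by apply: (@eq_measure_integral _ _ R setT G N _ GE).
  rewrite integral_pushforward//.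
    by apply: eq_integral => z _ /=; rewrite mulN1r.
  rewrite /= (_ : _ \o _ = EFin \o (fun z => - z)).
    apply: integrable_gauss_dom; first exact: oppr_measurable.
    move=> z; rewrite normrN;
      have := add_sqr_le_cube (normr_ge0 z); have := sqr_ge0 `|z|; have := normr_ge0 z; lra.
  by apply/funext => z /=; rewrite mulN1r.
have hN : \int[gauss]_z (- z) = - \int[gauss]_z z.
  transitivity (\int[gauss]_z (-1 * z)).
    by apply: eq_Rintegral => z _; rewrite mulN1r.
  by rewrite RintegralZl ?mulN1r//; exact: integrable_gauss_id.
by move: h; rewrite hN => /eqP; rewrite -addr_eq0 -mulr2n mulrn_eq0/= => /eqP.
Qed.

(** The reason for variance 1: [(z ^+ 2 - 1) * phi z] has a primitive that vanishes at 0 and at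
    infinity, so the second moment equals the total mass on the half-line. *)
Let dphi (z : R) : is_derive z 1 (fun x => - x * phi x) ((z ^+ 2 - 1) * phi z).
Proof.
have -> : (fun x => - x * phi x) =
    (fun x => - x * (normal_peak 1 * expR (- (x ^+ 2 / 2)))).
  by apply/funext => x; rewrite phiE.
have h : is_derive z 1 (fun x : R => - (x ^+ 2 / 2)) (- z).
  by apply: is_derive_eq; rewrite /= ?scaler0 ?add0r ?addr0 /GRing.scale/=; field.
have h2 := @is_derive1_comp R expR (fun x : R => - (x ^+ 2 / 2)) z _ _ (is_derive_expR _) h.
have h3 := is_deriveZ (normal_peak 1 : R) h2.
have h4 : is_derive z 1 (fun x : R => - x) (- 1) := is_deriveNid z 1.
have h5 := is_deriveM h4 h3.
apply: (is_derive_eq h5).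
rewrite phiE /= /GRing.scale/=; ring.
Qed.

Let cvg_zphi : (- x * phi x) @[x --> +oo] --> (0 : R).
Proof.
pose p := normal_peak 1 : R.
have p0 : 0 <= p by exact: normal_peak_ge0.
apply/cvgrPdist_le => e e0; near=> x.
have x0 : 0 < x by near: x; apply: nbhs_pinfty_gt; exact: num_real.
(* Since x^2/2 <= exp(x^2/2), the absolute value is at most 2 p / x. *)
have xe : 2 * p / e <= x by near: x; apply: nbhs_pinfty_ge; exact: num_real.
rewrite sub0r mulNr opprK ger0_norm; last by rewrite mulr_ge0// ltW.
rewrite phiE -/p expRN.
have h : x ^+ 2 / 2 <= expR (x ^+ 2 / 2).
  by rewrite (le_trans _ (expR_ge1Dx _))// lerDr.
rewrite mulrA ler_pdivrMr ?expR_gt0//.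
apply: (@le_trans _ _ (e * (x ^+ 2 / 2))); last by rewrite ler_wpM2l// ltW.
move: xe; rewrite ler_pdivrMr//; nra.
Unshelve. all: by end_near. Qed.

Let cphi0 : continuous phi.
Proof. by apply: continuous_normal_pdf; exact: oner_neq0. Qed.

Let cphi : continuous (fun z : R => (z ^+ 2 - 1) * phi z).
Proof.
move=> z; apply: cvgM; last exact: cphi0.
apply: cvgB; [exact: exprn_continuous|exact: cvg_cst].
Qed.

Let cG : continuous (fun z : R => - z * phi z).
Proof.
by move=> z; apply/differentiable_continuous/derivable1_diffP; case: (dphi z).
Qed.

Let dG z : (fun z : R => - z * phi z)^`()%classic z = (z ^+ 2 - 1) * phi z.
Proof. by rewrite derive1E; apply: derive_val. Qed.

(** The half-line is cut at 1, where the integrand changes sign: the fundamental theorem on an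
    unbounded interval is applied to a nonnegative integrand only. *)
Let integral_1y : (\int[mu]_(x in `[1%R, +oo[) ((x ^+ 2 - 1) * phi x)%:E = (phi 1)%:E)%E.
Proof.
rewrite (@ge0_continuous_FTC2y _ _ (fun z : R => - z * phi z) 1 0)//.
- by rewrite mulN1r EFinN sub0e oppeK.
- move=> x x1; rewrite mulr_ge0// subr_ge0 -[leLHS](expr1n _ 2).
  by rewrite lerXn2r ?nnegrE ?(le_trans _ x1).
- exact: continuous_subspaceT.
- by move=> x _; case: (dphi x).
- by apply: cvg_at_right_filter; exact: cG.
Qed.

Let integral_01 : (\int[mu]_(x in `[0%R, 1%R]) ((x ^+ 2 - 1) * phi x)%:E = (- phi 1)%:E)%E.
Proof.
rewrite (@continuous_FTC2 _ _ (fun z : R => - z * phi z) 0 1)//.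
- by rewrite mulN1r oppr0 mul0r sube0.
- exact: continuous_subspaceT.
- split.
  + by move=> x _; case: (dphi x).
  + by apply: cvg_at_right_filter; exact: cG.
  + by apply: cvg_at_left_filter; exact: cG.
Qed.

Lemma Rintegral_gauss_sqr : \int[gauss]_z (z ^+ 2) = 1 :> R.
Proof.
have sphi z : phi (- z) = phi z by rewrite !phiE sqrrN.
have m2 : measurable_fun [set: R] (fun z : R => z ^+ 2 * phi z).
  by apply: measurable_funM => //; exact: measurable_funX.
have p2 z : 0 <= z ^+ 2 * phi z by rewrite mulr_ge0// sqr_ge0.
have i0 : mu.-integrable setT (EFin \o phi) by exact: integrable_normal_pdf.
have i2 : mu.-integrable setT (EFin \o (fun z : R => z ^+ 2 * phi z)).
  apply/integrableP; split; first exact/measurable_EFinP.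
  have /integrableP[_] := integrable_gauss_sqr.
  rewrite gauss_ge0_integral//; last first.
    by apply: measurableT_comp => //; apply/measurable_EFinP; exact: measurable_funX.
  apply: le_lt_trans; rewrite le_eqVlt; apply/orP; left; apply/eqP.
  apply: eq_integral => z _ /=; rewrite -EFinM ger0_norm//.
  by rewrite ger0_norm// sqr_ge0.
have id : mu.-integrable setT (EFin \o (fun z : R => (z ^+ 2 - 1) * phi z)).
  rewrite (_ : EFin \o _ = ((EFin \o (fun z : R => z ^+ 2 * phi z)%R) \- (EFin \o phi))%E).
    exact: integrableB.
  by apply/funext => z /=; rewrite -EFinB mulrBl mul1r.
have h : (\int[mu]_(x in `[0%R, +oo[) ((x ^+ 2 - 1) * phi x)%:E = 0)%E.
  transitivity ((- phi 1)%:E + (phi 1)%:E)%E; last by rewrite -EFinD addNr.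
  rewrite -integral_01 -integral_1y.
  rewrite (_ : `[0%R, +oo[%classic = `[0%R, 1%R] `|` `]1%R, +oo[)%classic; last first.
    by rewrite -itv_bndbnd_setU ?bnd_simp.
  rewrite integral_setU//.
  - congr (_ + _)%E; rewrite integral_itv_obnd_cbnd//.
    by apply/measurable_EFinP; apply: measurable_funTS; exact: continuous_measurable_fun.
  - by apply/measurable_EFinP; apply: measurable_funTS; exact: continuous_measurable_fun.
  - rewrite disj_set2E; apply/eqP; rewrite -subset0 => x []/= /[!in_itv]/=.
    by rewrite andbT => /andP[_ x1]; rewrite ltNge x1.
have half (f : R -> R) : (forall z, 0 <= f z) -> continuous f -> (forall z, f (- z) = f z) ->
    (\int[mu]_z (f z)%:E = 2%:E * \int[mu]_(x in `[0%R, +oo[) (f x)%:E)%E.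
  move=> f0 cf sf; rewrite ge0_symfun_integralT//; last by move=> z /=; rewrite sf.
  by rewrite -set_itvcy.
have e1 : (\int[mu]_(x in `[0%R, +oo[) (x ^+ 2 * phi x)%:E =
           \int[mu]_(x in `[0%R, +oo[) (phi x)%:E)%E.
  have i0' : mu.-integrable `[0%R, +oo[ (EFin \o phi) by exact: (integrableS measurableT).
  have i2' : mu.-integrable `[0%R, +oo[ (EFin \o (fun z : R => z ^+ 2 * phi z)).
    exact: (integrableS measurableT).
  have : (\int[mu]_(x in `[0%R, +oo[) ((x ^+ 2 * phi x)%R%:E - (phi x)%:E) = 0)%E.
    by rewrite -h; apply: eq_integral => z _; rewrite -EFinB mulrBl mul1r.
  rewrite integralB// => /eqP.
  rewrite sube_eq ?add0e; first by move=> /eqP.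
    exact: integrable_fin_num.
  by rewrite fin_num_adde_defr.
apply: EFin_inj; rewrite EFin_Rintegral; last exact: integrable_gauss_sqr.
rewrite gauss_ge0_integral//; last 2 first.
  by apply/measurable_EFinP; exact: measurable_funX.
  by move=> x; rewrite lee_fin sqr_ge0.
under eq_integral do rewrite -EFinM.
rewrite half//; last 2 first.
- move=> z; apply: cvgM; last exact: cphi0.
  exact: exprn_continuous.
- by move=> z; rewrite sqrrN sphi.
rewrite e1 -half//.
- exact: integral_normal_pdf.
Qed.

End gaussian_moments.

(** * Gaussian averaging operators *)

Notation borel V := (g_sigma_algebraType (@open V)).

Lemma measurable_continuous_borel (R : realType) (V : ptopologicalType) (f : V -> R) :
  continuous f -> measurable_fun setT (f : borel V -> R).
Proof.
move=> cf; apply: (measurability _ (RGenOpens.measurableE R)) => //.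
move=> _ [_ [a [b ->]] <-]; rewrite setTI; apply: sub_sigma_algebra.
by apply: open_comp => //; move=> x _; exact: cf.
Qed.

Section gaussian_steps.
Context {R : realType} {V : normedModType R}.
Local Notation gauss := (@normal_prob R 0 1).
Implicit Types (v w x : V) (ws : seq V) (f : V -> R).

Definition add_scale w (p : borel V * R) : borel V := (p.1 : V) + p.2 *: w.

Let add_scale_rect w (U : set V) (q : rat) (k : nat) : set (borel V * R) :=
  [set S : V | forall z : R, `|z - ratr q| < k.+1%:R^-1 -> U (S + z *: w)]° `*`
  [set z : R | `|z - ratr q| < k.+1%:R^-1].

(** Continuity alone does not suffice: for a general normed space [V] the product of the Borel
    sigma-algebras may be smaller than the Borel sigma-algebra of the product. As the scalar factor
    has a countable base, the preimage of an open set is a countable union of the rectangles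
    [add_scale_rect], with rational centres and radii 1/(k+1). *)
Lemma measurable_add_scale w : measurable_fun setT (add_scale w).
Proof.
apply: (@measurability _ _ _ _ setT (add_scale w) (@open V)) => // _ [U oU <-].
rewrite setTI (_ : _ @^-1` _ = \bigcup_q \bigcup_k add_scale_rect w U q k).
  apply: bigcupT_measurable_rat => q; apply: bigcup_measurable => k _.
  apply: measurableX.
    by apply: sub_sigma_algebra; exact: open_interior.
  rewrite (_ : [set z | _] = `](ratr q - k.+1%:R^-1), (ratr q + k.+1%:R^-1)[%classic)//.
  by apply/seteqP; split => z /=; rewrite in_itv/= ltr_distl.
apply/seteqP; split => [[S z]|[S z] [q _ [k _ [/interior_subset/= + zq]]]]/=; last exact.
move=> SzU.
have cA : {for ((S, z) : V * R), continuous (fun p : V * R => p.1 + p.2 *: w)}.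
  apply: cvgD; first exact: cvg_fst.
  by apply: cvgZr_tmp; exact: cvg_snd.
have /cA : nbhs (S + z *: w) U by exact: open_nbhs_nbhs.
case=> -[N M] /= [nN /nbhs_ballP[e/= e0 eM]] NMU.
(* Half of [e], because both z and the moving scalar are compared with the rational centre. *)
have [k ke] : exists k : nat, k.+1%:R^-1 < e / 2.
  have /ltr_add_invr[k] : 0 < e / 2 by rewrite divr_gt0.
  by rewrite add0r => ?; exists k.
have k0 : 0 < k.+1%:R^-1 :> R by rewrite invr_gt0.
have [q] : exists q : rat, ratr q \in `](z - k.+1%:R^-1), (z + k.+1%:R^-1)[.
  by apply: rat_in_itvoo; rewrite ltrD2l (lt_trans _ k0)// oppr_lt0.
rewrite in_itv/= -ltr_distl distrC => qz.
exists q => //; exists k => //; split => //=.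
apply: (filterS _ nN) => S' NS' z' z'q.
apply: (NMU (S', z')); split => //=; apply: eM.
rewrite /ball/= (splitr e) (le_lt_trans (ler_distD (ratr q) _ _))//.
by rewrite ltrD// (lt_trans _ ke)// distrC.
Qed.

Definition add_scale_rv w : borel V * measurableTypeR R -> borel V := add_scale w.

HB.instance Definition _ w :=
  isMeasurableFun.Build _ _ _ _ (add_scale_rv w) (measurable_add_scale w).

Definition gstep w f x : R := \int[gauss]_z f (x + z *: w).

Definition gsteps ws f : V -> R := foldr gstep f ws.

Let bmeas_add_scale w f : bmeas (f : borel V -> R) ->
  bmeas (fun p : borel V * R => f (add_scale w p)).
Proof. by move=> bf; apply: bmeas_comp bf; exact: measurable_add_scale. Qed.

Lemma bmeas_line f x w : bmeas (f : borel V -> R) ->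
  bmeas (fun z : R => f (x + z *: w)).
Proof. by move=> /(bmeas_add_scale w)/bmeas_section1; exact. Qed.

Lemma bmeas_gstep w f : bmeas (f : borel V -> R) -> bmeas (gstep w f : borel V -> R).
Proof.
by move=> bf; exact: (@bmeas_Rintegral _ _ _ _ _ \d_(0 : borel V) gauss _ (bmeas_add_scale w bf)).
Qed.

Lemma bmeas_gsteps ws f : bmeas (f : borel V -> R) -> bmeas (gsteps ws f : borel V -> R).
Proof. by move=> bf; elim: ws => //= w ws; exact: bmeas_gstep. Qed.

Lemma gstep_comm v w f : bmeas (f : borel V -> R) ->
  gstep v (gstep w f) = gstep w (gstep v f).
Proof.
move=> bf; apply/funext => x; rewrite /gstep.
pose F (p : R * R) := f (x + p.1 *: v + p.2 *: w).
have bF : bmeas F.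
  apply: (@bmeas_comp _ _ _ _ (borel V) (fun p : R * R => add_scale w (add_scale v (x, p.1), p.2))) bf.
  apply: (measurableT_comp (measurable_add_scale w)).
  apply/measurable_fun_pair => //.
  apply: (measurableT_comp (measurable_add_scale v)).
  exact/measurable_fun_pair.
rewrite -[LHS]/(\int[gauss]_y \int[gauss]_z F (y, z)) (Rintegral_exchange gauss gauss bF).
by apply: eq_Rintegral => z _; apply: eq_Rintegral => y _; rewrite /F/= addrAC.
Qed.

Lemma gstep_gsteps w ws f : bmeas (f : borel V -> R) ->
  gstep w (gsteps ws f) = gsteps ws (gstep w f).
Proof.
move=> bf; elim: ws => //= v ws IH; rewrite gstep_comm ?IH//.
exact: bmeas_gsteps.
Qed.

Lemma gstep_add (s t : R) w f : bmeas (f : borel V -> R) ->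
  gstep (s *: w) (gstep (t *: w) f) = gstep (Num.sqrt (s ^+ 2 + t ^+ 2) *: w) f.
Proof.
move=> bf; apply/funext => x; rewrite /gstep.
have := @Rintegral_gauss_convolution R s t _ (bmeas_line x w bf).
under eq_Rintegral do under eq_Rintegral do rewrite scalerDl addrA mulrC [t * _]mulrC -!scalerA.
move=> ->; apply: eq_Rintegral => z _.
by rewrite mulrC scalerA.
Qed.

(** Steps in different directions commute, so the two passes can be merged direction by
    direction. *)
Lemma gsteps_add ws (s t : R) f : 0 <= s -> 0 <= t -> bmeas (f : borel V -> R) ->
  gsteps [seq Num.sqrt s *: w | w <- ws] (gsteps [seq Num.sqrt t *: w | w <- ws] f) =
  gsteps [seq Num.sqrt (s + t) *: w | w <- ws] f.
Proof.
move=> s0 t0 bf; elim: ws => //= w ws IH.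
rewrite -gstep_gsteps ?IH ?gstep_add ?sqr_sqrtr//; first exact: bmeas_gsteps.
exact: bmeas_gsteps.
Qed.

(** Infinite divisibility of the Gaussian law, and the reason why the limit operator does not depend
    on r. *)
Lemma gsteps_iter ws r f : bmeas (f : borel V -> R) ->
  iter r.+1 (gsteps [seq Num.sqrt (r.+1%:R^-1) *: w | w <- ws]) f = gsteps ws f.
Proof.
move=> bf.
have r0 : 0 <= r.+1%:R^-1 :> R by rewrite invr_ge0.
have h k : iter k.+1 (gsteps [seq Num.sqrt (r.+1%:R^-1) *: w | w <- ws]) f =
    gsteps [seq Num.sqrt (k.+1%:R * r.+1%:R^-1) *: w | w <- ws] f.
  elim: k => [|k IH]; first by rewrite mul1r.
  rewrite iterS IH gsteps_add//.
  by rewrite -[k.+2]addn1 natrD mulrDl mul1r addrC.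
rewrite h divff// sqrtr1; congr gsteps.
by rewrite -[RHS]map_id; apply: eq_map => w; rewrite scale1r.
Qed.

(* The law of [\sum_w Z_w *: w] for independent standard normal [Z_w]. It need not
   have a density: [ws] may span a proper subspace. *)
Fixpoint gauss_law ws : probability (borel V) R :=
  if ws is w :: ws' then distribution (gauss_law ws' \x gauss)%E (add_scale_rv w)
  else \d_(0 : borel V).

Lemma Rintegral_gauss_law ws f : bmeas (f : borel V -> R) ->
  \int[gauss_law ws]_x f x = gsteps ws f 0.
Proof.
elim: ws f => [|w ws IH] f bf.
  have mf : measurable_fun setT (fun x : borel V => (f x)%:E).
    by apply/measurable_EFinP; case: bf.
  by rewrite /Rintegral (integral_dirac (0 : borel V) measurableT mf) diracT mul1e.
rewrite [LHS](@Rintegral_law _ _ _ _ _ (gauss_law ws \x gauss)%E _ (add_scale w))//.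
  rewrite Rintegral_prod//; last exact: bmeas_add_scale.
  (* The law adds [w] last while [gsteps] has it outermost; commutation reconciles the two
     orders. *)
  by rewrite IH ?gsteps_gsteps -?gstep_gsteps//; exact: bmeas_gstep.
exact: measurable_add_scale.
Qed.

(** Gives the one-dimensional marginals: [l] turns a step along [w] into a step of size [l w] on the
    line, and the variances add up. *)
Lemma gsteps_functional ws (l : V -> R) (phi : R -> R) x :
  (forall y z w, l (y + z *: w) = l y + z * l w) -> bmeas phi ->
  gsteps ws (phi \o l) x =
  \int[gauss]_z phi (l x + z * Num.sqrt (\sum_(w <- ws) l w ^+ 2)).
Proof.
move=> ll bphi; elim: ws x => [|w ws IH] x /=.
  under eq_Rintegral do rewrite big_nil sqrtr0 mulr0 addr0.
  by rewrite Rintegral_cst_prob.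
rewrite /gstep; under eq_Rintegral => y _ do rewrite IH ll.
set v := \sum_(_ <- ws) _.
have bp : bmeas (fun z => phi (l x + z)).
  by apply: (@bmeas_comp _ _ _ _ _ (fun z => l x + z)) => //; exact: measurable_funD.
have := @Rintegral_gauss_convolution R (l w) (Num.sqrt v) _ bp.
rewrite big_cons sqr_sqrtr; last by apply: sumr_ge0 => i _; exact: sqr_ge0.
under eq_Rintegral do under eq_Rintegral do rewrite addrA mulrC [Num.sqrt v * _]mulrC.
move=> h; etransitivity; last first.
  by apply: eq_Rintegral => z _; rewrite mulrC.
by rewrite -h.
Qed.

End gaussian_steps.

(** * Smooth approximation of continuous functions *)

Section cubic_spline.
Context {R : realType}.
Implicit Types y t : R.

Definition pospart y : R := Num.max y 0.

Let ppos y : 0 <= y -> pospart y = y. Proof. exact: max_l. Qed.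
Let pneg y : y <= 0 -> pospart y = 0. Proof. exact: max_r. Qed.

Let pospart_cases y : (0 <= y /\ pospart y = y) \/ (y <= 0 /\ pospart y = 0).
Proof.
have [y0|y0] := leP 0 y; first by left; rewrite ppos.
by right; rewrite pneg ltW.
Qed.

Let normE y (c : R) : `|y| <= c <-> - c <= y /\ y <= c.
Proof. by rewrite ler_norml; split=> [/andP|/andP]. Qed.

Let pospart_lip y t : `|pospart (y + t) - pospart y| <= `|t|.
Proof.
apply/normE; have [t0|t0] := ger0P t; have [[y0 ->]|[y0 ->]] := pospart_cases y;
  have [[yt ->]|[yt ->]] := pospart_cases (y + t); lra.
Qed.

Let pospart2 y t :
  `|pospart (y + t) ^+ 2 - pospart y ^+ 2 - 2 * pospart y * t| <= `|t| ^+ 2.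
Proof.
rewrite real_normK ?num_real//.
apply/normE; have [[y0 ->]|[y0 ->]] := pospart_cases y;
  have [[yt ->]|[yt ->]] := pospart_cases (y + t).
- by split; have := sqr_ge0 t; lra.
- have h : 0 <= - (y + t) * y by rewrite mulr_ge0// oppr_ge0.
  by split; have := sqr_ge0 t; have := sqr_ge0 (y + t); have := sqr_ge0 y; nra.
- have h : 0 <= (y + t) * - y by rewrite mulr_ge0// oppr_ge0.
  by split; have := sqr_ge0 t; have := sqr_ge0 (y + t); have := sqr_ge0 y; nra.
- by split; have := sqr_ge0 t; lra.
Qed.

(** The third derivative of [pospart y ^+ 3] jumps from 0 to 6, so the remainder constant 1 persists
    across the knot. The spline estimates are weighted sums of such bounds at the knots. *)
Let pospart3 y t :
  `|pospart (y + t) ^+ 3 - pospart y ^+ 3 - 3 * pospart y ^+ 2 * t -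
    3 * pospart y * t ^+ 2| <= `|t| ^+ 3.
Proof.
have cube_le (a b : R) : a <= b -> a ^+ 3 <= b ^+ 3.
  move=> ab; rewrite -subr_ge0.
  have -> : b ^+ 3 - a ^+ 3 = (b - a) * (((a + b) ^+ 2 + a ^+ 2 + b ^+ 2) / 2) by field.
  by rewrite mulr_ge0 ?subr_ge0// divr_ge0// !addr_ge0 ?sqr_ge0.
have [[y0 ->]|[y0 ->]] := pospart_cases y;
  have [[yt ->]|[yt ->]] := pospart_cases (y + t).
- by rewrite (_ : _ - _ = t ^+ 3) ?normrX//; ring.
- have t0 : t <= 0 by lra.
  rewrite (_ : _ - _ = t ^+ 3 - (y + t) ^+ 3); last ring.
  have h1 : t ^+ 3 <= (y + t) ^+ 3 by apply: cube_le; lra.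
  have h2 : (y + t) ^+ 3 <= 0 by have := cube_le _ _ yt; rewrite expr0n.
  rewrite ler0_norm; last by lra.
  rewrite (ler0_norm t0) exprNn -signr_odd/= expr1 mulN1r; lra.
- have t0 : 0 <= t by lra.
  rewrite (_ : _ - _ = (y + t) ^+ 3); last ring.
  rewrite !ger0_norm ?exprn_ge0//; apply: cube_le; lra.
- by rewrite (_ : _ - _ = 0) ?normr0 ?exprn_ge0//; ring.
Qed.

(* The cubic B-spline with knots 0, 1, 2, 3, 4; its integer translates form a
   partition of unity. [spline2] is half of its second derivative. *)
Definition spline y : R :=
  (pospart y ^+ 3 - 4 * pospart (y - 1) ^+ 3 + 6 * pospart (y - 2) ^+ 3
   - 4 * pospart (y - 3) ^+ 3 + pospart (y - 4) ^+ 3) / 6.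

Definition spline1 y : R :=
  (pospart y ^+ 2 - 4 * pospart (y - 1) ^+ 2 + 6 * pospart (y - 2) ^+ 2
   - 4 * pospart (y - 3) ^+ 2 + pospart (y - 4) ^+ 2) / 2.

Definition spline2 y : R :=
  (pospart y - 4 * pospart (y - 1) + 6 * pospart (y - 2)
   - 4 * pospart (y - 3) + pospart (y - 4)) / 2.

(** Beyond 4 no truncation is active, and the binomial sums are fourth differences of polynomials of
    degree at most 3. *)
Lemma spline_outside y : (y <= 0 \/ 4 <= y) ->
  [/\ spline y = 0, spline1 y = 0 & spline2 y = 0].
Proof.
rewrite /spline /spline1 /spline2; case=> y0.
  by rewrite !pneg; try lra; split; lra.
by rewrite !ppos; try lra; split; field.
Qed.

Let pospart_bd y : y <= 4 -> 0 <= pospart y /\ pospart y <= 4.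
Proof. by move=> y4; have [[y0 ->]|[y0 ->]] := pospart_cases y; lra. Qed.

Lemma spline_bound y :
  [/\ `|spline y| <= 1000, `|spline1 y| <= 1000 & `|spline2 y| <= 1000].
Proof.
have [y4|y4] := leP 4 y.
  have [|-> -> ->] := @spline_outside y; first by right.
  rewrite normr0; have h : (0 : R) <= 1000 by lra.
  exact: (And3 h h h).
have b0 := pospart_bd (ltW y4).
have b1 : 0 <= pospart (y - 1) /\ pospart (y - 1) <= 4 by apply: pospart_bd; lra.
have b2 : 0 <= pospart (y - 2) /\ pospart (y - 2) <= 4 by apply: pospart_bd; lra.
have b3 : 0 <= pospart (y - 3) /\ pospart (y - 3) <= 4 by apply: pospart_bd; lra.
have b4 : 0 <= pospart (y - 4) /\ pospart (y - 4) <= 4 by apply: pospart_bd; lra.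
have sq (z : R) : 0 <= z /\ z <= 4 -> 0 <= z ^+ 2 /\ z ^+ 2 <= 16 by nra.
have cu (z : R) : 0 <= z /\ z <= 4 -> 0 <= z ^+ 3 /\ z ^+ 3 <= 64.
  move=> zz; have := sq z zz; rewrite exprS; nra.
split; apply/normE; rewrite /spline /spline1 /spline2.
- by have := cu _ b0; have := cu _ b1; have := cu _ b2; have := cu _ b3; have := cu _ b4; lra.
- by have := sq _ b0; have := sq _ b1; have := sq _ b2; have := sq _ b3; have := sq _ b4; lra.
- by lra.
Qed.

(** The weights 1, 4, 6, 4, 1 add up to 16; division by 6, 2 and 2 gives the constants 3, 8 and 8
    here and in the next two lemmas. *)
Lemma spline_taylor y t :
  `|spline (y + t) - spline y - spline1 y * t - spline2 y * t ^+ 2| <= 3 * `|t| ^+ 3.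
Proof.
have := pospart3 y t; have := pospart3 (y - 1) t; have := pospart3 (y - 2) t.
have := pospart3 (y - 3) t; have := pospart3 (y - 4) t.
have e (c : R) : y - c + t = y + t - c by ring.
rewrite !e => /normE h4 /normE h3 /normE h2 /normE h1 /normE h0; apply/normE.
rewrite /spline /spline1 /spline2; lra.
Qed.

Lemma spline1_taylor y t :
  `|spline1 (y + t) - spline1 y - 2 * spline2 y * t| <= 8 * `|t| ^+ 2.
Proof.
have := pospart2 y t; have := pospart2 (y - 1) t; have := pospart2 (y - 2) t.
have := pospart2 (y - 3) t; have := pospart2 (y - 4) t.
have e (c : R) : y - c + t = y + t - c by ring.
rewrite !e => /normE h4 /normE h3 /normE h2 /normE h1 /normE h0; apply/normE.
rewrite /spline1 /spline2; lra.
Qed.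

Lemma spline2_lipschitz y t : `|spline2 (y + t) - spline2 y| <= 8 * `|t|.
Proof.
have := pospart_lip y t; have := pospart_lip (y - 1) t; have := pospart_lip (y - 2) t.
have := pospart_lip (y - 3) t; have := pospart_lip (y - 4) t.
have e (c : R) : y - c + t = y + t - c by ring.
rewrite !e => /normE h4 /normE h3 /normE h2 /normE h1 /normE h0; apply/normE.
rewrite /spline2; lra.
Qed.

Lemma spline_ge0 y : 0 <= spline y.
Proof.
have [y0|y0] := leP y 0; first by have [|->] := @spline_outside y; first by left.
have [y4|y4] := leP 4 y; first by have [|->] := @spline_outside y; first by right.
rewrite /spline (ppos (ltW y0)) (@pneg (y - 4)); last lra.
have [y1|y1] := leP y 1.
  by rewrite !pneg; try lra; have := exprn_ge0 3 (ltW y0); lra.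
rewrite (@ppos (y - 1)); last lra.
have [y2|y2] := leP y 2.
  rewrite !pneg; try lra.
  (* On each inner unit interval the spline is a cubic in the distance z to a knot, and positivity
     is a polynomial inequality on [0, 1]; on the last interval it is z^3/6. *)
  set z := y - 1; have -> : y = z + 1 by rewrite /z; ring.
  have z0 : 0 <= z by rewrite /z; lra.
  have z1 : z <= 1 by rewrite /z; lra.
  nra.
rewrite (@ppos (y - 2)); last lra.
have [y3|y3] := leP y 3.
  rewrite !pneg; try lra.
  set z := 3 - y; have -> : y = 3 - z by rewrite /z; ring.
  have z0 : 0 <= z by rewrite /z; lra.
  have z1 : z <= 1 by rewrite /z; lra.
  nra.
rewrite ppos; last lra.
set z := 4 - y; have -> : y = 4 - z by rewrite /z; ring.
have z0 : 0 <= z by rewrite /z; lra.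
have := exprn_ge0 3 z0; nra.
Qed.

(* The sum of the translates of [spline] by the natural numbers. *)
Definition smoothstep y : R :=
  (pospart y ^+ 3 - 3 * pospart (y - 1) ^+ 3 + 3 * pospart (y - 2) ^+ 3
   - pospart (y - 3) ^+ 3) / 6.

Lemma smoothstep_le0 y : y <= 0 -> smoothstep y = 0.
Proof. by move=> y0; rewrite /smoothstep !pneg; lra. Qed.

Lemma smoothstep_ge3 y : 3 <= y -> smoothstep y = 1.
Proof. by move=> y3; rewrite /smoothstep !ppos; try lra; field. Qed.

Lemma smoothstepB y : smoothstep y - smoothstep (y - 1) = spline y.
Proof.
rewrite /smoothstep /spline.
have -> : y - 1 - 1 = y - 2 by ring.
have -> : y - 1 - 2 = y - 3 by ring.
have -> : y - 1 - 3 = y - 4 by ring.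
by field.
Qed.

Lemma sum_spline n y :
  \sum_(k < n) spline (y - k%:R) = smoothstep y - smoothstep (y - n%:R).
Proof.
elim: n => [|n IH]; first by rewrite big_ord0 subr0 subrr.
rewrite big_ord_recr/= IH -smoothstepB -natr1.
rewrite (_ : y - n%:R - 1 = y - (n%:R + 1)); last by ring.
by ring.
Qed.

(** For large n the shifted term in [sum_spline] vanishes, which leaves a finite sum of splines. *)
Lemma smoothstep_ge0 y : 0 <= smoothstep y.
Proof.
have [n yn] : exists n : nat, y <= n%:R.
  exists (Num.trunc y).+1; apply: ltW; exact: truncnS_gt.
have := sum_spline n y; rewrite (@smoothstep_le0 (y - n%:R)) ?subr0; last lra.
by move=> <-; apply: sumr_ge0 => k _; exact: spline_ge0.
Qed.

(** The mirror image: y + n lies beyond 3, where the step equals 1, so n splines add up to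
    [1 - smoothstep y]. *)
Lemma smoothstep_le1 y : smoothstep y <= 1.
Proof.
have [n yn] : exists n : nat, 3 - y <= n%:R.
  exists (Num.trunc (3 - y)).+1; apply: ltW; exact: truncnS_gt.
have := sum_spline n (y + n%:R); rewrite (@smoothstep_ge3 (y + n%:R)); last lra.
rewrite addrK => h; have : 0 <= 1 - smoothstep y.
  by rewrite -h; apply: sumr_ge0 => k _; exact: spline_ge0.
by rewrite subr_ge0.
Qed.

End cubic_spline.

(** * Functions with a third-order Taylor bound and their closure properties *)

Section smooth.
Context {R : realType}.

(* [g1 x] and [g2 x] are the first two Taylor terms of [g] at [x]; the factor 1/2
   of the second derivative is part of [g2]. *)
Record smooth_with (V : normedModType R) (C : R) (g : V -> R)
    (g1 g2 : V -> V -> R) : Prop := SmoothWith {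
  smooth_bound : forall x, `|g x| <= C;
  smooth_linear1 : forall x a u v, g1 x (a *: u + v) = a * g1 x u + g1 x v;
  smooth_quadratic2 : forall x a u, g2 x (a *: u) = a ^+ 2 * g2 x u;
  smooth_bound1 : forall x u, `|g1 x u| <= C * `|u|;
  smooth_bound2 : forall x u, `|g2 x u| <= C * `|u| ^+ 2;
  smooth_lip : forall x u, `|g (x + u) - g x| <= C * `|u|;
  smooth_lip1 : forall x v u, `|g1 (x + v) u - g1 x u| <= C * (`|v| * `|u|);
  smooth_lip2 : forall x v u, `|g2 (x + v) u - g2 x u| <= C * (`|v| * `|u| ^+ 2);
  smooth_taylor1 : forall x u, `|g (x + u) - g x - g1 x u| <= C * `|u| ^+ 2;
  smooth_taylor2 : forall x u,
    `|g (x + u) - g x - g1 x u - g2 x u| <= C * `|u| ^+ 3 }.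

(** A single constant bounds all fields, since replacement errors must be uniform over all functions
    that share it. The Lipschitz and first-order bounds are recorded because the product rule
    consumes them. *)
Definition smooth (V : normedModType R) (g : V -> R) :=
  exists C g1 g2, smooth_with C g g1 g2.

Let normM_le (a b A B : R) : `|a| <= A -> `|b| <= B -> `|a * b| <= A * B.
Proof. by move=> aA bB; rewrite normrM ler_pM. Qed.

Let normD_le (a b A B : R) : `|a| <= A -> `|b| <= B -> `|a + b| <= A + B.
Proof. by move=> aA bB; rewrite (le_trans (ler_normD _ _))// lerD. Qed.

Section closure.
Context {V : normedModType R}.


Lemma smooth_ge0 C (g : V -> R) g1 g2 : smooth_with C g g1 g2 -> 0 <= C.
Proof. by move=> sg; rewrite (le_trans _ (smooth_bound sg 0)). Qed.

Lemma smooth_scale1 C (g : V -> R) g1 g2 :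
  smooth_with C g g1 g2 -> forall x a u, g1 x (a *: u) = a * g1 x u.
Proof.
move=> sg x a u; have z : g1 x 0 = 0.
  by have := smooth_linear1 sg x (-1) 0 0; rewrite scaler0 addr0; lra.
by rewrite -[a *: u]addr0 (smooth_linear1 sg) z addr0.
Qed.

Lemma smooth_continuous (g : V -> R) : smooth g -> continuous g.
Proof.
move=> [C [g1 [g2 sg]]] x; have C0 := smooth_ge0 sg.
apply/cvgrPdist_le => e e0; near=> y.
rewrite distrC (_ : g y = g (x + (y - x))); last by rewrite addrC subrK.
rewrite (le_trans (smooth_lip sg _ _))//.
have : `|y - x| <= e / (C + 1).
  rewrite distrC; near: y; apply: cvgr_dist_le => //.
  by rewrite divr_gt0// ltr_wpDl.
rewrite ler_pdivlMr ?ltr_wpDl// mulrDr mulr1 mulrC; apply: le_trans.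
by rewrite lerDl.
Unshelve. all: by end_near. Qed.

Lemma smooth_bmeas (g : V -> R) : smooth g -> bmeas (g : borel V -> R).
Proof.
move=> sg; split.
  by apply: measurable_continuous_borel; exact: smooth_continuous.
by case: sg => C [g1 [g2 sg]]; exists C; exact: smooth_bound sg.
Qed.

Lemma smooth_cst (c : R) : smooth (fun _ : V => c).
Proof.
exists `|c|, (fun _ _ => 0), (fun _ _ => 0); split => //= *;
  rewrite ?subrr ?subr0 ?normr0 ?mulr0 ?addr0//; by rewrite ?mulr_ge0 ?exprn_ge0.
Qed.

Lemma smoothD (g h : V -> R) : smooth g -> smooth h -> smooth (fun x => g x + h x).
Proof.
move=> [C [g1 [g2 sg]]] [D [h1 [h2 sh]]].
exists (C + D), (fun x u => g1 x u + h1 x u), (fun x u => g2 x u + h2 x u).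
split=> [x|x a u v|x a u|x u|x u|x u|x v u|x v u|x u|x u];
  rewrite ?(smooth_linear1 sg) ?(smooth_linear1 sh)
  ?(smooth_quadratic2 sg) ?(smooth_quadratic2 sh) ?[leRHS]mulrDl.
- exact: normD_le (smooth_bound sg _) (smooth_bound sh _).
- by rewrite mulrDr addrACA.
- by rewrite mulrDr.
- exact: normD_le (smooth_bound1 sg _ _) (smooth_bound1 sh _ _).
- exact: normD_le (smooth_bound2 sg _ _) (smooth_bound2 sh _ _).
- apply: le_trans (normD_le (smooth_lip sg x u) (smooth_lip sh x u)).
  by rewrite (_ : _ - _ = g (x + u) - g x + (h (x + u) - h x))//; ring.
- apply: le_trans (normD_le (smooth_lip1 sg x v u) (smooth_lip1 sh x v u)).
  by rewrite (_ : _ - _ = g1 (x + v) u - g1 x u + (h1 (x + v) u - h1 x u))//; ring.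
- apply: le_trans (normD_le (smooth_lip2 sg x v u) (smooth_lip2 sh x v u)).
  by rewrite (_ : _ - _ = g2 (x + v) u - g2 x u + (h2 (x + v) u - h2 x u))//; ring.
- apply: le_trans (normD_le (smooth_taylor1 sg x u) (smooth_taylor1 sh x u)).
  by rewrite (_ : _ - _ = g (x + u) - g x - g1 x u + (h (x + u) - h x - h1 x u))//; ring.
- apply: le_trans (normD_le (smooth_taylor2 sg x u) (smooth_taylor2 sh x u)).
  by rewrite (_ : _ - _ = g (x + u) - g x - g1 x u - g2 x u +
    (h (x + u) - h x - h1 x u - h2 x u))//; ring.
Qed.

Lemma smoothM (g h : V -> R) : smooth g -> smooth h -> smooth (fun x => g x * h x).
Proof.
move=> [C [g1 [g2 sg]]] [D [h1 [h2 sh]]].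
have C0 := smooth_ge0 sg; have D0 := smooth_ge0 sh.
have CD0 : 0 <= C * D by rewrite mulr_ge0.
(* The increment of the second-order term of a product splits into six products, more than any other
   field does. The cross term is g1 h1 without a factor 2 because the second-order terms carry the
   1/2. *)
exists (6 * (C * D)), (fun x u => g x * h1 x u + g1 x u * h x),
  (fun x u => g x * h2 x u + g1 x u * h1 x u + g2 x u * h x).
have fin (k m n A : R) : A = k * (m * n) -> 0 <= m -> 0 <= n -> k <= 6 ->
    A <= 6 * m * n.
  by move=> -> m0 n0 k6; rewrite -mulrA ler_wpM2r// mulr_ge0.
have e0 x : 0 <= `|x : V| by [].
split=> [x|x a u v|x a u|x u|x u|x u|x v u|x v u|x u|x u];
  rewrite ?(smooth_linear1 sg) ?(smooth_linear1 sh)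
  ?(smooth_quadratic2 sg) ?(smooth_quadratic2 sh).
- apply: le_trans (normM_le (smooth_bound sg _) (smooth_bound sh _)) _; lra.
- by ring.
- by rewrite (smooth_scale1 sg) (smooth_scale1 sh); ring.
- apply: le_trans (normD_le (normM_le (smooth_bound sg x) (smooth_bound1 sh x u))
    (normM_le (smooth_bound1 sg x u) (smooth_bound sh x))) _.
  by apply: (fin 2) => //; try lra; ring.
- apply: le_trans (normD_le (normD_le
    (normM_le (smooth_bound sg x) (smooth_bound2 sh x u))
    (normM_le (smooth_bound1 sg x u) (smooth_bound1 sh x u)))
    (normM_le (smooth_bound2 sg x u) (smooth_bound sh x))) _.
  by apply: (fin 3); rewrite ?sqr_ge0//; try lra; ring.
- rewrite (_ : _ - _ = (g (x + u) - g x) * h (x + u) + g x * (h (x + u) - h x)); last ring.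
  apply: le_trans (normD_le (normM_le (smooth_lip sg x u) (smooth_bound sh _))
    (normM_le (smooth_bound sg x) (smooth_lip sh x u))) _.
  by apply: (fin 2) => //; try lra; ring.
- rewrite (_ : _ - _ = (g (x + v) - g x) * h1 (x + v) u + g x * (h1 (x + v) u - h1 x u) +
    ((g1 (x + v) u - g1 x u) * h (x + v) + g1 x u * (h (x + v) - h x))); last ring.
  apply: le_trans (normD_le
    (normD_le (normM_le (smooth_lip sg x v) (smooth_bound1 sh _ u))
      (normM_le (smooth_bound sg x) (smooth_lip1 sh x v u)))
    (normD_le (normM_le (smooth_lip1 sg x v u) (smooth_bound sh _))
      (normM_le (smooth_bound1 sg x u) (smooth_lip sh x v)))) _.
  by apply: (fin 4); rewrite ?mulr_ge0//; try lra; ring.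
- rewrite (_ : _ - _ = (g (x + v) - g x) * h2 (x + v) u + g x * (h2 (x + v) u - h2 x u) +
    ((g1 (x + v) u - g1 x u) * h1 (x + v) u + g1 x u * (h1 (x + v) u - h1 x u)) +
    ((g2 (x + v) u - g2 x u) * h (x + v) + g2 x u * (h (x + v) - h x))); last ring.
  apply: le_trans (normD_le (normD_le
    (normD_le (normM_le (smooth_lip sg x v) (smooth_bound2 sh _ u))
      (normM_le (smooth_bound sg x) (smooth_lip2 sh x v u)))
    (normD_le (normM_le (smooth_lip1 sg x v u) (smooth_bound1 sh (x + v) u))
      (normM_le (smooth_bound1 sg x u) (smooth_lip1 sh x v u))))
    (normD_le (normM_le (smooth_lip2 sg x v u) (smooth_bound sh _))
      (normM_le (smooth_bound2 sg x u) (smooth_lip sh x v)))) _.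
  by apply: (fin 6); rewrite ?mulr_ge0 ?sqr_ge0//; try lra; ring.
- rewrite (_ : _ - _ = (g (x + u) - g x - g1 x u) * h (x + u) +
    g x * (h (x + u) - h x - h1 x u) + g1 x u * (h (x + u) - h x)); last ring.
  apply: le_trans (normD_le (normD_le
    (normM_le (smooth_taylor1 sg x u) (smooth_bound sh _))
    (normM_le (smooth_bound sg x) (smooth_taylor1 sh x u)))
    (normM_le (smooth_bound1 sg x u) (smooth_lip sh x u))) _.
  by apply: (fin 3); rewrite ?sqr_ge0//; try lra; ring.
- rewrite (_ : _ - _ = (g (x + u) - g x - g1 x u - g2 x u) * h (x + u) +
    g x * (h (x + u) - h x - h1 x u - h2 x u) +
    g1 x u * (h (x + u) - h x - h1 x u) + g2 x u * (h (x + u) - h x)); last ring.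
  apply: le_trans (normD_le (normD_le (normD_le
    (normM_le (smooth_taylor2 sg x u) (smooth_bound sh _))
    (normM_le (smooth_bound sg x) (smooth_taylor2 sh x u)))
    (normM_le (smooth_bound1 sg x u) (smooth_taylor1 sh x u)))
    (normM_le (smooth_bound2 sg x u) (smooth_lip sh x u))) _.
  by apply: (fin 4); rewrite ?exprn_ge0//; try lra; ring.
Qed.

Lemma smooth_sum (I : Type) (s : seq I) (F : I -> V -> R) :
  (forall i, smooth (F i)) -> smooth (fun x => \sum_(i <- s) F i x).
Proof.
move=> sF; elim: s => [|i s IH].
  rewrite (_ : (fun x => _) = (fun=> 0)); first exact: smooth_cst.
  by apply/funext => x; rewrite big_nil.
rewrite (_ : (fun x => _) = (fun x => F i x + \sum_(j <- s) F j x)).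
  exact: smoothD.
by apply/funext => x; rewrite big_cons.
Qed.

Lemma smooth_prod (I : Type) (s : seq I) (F : I -> V -> R) :
  (forall i, smooth (F i)) -> smooth (fun x => \prod_(i <- s) F i x).
Proof.
move=> sF; elim: s => [|i s IH].
  rewrite (_ : (fun x => _) = (fun=> 1)); first exact: smooth_cst.
  by apply/funext => x; rewrite big_nil.
rewrite (_ : (fun x => _) = (fun x => F i x * \prod_(j <- s) F j x)).
  exact: smoothM.
by apply/funext => x; rewrite big_cons.
Qed.

Let norm_convex (J : finType) (d : J -> R) (F : J -> R) (B : R) :
  (forall j, 0 <= d j) -> \sum_j d j = 1 -> (forall j, `|F j| <= B) ->
  `|\sum_j d j * F j| <= B.
Proof.
move=> d0 d1 FB; rewrite (le_trans (ler_norm_sum _ _ _))//.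
rewrite -[leRHS]mul1r -d1 mulr_suml ler_sum// => j _.
by rewrite normrM (ger0_norm (d0 j)) ler_wpM2l.
Qed.

(** A convex combination of translates inherits all bounds with the same [C]; hence the constants do
    not grow along the iteration over trials. *)
Lemma smooth_average (J : finType) (d : J -> R) (u : J -> V) C (g : V -> R) g1 g2 :
  (forall j, 0 <= d j) -> \sum_j d j = 1 -> smooth_with C g g1 g2 ->
  smooth_with C (fun x => \sum_j d j * g (x + u j))
    (fun x w => \sum_j d j * g1 (x + u j) w) (fun x w => \sum_j d j * g2 (x + u j) w).
Proof.
move=> d0 d1 sg; split => x; move=> *.
- by apply: norm_convex => // j; exact: smooth_bound sg _.
- rewrite mulr_sumr -big_split/=; apply: eq_bigr => j _.
  by rewrite (smooth_linear1 sg) mulrDr mulrCA.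
- by rewrite mulr_sumr; apply: eq_bigr => j _; rewrite (smooth_quadratic2 sg) mulrCA.
- by apply: norm_convex => // j; exact: smooth_bound1 sg _ _.
- by apply: norm_convex => // j; exact: smooth_bound2 sg _ _.
- rewrite -sumrB; under eq_bigr do rewrite -mulrBr (addrAC x).
  by apply: norm_convex => // j; exact: smooth_lip sg _ _.
- rewrite -sumrB; under eq_bigr do rewrite -mulrBr (addrAC x).
  by apply: norm_convex => // j; exact: smooth_lip1 sg _ _ _.
- rewrite -sumrB; under eq_bigr do rewrite -mulrBr (addrAC x).
  by apply: norm_convex => // j; exact: smooth_lip2 sg _ _ _.
- rewrite -!sumrB; under eq_bigr do rewrite -!mulrBr (addrAC x).
  by apply: norm_convex => // j; exact: smooth_taylor1 sg _ _.
- rewrite -!sumrB; under eq_bigr do rewrite -!mulrBr (addrAC x).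
  by apply: norm_convex => // j; exact: smooth_taylor2 sg _ _.
Qed.

End closure.

Lemma smooth_comp_affine (V W : normedModType R) (g : W -> R) (A : V -> W) (L : V -> W) (B : R) :
  1 <= B -> (forall x u, A (x + u) = A x + L u) ->
  (forall a u v, L (a *: u + v) = a *: L u + L v) -> (forall u, `|L u| <= B * `|u|) ->
  smooth g -> smooth (g \o A).
Proof.
move=> B1 AL LL LB [C [g1 [g2 sg]]]; have C0 := smooth_ge0 sg.
have B0 : 0 <= B by lra.
have L0 : L 0 = 0.
  by have := LL (-1) 0 0; rewrite scaler0 addr0 scaleN1r addNr.
have LZ a u : L (a *: u) = a *: L u by rewrite -[a *: u]addr0 LL L0 addr0.
(* With B >= 1 the power B^3 absorbs the factors 1, B and B^2 of the lower orders. *)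
have B2 : B <= B ^+ 3 by rewrite -[leLHS]expr1 ler_weXn2l.
have B3 : B ^+ 2 <= B ^+ 3 by rewrite ler_weXn2l.
have LBn u n : `|L u| ^+ n <= B ^+ n * `|u| ^+ n.
  by rewrite -exprMn lerXn2r ?nnegrE// mulr_ge0.
have B1' : 1 <= B ^+ 3 by rewrite -[leLHS](expr1n _ 3) lerXn2r ?nnegrE.
exists (C * B ^+ 3), (fun x u => g1 (A x) (L u)), (fun x u => g2 (A x) (L u)).
split => x; move=> *; rewrite /= ?AL ?LL ?LZ ?(smooth_linear1 sg)
  ?(smooth_quadratic2 sg)//.
- by rewrite (le_trans (smooth_bound sg _))// ler_peMr.
- apply: le_trans (smooth_bound1 sg _ _) _; rewrite -mulrA ler_wpM2l//.
  by rewrite (le_trans (LB _))// ler_wpM2r.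
- apply: le_trans (smooth_bound2 sg _ _) _; rewrite -mulrA ler_wpM2l//.
  by rewrite (le_trans (LBn _ _))// ler_wpM2r// sqr_ge0.
- apply: le_trans (smooth_lip sg _ _) _; rewrite -mulrA ler_wpM2l//.
  by rewrite (le_trans (LB _))// ler_wpM2r.
- apply: le_trans (smooth_lip1 sg _ _ _) _; rewrite -mulrA ler_wpM2l//.
  rewrite (le_trans (ler_pM _ _ (LB _) (LB _)))// mulrACA -expr2.
  by rewrite ler_wpM2r// mulr_ge0.
- apply: le_trans (smooth_lip2 sg _ _ _) _; rewrite -mulrA ler_wpM2l//.
  by rewrite (le_trans (ler_pM _ _ (LB _) (LBn _ 2)))// ?sqr_ge0// mulrACA -exprS.
- apply: le_trans (smooth_taylor1 sg _ _) _; rewrite -mulrA ler_wpM2l//.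
  by rewrite (le_trans (LBn _ _))// ler_wpM2r// sqr_ge0.
- apply: le_trans (smooth_taylor2 sg _ _) _; rewrite -mulrA ler_wpM2l//.
Qed.

Lemma smooth_spline : smooth (spline : R -> R).
Proof.
(* For |t| <= 1 the lower-order bounds follow from the next term of the expansion; for |t| >= 1
   every term is bounded by 1000. Two values and one derivative make 3000. *)
exists 3000, (fun y t => spline1 y * t), (fun y t => spline2 y * t ^+ 2).
have b y := @spline_bound R y.
have small (y t : R) : `|t| <= 1 \/ 1 <= `|t| by have [|/ltW] := leP `|t| 1; [left|right].
have bt (t : R) : 0 <= `|t| by [].
have T2 := @spline_taylor R.
have T1 (y t : R) : `|spline (y + t) - spline y - spline1 y * t| <= 3000 * `|t| ^+ 2.
  have [b0 b1 b2] := b y; have [b0' _ _] := b (y + t).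
  have [t1|t1] := small y t.
    rewrite (_ : _ - _ = spline (y + t) - spline y - spline1 y * t - spline2 y * t ^+ 2 +
      spline2 y * t ^+ 2); last ring.
    have h2 : `|spline2 y * t ^+ 2| <= 1000 * `|t| ^+ 2.
      by apply: normM_le => //; rewrite normrX.
    apply: le_trans (normD_le (T2 y t) h2) _.
    have : `|t| ^+ 3 <= `|t| ^+ 2 by rewrite ler_wiXn2l.
    by have := sqr_ge0 `|t|; lra.
  have h1 : `|spline1 y * t| <= 1000 * `|t| by exact: normM_le.
  apply: le_trans (normD_le (normD_le b0' _) _) _.
  + by rewrite normrN; exact: b0.
  + by rewrite normrN; exact: h1.
  have : `|t| ^+ 1 <= `|t| ^+ 2 by rewrite ler_weXn2l.
  by rewrite expr1; lra.
have T0 (y t : R) : `|spline (y + t) - spline y| <= 3000 * `|t|.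
  have [b0 b1 b2] := b y; have [b0' _ _] := b (y + t).
  have [t1|t1] := small y t.
    rewrite (_ : _ - _ = spline (y + t) - spline y - spline1 y * t - spline2 y * t ^+ 2 +
      spline2 y * t ^+ 2 + spline1 y * t); last ring.
    have h2 : `|spline2 y * t ^+ 2| <= 1000 * `|t| ^+ 2.
      by apply: normM_le => //; rewrite normrX.
    have h1 : `|spline1 y * t| <= 1000 * `|t| by exact: normM_le.
    apply: le_trans (normD_le (normD_le (T2 y t) h2) h1) _.
    have : `|t| ^+ 3 <= `|t| ^+ 1 by rewrite ler_wiXn2l.
    have : `|t| ^+ 2 <= `|t| ^+ 1 by rewrite ler_wiXn2l.
    by rewrite expr1; have := bt t; lra.
  apply: le_trans (normD_le b0' _) _; first by rewrite normrN; exact: b0.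
  by lra.
have D1 (y t : R) : `|spline1 (y + t) - spline1 y| <= 3000 * `|t|.
  have [b0 b1 b2] := b y; have [_ b1' _] := b (y + t).
  have [t1|t1] := small y t.
    rewrite (_ : _ - _ = spline1 (y + t) - spline1 y - 2 * spline2 y * t +
      2 * (spline2 y * t)); last ring.
    have h2 : `|spline2 y * t| <= 1000 * `|t| by exact: normM_le.
    have h2' : `|2 * (spline2 y * t)| <= 2 * (1000 * `|t|).
      by apply: normM_le h2; rewrite ger0_norm.
    apply: le_trans (normD_le (spline1_taylor y t) h2') _.
    have : `|t| ^+ 2 <= `|t| ^+ 1 by rewrite ler_wiXn2l.
    by rewrite expr1; have := bt t; lra.
  apply: le_trans (normD_le b1' _) _; first by rewrite normrN; exact: b1.
  by lra.
split.
- by move=> y; have [h _ _] := b y; lra.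
- by move=> y a u v; rewrite mulrDr; congr (_ + _); rewrite mulrCA.
- by move=> y a u; rewrite exprMn mulrCA.
- by move=> y u; have [_ h _] := b y; apply: normM_le => //; lra.
- move=> y u; have [_ _ h] := b y; rewrite normrM normrX ler_wpM2r ?sqr_ge0//; lra.
- exact: T0.
- move=> y v u; rewrite -mulrBl normrM [leRHS]mulrA ler_wpM2r//.
- move=> y v u; rewrite -mulrBl normrM normrX [leRHS]mulrA ler_wpM2r ?sqr_ge0//.
  apply: le_trans (spline2_lipschitz y v) _; have := bt v; lra.
- exact: T1.
- move=> y u; apply: le_trans (T2 y u) _; rewrite ler_wpM2r ?exprn_ge0//; lra.
Qed.

End smooth.

Section row_vector.
Context {R : realType} {m : nat}.
Local Notation V := ('rV[R]_m).
Implicit Types x v : 'rV[R]_m.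

Lemma coord_le_norm v b : `|v 0 b| <= `|v|.
Proof.
rewrite [leRHS]/Num.Def.normr/= mx_normrE; apply/bigmax_geP; right.
by exists (0, b).
Qed.

Lemma norm_le_coord v c : 0 <= c -> (forall b, `|v 0 b| <= c) -> `|v| <= c.
Proof.
move=> c0 vc; rewrite [leLHS]/Num.Def.normr/= mx_normrE.
apply/bigmax_leP; split => // -[i b] _ /=; by rewrite ord1.
Qed.

Definition box (c : R) : set 'rV[R]_m := [set v | forall b, `|v 0 b| <= c].

Lemma compact_box c : compact (box c).
Proof.
have := @rV_compact R m (fun=> `[- c, c]%classic) (fun=> @segment_compact _ _ _).
congr (compact _); apply/seteqP; split => v /= vc b.
  by have := vc b; rewrite in_itv/= ler_norml.
by have := vc b; rewrite in_itv/= -ler_norml.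
Qed.

(** Only [y] has to lie in [K]: in the application it is a grid node and [x] is any point near
    it. *)
Lemma continuous_uniform_on_compact (f : 'rV[R]_m -> R) (K : set 'rV[R]_m) (e : R) :
  continuous f -> compact K -> 0 < e ->
  exists2 d, 0 < d & forall y x, K y -> `|x - y| < d -> `|f x - f y| <= e.
Proof.
move=> cf /compact_near_coveringP cK e0.
have FR : Filter (at_right (0 : R)) by exact: at_right_proper_filter.
have := cK R (at_right 0) (fun d y => forall x, `|x - y| < d -> `|f x - f y| <= e) FR.
case.
  move=> y Ky.
  have e2 : 0 < e / 2 by rewrite divr_gt0.
  have /cvgrPdist_le/(_ _ e2)/nbhs_normP[r /= r0 fr] := cf y.
  exists ([set y' | `|y - y'| < r / 2], [set d : R | d < r / 2]).
    split => /=.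
      have := @nbhsx_ballx _ V y _ (divr_gt0 r0 (ltr0Sn R 1)); by rewrite -ball_normE.
    by apply: nbhs_right_lt; rewrite divr_gt0.
  move=> [y' d] [/= yy' dr] x xd.
  have h1 : `|f y - f y'| <= e / 2.
    by apply: fr => /=; rewrite (lt_trans yy')// ltr_pdivrMr// ltr_pMr// ltr1n.
  have h2 : `|f y - f x| <= e / 2.
    apply: fr => /=; rewrite (le_lt_trans (ler_distD y' _ _))// [ltRHS](splitr r).
    by rewrite ltrD// distrC (lt_trans xd).
  rewrite (le_trans (ler_distD (f y) _ _))// [leRHS](splitr e) lerD//.
  by rewrite distrC.
move=> d /= d0 h; exists (d / 2); first by rewrite divr_gt0.
move=> y x Ky; apply: h => //=; last by rewrite divr_gt0.
by rewrite sub0r normrN gtr0_norm ?divr_gt0// ltr_pdivrMr// ltr_pMr// ltr1n.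
Qed.

End row_vector.

(** * Quasi-interpolation by tensor-product splines *)

Section quasi_interpolation.
Context {R : realType} {m : nat}.
Local Notation V := ('rV[R]_m).

(** Spline of mesh 1/N in the coordinate b, supported between (k - M)/N and (k - M + 4)/N. *)
Let bump (N M k : nat) (b : 'I_m) (x : V) : R :=
  spline (N%:R * x 0 b + (M%:R - k%:R)).

Let smooth_bump N M k b : (0 < N)%N -> smooth (bump N M k b).
Proof.
move=> N0; pose A (x : V) : R := N%:R * x 0 b + (M%:R - k%:R).
apply: (@smooth_comp_affine _ _ _ spline A (fun u => N%:R * u 0 b) N%:R).
- by rewrite ler1n.
- by move=> x u; rewrite /A mxE; ring.
- by move=> a u v; rewrite !mxE /GRing.scale/=; ring.
- by move=> u; rewrite normrM ger0_norm// ler_wpM2l// coord_le_norm.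
- exact: smooth_spline.
Qed.

(** Each tensor spline is weighted by the value of [f] at the lower corner of its support, whose
    side 4/N is below the modulus of continuity; [chi] is the sum of the finitely many splines
    used. *)
Lemma quasi_interpolation (f : V -> R) (L : nat) (e : R) :
  continuous f -> 0 < e ->
  exists g chi : V -> R, [/\ smooth g, smooth chi,
    forall x, 0 <= chi x <= 1,
    forall x, box L%:R x -> chi x = 1 &
    forall x, `|f x * chi x - g x| <= e].
Proof.
move=> cf e0.
have [d d0 fd] := continuous_uniform_on_compact cf (@compact_box R m (L.+3)%:R) e0.
have [N N0 Nd] : exists2 N : nat, (0 < N)%N & 4 / N%:R < d.
  exists (Num.trunc (4 / d)).+1 => //; rewrite ltr_pdivrMr// mulrC -ltr_pdivrMr//.
  exact: truncnS_gt.
(* On the box of radius L one has N x + M >= 3 and N x + M - n <= 0, so each factor of [chi] is 1 -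
   0. The nodes run from -M/N to below L, within the radius L + 3 chosen above. *)
pose M := (N * L + 3)%N; pose n := (2 * (N * L) + 3)%N.
pose H (kap : {ffun 'I_m -> 'I_n}) (x : V) := \prod_b bump N M (kap b) b x.
pose grid (kap : {ffun 'I_m -> 'I_n}) : V := \row_b (((kap b)%:R - M%:R) / N%:R).
pose chi x := \sum_kap H kap x.
pose g x := \sum_kap f (grid kap) * H kap x.
have sH kap : smooth (H kap) by apply: smooth_prod => b; exact: smooth_bump.
have H0 kap x : 0 <= H kap x by apply: prodr_ge0 => b _; exact: spline_ge0.
have chiE x : chi x = \prod_b (smoothstep (N%:R * x 0 b + M%:R) -
    smoothstep (N%:R * x 0 b + M%:R - n%:R)).
  (* The sum over multi-indices factors into one sum per coordinate, and these telescope. *)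
  rewrite /chi /H -(bigA_distr_bigA (fun b (k : 'I_n) => bump N M k b x))/=; apply: eq_bigr => b _.
  by rewrite -sum_spline; apply: eq_bigr => k _; rewrite /bump addrA.
have N0' : 0 < N%:R :> R by rewrite ltr0n.
have chi01 x : 0 <= chi x <= 1.
  rewrite chiE; apply: (big_ind (fun t : R => 0 <= t <= 1)) => [|s t|b _].
  - by rewrite ler01 lexx.
  - by move=> /andP[s0 s1] /andP[t0 t1]; rewrite mulr_ge0//= mulr_ile1.
  apply/andP; split.
    by rewrite -sum_spline sumr_ge0// => k _; exact: spline_ge0.
  by rewrite (le_trans _ (smoothstep_le1 (N%:R * x 0 b + M%:R)))// gerBl smoothstep_ge0.
exists g, chi; split => //.
- by apply: smooth_sum => kap; apply: smoothM => //; exact: smooth_cst.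
- exact: smooth_sum.
- move=> x xL; rewrite chiE big1// => b _.
  have := xL b; rewrite ler_norml => /andP[xl xr].
  have h1 : N%:R * x 0 b <= N%:R * L%:R by rewrite ler_wpM2l.
  have h2 : - (N%:R * L%:R) <= N%:R * x 0 b by rewrite -mulrN ler_wpM2l.
  rewrite smoothstep_ge3; last by rewrite /M natrD natrM; lra.
  by rewrite smoothstep_le0 ?subr0// /M /n !natrD !natrM; lra.
move=> x.
rewrite /chi /g mulr_sumr -sumrB.
apply: (@le_trans _ _ (\sum_kap e * H kap x)); last first.
  rewrite -mulr_sumr ger_pMr//.
  by have /andP[_] := chi01 x.
rewrite (le_trans (ler_norm_sum _ _ _))// ler_sum// => kap _.
rewrite -mulrBl normrM (ger0_norm (H0 kap x)).
have [Hx0|Hx0] := eqVneq (H kap x) 0; first by rewrite Hx0 !mulr0.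
rewrite ler_wpM2r//.
have near b : 0 < N%:R * x 0 b + (M%:R - (kap b)%:R) < 4.
  have : bump N M (kap b) b x != 0.
    by apply: contra Hx0 => /eqP h; rewrite /H (bigD1 b)//= h mul0r.
  rewrite ltNge [X in _ && X]ltNge -negb_or; apply: contra => /orP h.
  by rewrite /bump; have [|->] := @spline_outside R (N%:R * x 0 b + (M%:R - (kap b)%:R)).
have kapn b : (kap b)%:R <= n%:R :> R by rewrite ler_nat ltnW.
have kap0 b : 0 <= (kap b)%:R :> R by [].
apply: fd.
  move=> b; rewrite mxE normrM normfV (ger0_norm (ltW N0')) ler_pdivrMr// ler_norml.
  have h3 : 3 <= 3 * N%:R :> R by rewrite ler_peMr// ler1n.
  have := kapn b; have := kap0 b.
  have -> : L.+3%:R = L%:R + 3 :> R by rewrite -addn3 natrD.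
  rewrite /M /n !natrD !natrM => ? ?; apply/andP; split; lra.
apply: le_lt_trans Nd; apply: norm_le_coord; first by rewrite divr_ge0.
move=> b; rewrite !mxE -(ler_pM2l N0') -{1}(ger0_norm (ltW N0')) -normrM.
have -> : N%:R * (x 0 b - ((kap b)%:R - M%:R) / N%:R) = N%:R * x 0 b + (M%:R - (kap b)%:R).
  by field; rewrite gt_eqF.
rewrite mulrCA divff ?mulr1 ?gt_eqF// ger0_norm; have /andP[] := near b; lra.
Qed.

End quasi_interpolation.

(** * Comparison of multinomial and Gaussian steps *)

Section gaussian_expansion.
Context {R : realType} {V : normedModType R}.
Local Notation gauss := (@normal_prob R 0 1).

Let integrable_gauss_quad (a b c : R) :
  gauss.-integrable setT (EFin \o (fun z : R => a + b * z + c * z ^+ 2)).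
Proof.
rewrite (_ : _ \o _ = (fun z : R => (a%:E + b%:E * z%:E + c%:E * (z ^+ 2)%:E)%E)).
  apply: integrableD => //; last by apply: integrableZl => //; exact: integrable_gauss_sqr.
  apply: integrableD => //; first exact: finite_measure_integrable_cst.
  by apply: integrableZl => //; exact: integrable_gauss_id.
by apply/funext => z.
Qed.

Let Rintegral_gauss_quad (a b c : R) :
  \int[gauss]_z (a + b * z + c * z ^+ 2) = a + c.
Proof.
have ib : gauss.-integrable setT (EFin \o (fun z : R => b * z)).
  rewrite (_ : _ \o _ = (fun z : R => (b%:E * z%:E)%E))//.
  by apply: integrableZl => //; exact: integrable_gauss_id.
have ic : gauss.-integrable setT (EFin \o (fun z : R => c * z ^+ 2)).
  rewrite (_ : _ \o _ = (fun z : R => (c%:E * (z ^+ 2)%:E)%E))//.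
  by apply: integrableZl => //; exact: integrable_gauss_sqr.
have ia : gauss.-integrable setT (EFin \o (fun z : R => a)).
  exact: finite_measure_integrable_cst.
rewrite RintegralD//; last first.
  rewrite (_ : _ \o _ = (fun z : R => (a%:E + (b * z)%:E)%E))//.
  exact: integrableD.
rewrite RintegralD// RintegralZl//; last exact: integrable_gauss_id.
rewrite RintegralZl//; last exact: integrable_gauss_sqr.
rewrite Rintegral_gauss_id Rintegral_gauss_sqr mulr0 addr0 mulr1.
by rewrite Rintegral_cst_prob.
Qed.

(** Mean 0 removes the linear term and variance 1 keeps [c]: a pointwise quadratic expansion becomes
    an expansion of the Gaussian average. *)
Lemma Rintegral_gauss_approx (h : R -> R) (a b c A B : R) : bmeas h ->
  (forall z, `|h z - (a + b * z + c * z ^+ 2)| <= A + B * (1 + `|z| ^+ 3)) ->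
  `|\int[gauss]_z h z - (a + c)| <= A + B * \int[gauss]_z (1 + `|z| ^+ 3).
Proof.
move=> bh hz.
have ih := @bmeas_integrable _ _ _ gauss _ bh.
have i3 := @integrable_gauss_cube R.
have iB : gauss.-integrable setT (EFin \o (fun z : R => B * (1 + `|z| ^+ 3))).
  rewrite (_ : _ \o _ = (fun z : R => (B%:E * (1 + `|z| ^+ 3)%:E)%E))//.
  exact: integrableZl.
have iAB : gauss.-integrable setT (EFin \o (fun z : R => A + B * (1 + `|z| ^+ 3))).
  rewrite (_ : _ \o _ = (fun z : R => (A%:E + (B * (1 + `|z| ^+ 3))%:E)%E))//.
  by apply: integrableD => //; exact: finite_measure_integrable_cst.
have iD : gauss.-integrable setT (EFin \o (fun z : R => h z - (a + b * z + c * z ^+ 2))).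
  rewrite (_ : _ \o _ = (fun z : R => ((h z)%:E - (a + b * z + c * z ^+ 2)%:E)%E))//.
  by apply: integrableB => //; exact: integrable_gauss_quad.
rewrite -(Rintegral_gauss_quad a b c) -RintegralB; [|by []|exact: ih|exact: (integrable_gauss_quad a b c)].
rewrite (le_trans (le_normr_Rintegral _ _))//.
apply: (@le_trans _ _ (\int[gauss]_z (A + B * (1 + `|z| ^+ 3)))).
  by apply: le_Rintegral => //; exact: integrable_norm.
rewrite RintegralD//; last exact: finite_measure_integrable_cst.
by rewrite Rintegral_cst_prob RintegralZl.
Qed.

(** [A] depends on [g] through the Taylor constant only, so the same [A] serves every function met
    in the iteration. *)
Lemma gsteps_expansion (C : R) (N : nat) : 0 <= C ->
  exists2 A : R, 0 <= A & forall (g : V -> R) g1 g2, smooth_with C g g1 g2 ->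
    forall (ws : seq V) (b : R), size ws = N -> 0 <= b ->
    (forall w, w \in ws -> `|w| <= b) ->
    forall x, `|gsteps ws g x - g x - \sum_(w <- ws) g2 x w| <= A * b ^+ 3.
Proof.
move=> C0; elim: N => [|N [A A0 IH]].
  exists 0 => // g g1 g2 _ [|//] b _ _ _ x /=.
  by rewrite big_nil subrr subr0 normr0 mul0r.
set m3 := \int[gauss]_z (1 + `|z| ^+ 3) : R.
have m30 : 0 <= m3.
  by apply: Rintegral_ge0 => z _; rewrite addr_ge0// exprn_ge0.
exists (A + C * N.+1%:R * m3); first by rewrite addr_ge0// !mulr_ge0.
move=> g g1 g2 sg [//|w ws] b [sws] b0 wb x.
have bg : bmeas (g : borel V -> R) by apply: smooth_bmeas; exists C, g1, g2.
have wsb w' : w' \in ws -> `|w'| <= b.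
  by move=> w'ws; apply: wb; rewrite inE w'ws orbT.
have wb0 : `|w| <= b by apply: wb; rewrite inE eqxx.
have {}IH := IH g g1 g2 sg ws b sws b0 wsb.
rewrite big_cons /= /gstep.
set S := \sum_(w' <- ws) g2 x w'.
rewrite (_ : _ - _ - _ = \int[gauss]_z gsteps ws g (x + z *: w) -
  (g x + S + g2 x w)); last by ring.
rewrite mulrDl (_ : _ * m3 * _ = C * N.+1%:R * b ^+ 3 * m3); last by ring.
apply: (@Rintegral_gauss_approx _ _ (g1 x w)).
  by apply: bmeas_line; exact: bmeas_gsteps.
move=> z.
have zc : `|z| <= 1 + `|z| ^+ 3.
  have [z1|/ltW z1] := leP `|z| 1.
    by rewrite (le_trans z1)// lerDl exprn_ge0.
  by apply: (@le_trans _ _ (`|z| ^+ 3)); rewrite ?lerDr// -[leLHS]expr1 ler_weXn2l.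
have hS : `|\sum_(w' <- ws) g2 (x + z *: w) w' - S| <= C * N%:R * b ^+ 3 * (1 + `|z| ^+ 3).
  rewrite /S -sumrB (le_trans (ler_norm_sum _ _ _))//.
  apply: (@le_trans _ _ (\sum_(w' <- ws) C * b ^+ 3 * (1 + `|z| ^+ 3))).
    rewrite big_seq [leRHS]big_seq; apply: ler_sum => w' w'ws.
    rewrite (le_trans (smooth_lip2 sg _ _ _))// -[leRHS]mulrA ler_wpM2l//.
    rewrite normrZ -mulrA [leRHS]mulrC ler_pM ?mulr_ge0 ?sqr_ge0//.
    by rewrite [leRHS]exprS ler_pM ?sqr_ge0// lerXn2r ?nnegrE ?wsb.
  by rewrite big_const_seq count_predT sws iter_addr_0 -[leLHS]mulr_natl; lra.
have hT : `|g (x + z *: w) - g x - z * g1 x w - z ^+ 2 * g2 x w| <=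
    C * b ^+ 3 * (1 + `|z| ^+ 3).
  have := smooth_taylor2 sg x (z *: w).
  rewrite (smooth_scale1 sg) (smooth_quadratic2 sg) => h.
  rewrite (le_trans h)// -mulrA ler_wpM2l// normrZ exprMn mulrC.
  rewrite ler_pM ?exprn_ge0//; last by rewrite lerDr.
  by rewrite lerXn2r ?nnegrE.
(* Three errors: the remaining directions from the displaced point, the displacement of their
   quadratic terms, and the Taylor remainder along [w]. *)
rewrite (_ : _ - _ =
   (gsteps ws g (x + z *: w) - g (x + z *: w) - \sum_(w' <- ws) g2 (x + z *: w) w') +
   ((\sum_(w' <- ws) g2 (x + z *: w) w' - S) +
   (g (x + z *: w) - g x - z * g1 x w - z ^+ 2 * g2 x w))); last by ring.
rewrite (le_trans (ler_normD _ _))// lerD//.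
rewrite (le_trans (ler_normD _ _))// (le_trans (lerD hS hT))//.
by rewrite -natr1; lra.
Qed.

Lemma gsteps_contraction (ws : seq V) (f h : V -> R) (B : R) :
  bmeas (f : borel V -> R) -> bmeas (h : borel V -> R) ->
  (forall x, `|f x - h x| <= B) -> forall x, `|gsteps ws f x - gsteps ws h x| <= B.
Proof.
move=> bf bh fhB; elim: ws => //= w ws IH x.
have bl f' : bmeas (f' : borel V -> R) -> bmeas (fun z : R => gsteps ws f' (x + z *: w)).
  by move=> bf'; apply: bmeas_line; exact: bmeas_gsteps.
rewrite /gstep -RintegralB//; [|exact/bmeas_integrable/bl..].
by apply: le_norm_Rintegral_prob => //; apply: bmeasB; exact: bl.
Qed.

End gaussian_expansion.

Section multinomial_step.
Context {R : realType} {V : normedModType R} {J : finType}.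
Variables (d : J -> R) (u : J -> V).
Hypotheses (d0 : forall j, 0 <= d j) (d1 : \sum_j d j = 1)
  (du : \sum_j d j *: u j = 0).

Definition tstep (c : R) (f : V -> R) (x : V) : R := \sum_j d j * f (x + c *: u j).

(** The weights give the covariance sum_j d_j u_j (x) u_j of one trial, whose displacements have
    mean zero. *)
Definition gauss_dirs : seq V := [seq Num.sqrt (d j) *: u j | j <- index_enum J].

Let b : R := \sum_j `|u j|.

Let ub j : `|u j| <= b.
Proof. by rewrite /b (bigD1 j)//= lerDl sumr_ge0. Qed.

Let b0 : 0 <= b. Proof. by apply: sumr_ge0. Qed.

Let linear_sum0 C g g1 g2 (c : R) x : smooth_with C g g1 g2 ->
  \sum_j d j * g1 x (c *: u j) = 0.
Proof.
move=> sg.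
have h (s : seq J) : \sum_(j <- s) d j * g1 x (c *: u j) =
    c * g1 x (\sum_(j <- s) d j *: u j).
  elim: s => [|j s IH]; first by rewrite !big_nil -[0 in RHS](scaler0 V 0) (smooth_scale1 sg) mul0r mulr0.
  by rewrite !big_cons IH (smooth_linear1 sg) (smooth_scale1 sg); ring.
by rewrite h du -[0 in LHS](scaler0 V 0) (smooth_scale1 sg) mul0r mulr0.
Qed.

(** Both operators have the second-order expansion g + sum_j d_j g2 (c u_j): centering kills the
    first-order term of the trial, and g2 turns each square root into d_j. *)
Lemma tstep_gsteps (C : R) : 0 <= C -> exists2 K : R, 0 <= K &
  forall (g : V -> R) g1 g2, smooth_with C g g1 g2 -> forall c x, 0 <= c ->
    `|tstep c g x - gsteps [seq c *: w | w <- gauss_dirs] g x| <= K * c ^+ 3.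
Proof.
move=> C0; have [A A0 hA] := @gsteps_expansion R V C #|J| C0.
exists ((C + A) * b ^+ 3); first by rewrite mulr_ge0 ?exprn_ge0 ?addr_ge0.
move=> g g1 g2 sg c x c0.
have dle1 j : d j <= 1 by rewrite -d1 (bigD1 j)//= lerDl sumr_ge0.
have sz : size [seq c *: w | w <- gauss_dirs] = #|J|.
  by rewrite /gauss_dirs !size_map cardT enumT [index_enum _]unlock.
have hw w : w \in [seq c *: w | w <- gauss_dirs] -> `|w| <= c * b.
  move=> /mapP[_ /mapP[j _ ->] ->]; rewrite !normrZ ger0_norm//.
  rewrite ler_wpM2l// ger0_norm ?sqrtr_ge0// -[leRHS]mul1r ler_pM ?sqrtr_ge0//.
  by rewrite -[leRHS]sqrtr1 ler_wsqrtr.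
have := hA g g1 g2 sg _ (c * b) sz (mulr_ge0 c0 b0) hw x.
set G := gsteps _ _ _; rewrite !big_map/= => hG.
have hT : `|tstep c g x - g x - \sum_j d j * g2 x (c *: u j)| <= C * (c * b) ^+ 3.
  have -> : tstep c g x - g x - \sum_j d j * g2 x (c *: u j) =
      \sum_j d j * (g (x + c *: u j) - g x - g1 x (c *: u j) - g2 x (c *: u j)).
    under [RHS]eq_bigr do rewrite !mulrBr.
    rewrite !sumrB -[X in _ - X - _ - _]mulr_suml d1 mul1r (linear_sum0 _ _ sg).
    by rewrite subr0.
  rewrite (le_trans (ler_norm_sum _ _ _))//.
  rewrite -[leRHS]mul1r -d1 mulr_suml ler_sum// => j _.
  rewrite normrM (ger0_norm (d0 j)) ler_wpM2l//.
  rewrite (le_trans (smooth_taylor2 sg _ _))// ler_wpM2l//.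
  by rewrite lerXn2r ?nnegrE ?mulr_ge0// normrZ ger0_norm// ler_wpM2l.
have e : \sum_j g2 x (c *: (Num.sqrt (d j) *: u j)) = \sum_j d j * g2 x (c *: u j).
  apply: eq_bigr => j _.
  by rewrite scalerA mulrC -scalerA (smooth_quadratic2 sg) sqr_sqrtr.
rewrite e in hG.
rewrite (_ : _ - _ = (tstep c g x - g x - \sum_j d j * g2 x (c *: u j)) -
  (G - g x - \sum_j d j * g2 x (c *: u j))); last by ring.
rewrite (le_trans (ler_normB _ _))// (le_trans (lerD hT hG))//.
by rewrite le_eqVlt; apply/orP; left; apply/eqP; ring.
Qed.

Lemma smooth_tstep C c (g : V -> R) : (exists g1 g2, smooth_with C g g1 g2) ->
  exists g1 g2, smooth_with C (tstep c g) g1 g2.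
Proof.
by move=> [g1 [g2 sg]]; do 2 eexists; exact: (smooth_average _ d0 d1 sg).
Qed.

(** The right-hand side is affine in [chi] and the weights add up to 1, so this shape of error
    passes through any number of averages. *)
Lemma tstep_le (f g chi : V -> R) (C e c : R) :
  (forall x, `|f x - g x| <= C * (1 - chi x) + e) ->
  forall x, `|tstep c f x - tstep c g x| <= C * (1 - tstep c chi x) + e.
Proof.
move=> fg x; rewrite /tstep -sumrB (le_trans (ler_norm_sum _ _ _))//.
rewrite [leRHS](_ : _ = \sum_j d j * (C * (1 - chi (x + c *: u j)) + e)).
  apply: ler_sum => j _.
  by rewrite -mulrBr normrM (ger0_norm (d0 j)) ler_wpM2l.
under [RHS]eq_bigr do rewrite mulrDr mulrCA mulrBr mulr1.
by rewrite big_split/= -mulr_sumr sumrB d1 -mulr_suml d1 mul1r.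
Qed.

End multinomial_step.

(** * Replacement of all trials by Gaussian steps *)

Section trotter.
Context {R : realType} {V : normedModType R} {I : finType} {J : I -> finType}.
Variables (d : forall i, J i -> R) (u : forall i, J i -> V).
Arguments d : clear implicits.
Arguments u : clear implicits.
Hypotheses (d0 : forall i j, 0 <= d i j) (d1 : forall i, \sum_j d i j = 1)
  (du : forall i, \sum_j d i j *: u i j = 0).

Definition trials (r : nat) : seq (I * 'I_r) :=
  [seq (i, l) | i <- index_enum I, l <- index_enum 'I_r].

Definition titer r (s : seq (I * 'I_r)) (c : R) (f : V -> R) : V -> R :=
  foldr (fun a => tstep (d a.1) (u a.1) c) f s.

Definition clt_dirs : seq V :=
  flatten [seq gauss_dirs (d i) (u i) | i <- index_enum I].

Let gstep1 (c : R) (i : I) : (V -> R) -> V -> R :=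
  gsteps [seq c *: w | w <- gauss_dirs (d i) (u i)].

Let giter r (s : seq (I * 'I_r)) (c : R) (f : V -> R) : V -> R :=
  foldr (fun a => gstep1 c a.1) f s.

Let bmeas_giter r (s : seq (I * 'I_r)) (c : R) (f : V -> R) :
  bmeas (f : borel V -> R) -> bmeas (giter s c f : borel V -> R).
Proof. by move=> bf; elim: s => //= a s IH; exact: bmeas_gsteps. Qed.

(** [trials] lists the repetitions of one observable consecutively, so its r.+1 equal Gaussian steps
    merge exactly by [gsteps_iter]. *)
Let giter_trials r (f : V -> R) : bmeas (f : borel V -> R) ->
  giter (trials r.+1) (Num.sqrt (r.+1%:R^-1)) f = gsteps clt_dirs f.
Proof.
move=> bf; rewrite /giter /trials /clt_dirs.
have szr : size (index_enum 'I_r.+1) = r.+1.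
  by rewrite [index_enum _]unlock -enumT size_enum_ord.
elim: (index_enum I) => //= i s IH.
rewrite foldr_cat IH /gsteps foldr_cat -/(gsteps _ _) -/(gsteps _ _).
set h := gsteps _ f; have bh : bmeas (h : borel V -> R) by exact: bmeas_gsteps.
rewrite -[RHS](gsteps_iter _ r bh).
have E (t : seq 'I_r.+1) :
    foldr (fun a => gstep1 (Num.sqrt r.+1%:R^-1) a.1) h [seq (i, l) | l <- t] =
    iter (size t) (gstep1 (Num.sqrt r.+1%:R^-1) i) h.
  by elim: t => //= l t ->.
by rewrite E szr.
Qed.

Let smooth_titer r (s : seq (I * 'I_r)) c C (g : V -> R) :
  (exists g1 g2, smooth_with C g g1 g2) ->
  exists g1 g2, smooth_with C (titer s c g) g1 g2.
Proof. by move=> sg; elim: s => //= a s IH; exact: smooth_tstep. Qed.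

Lemma titer_le r (s : seq (I * 'I_r)) (f g chi : V -> R) (C e c : R) :
  (forall x, `|f x - g x| <= C * (1 - chi x) + e) ->
  forall x, `|titer s c f x - titer s c g x| <= C * (1 - titer s c chi x) + e.
Proof. by move=> fg; elim: s => //= a s IH; exact: tstep_le. Qed.

Lemma titer_gsteps (g : V -> R) : smooth g -> exists2 K : R, 0 <= K &
  forall r x, `|titer (trials r.+1) (Num.sqrt (r.+1%:R^-1)) g x - gsteps clt_dirs g x|
    <= K * Num.sqrt (r.+1%:R^-1).
Proof.
move=> [C sg]; have C0 : 0 <= C by case: sg => g1 [g2 /smooth_ge0].
have /choice[K hK] : forall i, exists K : R, 0 <= K /\
    forall (g : V -> R) g1 g2, smooth_with C g g1 g2 -> forall c x, 0 <= c ->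
    `|tstep (d i) (u i) c g x - gstep1 c i g x| <= K * c ^+ 3.
  by move=> i; apply/exists2P; exact: tstep_gsteps.
pose B := \sum_i K i.
have B0 : 0 <= B by apply: sumr_ge0 => i _; have [] := hK i.
have KB i : K i <= B.
  by rewrite /B (bigD1 i)//= lerDl sumr_ge0// => i' _; have [] := hK i'.
exists (#|I|%:R * B); first by rewrite mulr_ge0.
move=> r x; set c := Num.sqrt _.
have c0 : 0 <= c by exact: sqrtr_ge0.
have bg : bmeas (g : borel V -> R) by apply: smooth_bmeas; exists C.
(* One replacement per trial: the head is replaced on [titer s c g], still bounded by the same [C],
   and the error of the tail passes through a contraction. With |I| (r+1) trials and c^2 = 1/(r+1),
   the total is |I| B c. *)
have h (s : seq (I * 'I_r.+1)) y :
    `|titer s c g y - giter s c g y| <= (size s)%:R * (B * c ^+ 3).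
  elim: s y => [|a s IH] y /=; first by rewrite subrr normr0 mul0r.
  rewrite -natr1 mulrDl mul1r [leRHS]addrC (le_trans (ler_distD (gstep1 c a.1 (titer s c g) y) _ _))//.
  have [g1 [g2 sgs]] := smooth_titer s c sg.
  have bt : bmeas (titer s c g : borel V -> R).
    by apply: smooth_bmeas; exists C, g1, g2.
  rewrite lerD//.
    have [_ hKa] := hK a.1.
    by rewrite (le_trans (hKa _ _ _ sgs _ _ c0))// ler_wpM2r// exprn_ge0.
  by apply: gsteps_contraction => //; exact: bmeas_giter.
rewrite -(giter_trials r bg); apply: le_trans (h _ _) _.
have szr n : size (index_enum 'I_n) = n.
  by rewrite [index_enum _]unlock -enumT size_enum_ord.
have szI : size (index_enum I) = #|I|.
  by rewrite cardT enumT [index_enum _]unlock.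
rewrite /trials size_allpairs szr szI natrM (exprSr c 2).
rewrite (_ : c ^+ 2 = r.+1%:R^-1); last by rewrite sqr_sqrtr// invr_ge0.
rewrite le_eqVlt; apply/orP; left; apply/eqP.
have := pnatr_eq0 R r.+1; move: (r.+1%:R : R) => n /= n0; field; by rewrite n0.
Qed.

End trotter.

(** * Central limit theorem for bounded continuous functions *)

Section central_limit.
Context {R : realType} {m : nat} {I : finType} {J : I -> finType}.
Local Notation V := ('rV[R]_m).
Variables (d : forall i, J i -> R) (u : forall i, J i -> V).
Arguments d : clear implicits.
Arguments u : clear implicits.
Hypotheses (d0 : forall i j, 0 <= d i j) (d1 : forall i, \sum_j d i j = 1)
  (du : forall i, \sum_j d i j *: u i j = 0).

Lemma tight (P : probability (borel V) R) (e : R) : 0 < e ->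
  exists L : nat, measurable (box L%:R : set (borel V)) /\ 1 - e <= fine (P (box L%:R)).
Proof.
move=> e0.
have mbox c : measurable (box c : set (borel V)).
  rewrite (_ : box c = \bigcap_b ((fun v : borel V => `|v 0 b|) @^-1` `]-oo, c])).
    apply: fin_bigcap_measurable => // b _; rewrite -[X in measurable X]setTI.
    apply: (measurable_continuous_borel (f := fun v : V => `|v 0 b|)) => //.
    move=> v; apply: (cvg_comp _ _ (@coord_continuous R _ _ 0 b v)).
    exact: norm_continuous.
  by apply/seteqP; split => v /= vc b; [move=> _|]; have := vc b; rewrite /= in_itv//=; exact.
have : P (box n%:R : set (borel V)) @[n --> \oo] --> 1%E.
  rewrite -(probability_setT P) (_ : setT = \bigcup_n (box n%:R : set (borel V))).
    apply: nondecreasing_cvg_mu => //; first exact: bigcup_measurable.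
    move=> n k nk; apply/subsetPset => v vn b.
    by rewrite (le_trans (vn b))// ler_nat.
  apply/seteqP; split => // v _.
  exists (Num.trunc `|v : V|).+1 => // b.
  by rewrite (le_trans (coord_le_norm _ _))// ltW// truncnS_gt.
move=> /fine_cvg/cvgrPdist_le/(_ _ e0)[L _ /(_ L (leqnn L)) h].
exists L; split => //; move: h => /=; rewrite ler_norml => /andP[_]; lra.
Qed.

Let cvg_smooth (g : V -> R) (e : R) : smooth g -> 0 < e ->
  \forall r \near \oo, `|titer d u (trials r) (Num.sqrt (r%:R^-1)) g 0 -
     gsteps (clt_dirs d u) g 0| <= e.
Proof.
move=> sg e0; have [K K0 hK] := titer_gsteps d0 d1 du sg.
near=> r.
have r0 : (0 < r)%N by near: r; exists 1%N.
(* This makes the error K / sqrt r at most [e]. *)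
have rK : (K / e) ^+ 2 <= r%:R by near: r; exact: nbhs_infty_ger.
move: rK; rewrite -(prednK r0); set r' := r.-1 => rK.
rewrite (le_trans (hK r' 0))//.
rewrite -(ger0_norm K0) -sqrtr_sqr -sqrtrM ?sqr_ge0//.
rewrite -[leRHS](ger0_norm (ltW e0)) -sqrtr_sqr ler_wsqrtr//.
rewrite ler_pdivrMr ?ltr0n//; move: rK.
by rewrite exprMn exprVn ler_pdivrMr ?exprn_gt0// mulrC.
Unshelve. all: by end_near. Qed.

Theorem central_limit (f : V -> R) (C : R) : continuous f -> (forall x, `|f x| <= C) ->
  titer d u (trials r) (Num.sqrt (r%:R^-1)) f 0 @[r --> \oo] -->
  \int[gauss_law (clt_dirs d u)]_x f x.
Proof.
move=> cf fC; set P := gauss_law _.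
have C0 : 0 <= C by rewrite (le_trans _ (fC 0)).
apply/cvgrPdist_le => e e0.
(* Mass [eta] outside the box costs at most C eta <= e/8; the summand 1 guards against C = 0. *)
pose eta := e / 8 / (C + 1).
have eta0 : 0 < eta by rewrite !divr_gt0// ltr_wpDl.
have Ceta : C * eta <= e / 8.
  rewrite /eta mulrCA -[leRHS]mulr1 ler_wpM2l ?divr_ge0 ?ltW//.
  by rewrite ltr_pdivrMr ?mul1r ?ltrDl// ltr_wpDl.
have [L [mL PL]] := tight P eta0.
have e8 : 0 < e / 8 by rewrite divr_gt0.
have [g [chi [sg schi chi01 chiL fg]]] := quasi_interpolation L cf e8.
have bf : bmeas (f : borel V -> R).
  by split; [exact: measurable_continuous_borel|exists C].
have bg := smooth_bmeas sg; have bchi := smooth_bmeas schi.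
have {}fg x : `|f x - g x| <= C * (1 - chi x) + e / 8.
  rewrite (_ : f x - g x = f x * (1 - chi x) + (f x * chi x - g x)); last by ring.
  rewrite (le_trans (ler_normD _ _))// lerD//.
  have /andP[_ c1] := chi01 x.
  by rewrite normrM [X in _ * X]ger0_norm ?subr_ge0// ler_wpM2r// subr_ge0.
have ichi : 1 - eta <= \int[P]_x chi x.
  rewrite (le_trans PL)//.
  have -> : fine (P (box L%:R)) = \int[P]_x \1_(box L%:R) x.
    by rewrite /Rintegral integral_indic// setIT.
  apply: le_Rintegral => //.
  - apply: bmeas_integrable; split; first exact: measurable_indic.
    by exists 1 => x; rewrite indicE; case: (_ \in _); rewrite ?normr1 ?normr0.
  - exact: bmeas_integrable.
  - move=> x _; rewrite indicE; have [/set_mem xL|_] := boolP (x \in box L%:R).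
      by rewrite (chiL x xL).
    by have /andP[] := chi01 x.
have bound : bmeas (fun x : borel V => C * (1 - chi x) + e / 8).
  apply: bmeasD; last exact: bmeas_cst.
  by apply: bmeasZ; apply: bmeasB => //; exact: bmeas_cst.
have hP : `|\int[P]_x f x - \int[P]_x g x| <= C * (1 - \int[P]_x chi x) + e / 8.
  rewrite -RintegralB//; [|exact: bmeas_integrable..].
  rewrite (le_trans (le_normr_Rintegral _ _))//.
    by apply: bmeas_integrable; exact: bmeasB.
  apply: (@le_trans _ _ (\int[P]_x (C * (1 - chi x) + e / 8))).
    apply: le_Rintegral => //; last exact: bmeas_integrable.
    by apply: integrable_norm => //; apply: bmeas_integrable; exact: bmeasB.
  rewrite RintegralD//; last 2 first.
    by apply: bmeas_integrable; apply: bmeasZ; apply: bmeasB => //; exact: bmeas_cst.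
    by apply: bmeas_integrable; exact: bmeas_cst.
  rewrite RintegralZl//; last first.
    by apply: bmeas_integrable; apply: bmeasB => //; exact: bmeas_cst.
  rewrite RintegralB//; [|apply: bmeas_integrable; exact: bmeas_cst|exact: bmeas_integrable].
  by rewrite !Rintegral_cst_prob.
near=> r.
have hg : `|titer d u (trials r) (Num.sqrt (r%:R^-1)) g 0 - \int[P]_x g x| <= e / 8.
  by rewrite Rintegral_gauss_law//; near: r; exact: cvg_smooth.
have hchi : `|titer d u (trials r) (Num.sqrt (r%:R^-1)) chi 0 - \int[P]_x chi x| <= eta.
  by rewrite Rintegral_gauss_law//; near: r; exact: cvg_smooth.
have hf := @titer_le _ _ _ _ d u d0 d1 _ (trials r) _ _ _ _ _ (Num.sqrt (r%:R^-1)) fg 0.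
move: hf hg hchi hP.
set a := titer _ _ _ _ f 0; set b := titer _ _ _ _ g 0; set c := titer _ _ _ _ chi 0.
move=> hf hg hchi hP.
(* Tightness of the trials: their average of [chi] is within [eta] of the Gaussian one, hence at
   least 1 - 2 eta. *)
have hc : C * (1 - c) <= e / 4.
  have : C * (1 - c) <= C * (2 * eta).
    rewrite ler_wpM2l//; move: hchi; rewrite ler_norml => /andP[h _]; lra.
  lra.
have hp : C * (1 - \int[P]_x chi x) <= e / 8.
  rewrite (le_trans _ Ceta)// ler_wpM2l//; lra.
move: hf hg hP; rewrite !ler_norml => /andP[? ?] /andP[? ?] /andP[? ?].
by apply/andP; split; lra.
Unshelve. all: by end_near. Qed.

End central_limit.

(** * Expectation over independent trials *)

Section expectation.
Context {R : realType} {V : normedModType R} {I : finType} {J : I -> finType}.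
Variables (d : forall i, J i -> R) (u : forall i, J i -> V).
Arguments d : clear implicits.
Arguments u : clear implicits.
Hypothesis d1 : forall i, \sum_j d i j = 1.
Context dT (T : measurableType dT) (P : probability T R) (r : nat).
Variables (Y : I * 'I_r -> {RV P >-> R}) (lam : forall i, J i -> R).
Arguments lam : clear implicits.
Hypotheses (lam_inj : forall i, injective (lam i))
  (indepY : mutually_independent Y)
  (lawY : forall a j, P (Y a @^-1` [set lam a.1 j]) = (d a.1 j)%:E).
(** Prescribed only where the outcome is one of the listed values; the remaining event is null by
    [PB]. *)
Variable U : I * 'I_r -> T -> V.
Hypothesis UE : forall a j w, Y a w = lam a.1 j -> U a w = u a.1 j.
Variables (f : V -> R) (c : R).
Hypothesis mf : forall s x,
  bmeas (fun w => f (x + c *: \sum_(a <- s) U a w)).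

Let E (S : {set I * 'I_r}) (A : I * 'I_r -> set R) : set T :=
  \bigcap_(a in [set` S]) (Y a @^-1` A a).

Let mY a (B : set R) : measurable B -> measurable (Y a @^-1` B).
Proof. by move=> mB; rewrite -[X in measurable X]setTI; exact: measurable_funP. Qed.

Let mE S A : (forall a, measurable (A a)) -> measurable (E S A).
Proof. by move=> mA; apply: fin_bigcap_measurable => // a _; exact: mY. Qed.

Let upd (A : I * 'I_r -> set R) (a : I * 'I_r) (B : set R) (a' : I * 'I_r) :=
  if a' == a then B else A a'.
Arguments upd : clear implicits.
Arguments E : clear implicits.

Let mupd A a B : (forall a, measurable (A a)) -> measurable B ->
  forall a', measurable (upd A a B a').
Proof. by move=> mA mB a'; rewrite /upd; case: ifP. Qed.

Let E_upd (S : {set I * 'I_r}) (A : I * 'I_r -> set R) (a : I * 'I_r) (B : set R) :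
  a \notin S -> E (a |: S) (upd A a B) = E S A `&` (Y a @^-1` B).
Proof.
move=> aS; apply/seteqP; split => w /=.
  move=> Ew; split.
    move=> a' a'S; have := Ew a'; rewrite /upd /= in_setU1 a'S orbT => /(_ isT).
    by case: eqP => [e|//]; move: aS; rewrite -e a'S.
  by have := Ew a; rewrite /upd /= in_setU1 eqxx; exact.
move=> [Ew Bw] a'; rewrite /upd /= in_setU1; case: eqP => [-> //|_ /= a'S].
exact: Ew.
Qed.

(** Since [a] lies outside [S], independence gives the new constraint a factor of its own. *)
Let P_upd (S : {set I * 'I_r}) (A : I * 'I_r -> set R) (a : I * 'I_r) j :
  (forall a, measurable (A a)) -> a \notin S ->
  P (E (a |: S) (upd A a [set lam a.1 j])) = (P (E S A) * (d a.1 j)%:E)%E.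
Proof.
move=> mA aS.
rewrite /E !indepY//; last by apply: mupd => //; exact: measurable_set1.
rewrite big_setU1//= {1}/upd eqxx lawY muleC; congr (_ * _)%E.
apply: eq_bigr => a' a'S; rewrite /upd; case: eqP a'S => // -> aS'.
by rewrite aS' in aS.
Qed.

Let B (a : I * 'I_r) j : set T := Y a @^-1` [set lam a.1 j].
Arguments B : clear implicits.

Let mB a j : measurable (B a j).
Proof. by apply: mY; exact: measurable_set1. Qed.

Let trivB a D : trivIset D (B a).
Proof.
move=> j j' _ _ [w [/= h1 h2]].
by apply: (@lam_inj a.1); rewrite -h1 -h2.
Qed.

Let spectrum a : set T := \big[setU/set0]_(j <- index_enum (J a.1)) B a j.
Arguments spectrum : clear implicits.

Let PB a : P (~` spectrum a) = 0%E.
Proof.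
rewrite probability_setC; last exact: bigsetU_measurable.
rewrite -[X in P X]setTI.
(* Finite additivity over the disjoint outcome events, read as the integral of the constant 1. *)
have := @ge0_integral_bigsetU _ _ _ P _ (B a) (fun=> 1%E) _ (@mB a)
  (index_enum_uniq (J a.1)) (@trivB a _) _ _.
rewrite -/(spectrum a) => h.
have -> : P (setT `&` spectrum a) = 1%E; last by rewrite subee.
rewrite setTI -[LHS]mul1e -integral_cst; last exact: bigsetU_measurable.
rewrite h//.
transitivity (\sum_j (d a.1 j)%:E)%E; last by rewrite sumEFin d1.
by apply: eq_bigr => j _; rewrite integral_cst// mul1e; exact: lawY.
Qed.

Let integral_split (a : I * 'I_r) (D : set T) (F : T -> R) : measurable D -> bmeas F ->
  \int[P]_(w in D) F w = \sum_j \int[P]_(w in D `&` B a j) F w.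
Proof.
move=> mD bF; have iF := bmeas_integrable P bF.
have mS : measurable (spectrum a) by exact: bigsetU_measurable.
have iD A : measurable A -> P.-integrable A (EFin \o F).
  by move=> mA; exact: (integrableS measurableT).
transitivity (\int[P]_(w in D `\` ~` spectrum a) F w).
  congr fine; apply: negligible_integral => //; first exact: measurableC.
  exact: iD.
  exact: PB.
rewrite setDE setCK /spectrum big_distrr/=.
rewrite {1}/Rintegral (@integral_bigsetU_EFin _ _ _ P _ (fun j => D `&` B a j))//.
- rewrite -[RHS]/(fine _%:E) -sumEFin; congr fine; apply: eq_bigr => j _.
  by rewrite /Rintegral fineK//; apply: integrable_fin_num => //; [exact: measurableI|exact/iD/measurableI].
- by move=> j; exact: measurableI.
- exact: index_enum_uniq.
- by apply: trivIset_setIl; exact: trivB.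
- by apply/measurable_EFinP/measurable_funTS; case: bF.
Qed.

(** Generalized to cylinder events for induction: [S] holds the measurements already revealed and
    [s] those to come. Revealing the next one splits the event by its outcome and moves the starting
    point x. *)
Let expectation_on (s : seq (I * 'I_r)) (S : {set I * 'I_r}) (A : I * 'I_r -> set R) x :
  (forall a, measurable (A a)) -> uniq s -> (forall a, a \in s -> a \notin S) ->
  \int[P]_(w in E S A) f (x + c *: \sum_(a <- s) U a w) =
  fine (P (E S A)) * titer d u s c f x.
Proof.
elim: s S A x => [|a s IH] S A x mA /=.
  move=> _ _; under eq_Rintegral do rewrite big_nil scaler0 addr0.
  by rewrite Rintegral_cst; [exact: mulrC|exact: mE].
move=> /andP[as_ us] sS.
rewrite (integral_split a (mE _ mA) (mf _ _)) /tstep mulr_sumr.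
apply: eq_bigr => j _.
have aS : a \notin S by apply: sS; rewrite inE eqxx.
have mj : measurable [set lam a.1 j] by exact: measurable_set1.
rewrite [X in Rintegral _ X](_ : _ = E (a |: S) (upd A a [set lam a.1 j])); last first.
  by rewrite E_upd.
transitivity (\int[P]_(w in E (a |: S) (upd A a [set lam a.1 j]))
    f (x + c *: u a.1 j + c *: \sum_(b <- s) U b w)).
  apply: eq_Rintegral => w; rewrite inE E_upd// => -[_ /= Yw].
  by rewrite big_cons scalerDr addrA (UE Yw).
rewrite IH//.
- rewrite P_upd// fineM//; first by rewrite mulrA.
  by apply: fin_num_measure; exact: mE.
- exact: mupd.
- move=> b bs; rewrite in_setU1 negb_or sS ?andbT; last by rewrite inE bs orbT.
  by apply: contraNneq as_ => <-.
Qed.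

Lemma expectation_titer x :
  \int[P]_w f (x + c *: \sum_(a <- trials r) U a w) = titer d u (trials r) c f x.
Proof.
have us : uniq (trials r : seq (I * 'I_r)).
  by apply: allpairs_uniq => [||[? ?] [? ?] _ _ [-> ->]//]; exact: index_enum_uniq.
have := @expectation_on (trials r) finset.set0 (fun=> setT) x _ us _.
rewrite (_ : E _ _ = setT); last first.
  by apply/seteqP; split => // w _ a /=; rewrite inE.
rewrite [X in fine X]probability_setT mul1r; apply => // a _.
by rewrite inE.
Qed.

End expectation.

(** * The kernel operator and its inverse *)

Section real_scalars.
Context {R : realType} {k : field_kind}.
Local Notation F := (rcfld R k).
Local Notation rc := (@rc_of_real R k).
Local Notation re := (@rc_re R k).
Local Notation conj := (@rc_conj R k).

Let rc_additive : zmod_morphism rc.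
Proof. by case: k => //= x y; rewrite -[RHS]/(x%:C%C - y%:C%C) -rmorphB. Qed.

Let rc_multiplicative : monoid_morphism rc.
Proof.
by case: k => //=; split=> // x y; rewrite -[RHS]/(x%:C%C * y%:C%C) -rmorphM.
Qed.

HB.instance Definition _ := GRing.isZmodMorphism.Build R F rc rc_additive.
HB.instance Definition _ := GRing.isMonoidMorphism.Build R F rc rc_multiplicative.

Let conj_additive : zmod_morphism conj.
Proof. by case: k => //= x y; exact: rmorphB. Qed.

Let conj_multiplicative : monoid_morphism conj.
Proof. by case: k => //=; split=> [|x y]; [exact: rmorph1|exact: rmorphM]. Qed.

HB.instance Definition _ := GRing.isZmodMorphism.Build F F conj conj_additive.
HB.instance Definition _ := GRing.isMonoidMorphism.Build F F conj conj_multiplicative.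

Let re_additive : zmod_morphism re.
Proof. by case: k => //= -[a b] [c d]. Qed.

HB.instance Definition _ := GRing.isZmodMorphism.Build F R re re_additive.

Lemma rc_re_of_real a : re (rc a) = a.
Proof. by case: k. Qed.

Lemma rc_reM a z : re (rc a * z) = a * re z.
Proof. by case: k z => //= -[x y] /=; rewrite mul0r subr0. Qed.

Lemma rc_conjK : involutive conj.
Proof. by case: k => //= z; exact: conjcK. Qed.

Lemma rc_conj_real a : conj (rc a) = rc a.
Proof. by case: k => //=; rewrite oppr0. Qed.

Lemma rc_conj_fixed z : conj z = z -> z = rc (re z).
Proof.
case: k z => //= -[x y] [] /eqP; rewrite -subr_eq0 -opprD oppr_eq0 -mulr2n mulrn_eq0/=.
by move=> /eqP ->.
Qed.

End real_scalars.

Section adjoint.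
Context {R : realType} {k : field_kind}.
Local Notation F := (rcfld R k).
Local Notation rc := (@rc_of_real R k).
Local Notation re := (@rc_re R k).
Local Notation conj := (@rc_conj R k).

Lemma adjmxD m n (A B : 'M[F]_(m, n)) : adjmx (A + B) = adjmx A + adjmx B.
Proof. by rewrite /adjmx linearD/= map_mxD. Qed.

Lemma adjmxN m n (A : 'M[F]_(m, n)) : adjmx (- A) = - adjmx A.
Proof. by rewrite /adjmx linearN/= map_mxN. Qed.

Lemma adjmxZ m n a (A : 'M[F]_(m, n)) : adjmx (a *: A) = conj a *: adjmx A.
Proof. by rewrite /adjmx linearZ/= map_mxZ. Qed.

Lemma adjmxM m n p (A : 'M[F]_(m, n)) (B : 'M[F]_(n, p)) :
  adjmx (A *m B) = adjmx B *m adjmx A.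
Proof. by rewrite /adjmx trmx_mul map_mxM. Qed.

Lemma adjmxK m n (A : 'M[F]_(m, n)) : adjmx (adjmx A) = A.
Proof. by apply/matrixP => i j; rewrite !mxE rc_conjK. Qed.

Lemma adjmx1 n : adjmx 1%:M = 1%:M :> 'M[F]_n.
Proof. by rewrite /adjmx trmx1 map_mx1. Qed.

Lemma adjmx0 m n : adjmx 0 = 0 :> 'M[F]_(n, m).
Proof. by rewrite /adjmx trmx0 map_mx0. Qed.

Lemma mxtrace_adj n (A : 'M[F]_n) : \tr (adjmx A) = conj (\tr A).
Proof. by rewrite /mxtrace raddf_sum; apply: eq_bigr => i _; rewrite !mxE. Qed.

Section selfadj_closed.
Context {q : nat}.
Local Notation sa := (selfadj R k q).
Implicit Types A B : 'M[F]_q.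

Lemma selfadj0 : sa 0. Proof. exact: adjmx0. Qed.

Lemma selfadj1 : sa 1%:M. Proof. exact: adjmx1. Qed.

Lemma selfadjD A B : sa A -> sa B -> sa (A + B).
Proof. by move=> hA hB; rewrite /selfadj/= adjmxD hA hB. Qed.

Lemma selfadjB A B : sa A -> sa B -> sa (A - B).
Proof. by move=> hA hB; rewrite /selfadj/= adjmxD adjmxN hA hB. Qed.

Lemma selfadjZ a A : sa A -> sa (rc a *: A).
Proof. by move=> hA; rewrite /selfadj/= adjmxZ hA rc_conj_real. Qed.

Lemma selfadj_sum (I : Type) (s : seq I) (P : pred I) (f : I -> 'M[F]_q) :
  (forall i, P i -> sa (f i)) -> sa (\sum_(i <- s | P i) f i).
Proof. by move=> hf; elim/big_ind: _ => //; [exact: selfadj0|exact: selfadjD]. Qed.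

Lemma selfadj_trace A : sa A -> \tr A = rc (frob A 1%:M).
Proof.
by move=> hA; rewrite /frob mulmx1; apply: rc_conj_fixed; rewrite -mxtrace_adj hA.
Qed.

Lemma frobC A B : frob A B = frob B A.
Proof. by rewrite /frob mxtrace_mulC. Qed.

Lemma frobDl A B C : frob (A + B) C = frob A C + frob B C.
Proof. by rewrite /frob mulmxDl mxtraceD raddfD. Qed.

Lemma frobZl a A B : frob (rc a *: A) B = a * frob A B.
Proof. by rewrite /frob -scalemxAl mxtraceZ rc_reM. Qed.

Lemma frobZr a A B : frob B (rc a *: A) = a * frob B A.
Proof. by rewrite frobC frobZl frobC. Qed.

Lemma frobNl A B : frob (- A) B = - frob A B.
Proof. by rewrite /frob mulNmx !raddfN. Qed.

Lemma frobBl A B C : frob (A - B) C = frob A C - frob B C.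
Proof. by rewrite frobDl frobNl. Qed.

Lemma frobBr A B C : frob C (A - B) = frob C A - frob C B.
Proof. by rewrite frobC frobBl !(frobC C). Qed.

Lemma frob0l A : frob 0 A = 0.
Proof. by rewrite /frob mul0mx !raddf0. Qed.

Lemma frob_suml (I : Type) (s : seq I) (P : pred I) (f : I -> 'M[F]_q) B :
  frob (\sum_(i <- s | P i) f i) B = \sum_(i <- s | P i) frob (f i) B.
Proof. by apply: (big_morph (fun A => frob A B)) => [A C|]; [exact: frobDl|exact: frob0l]. Qed.

Lemma frob_sumr (I : Type) (s : seq I) (P : pred I) (f : I -> 'M[F]_q) B :
  frob B (\sum_(i <- s | P i) f i) = \sum_(i <- s | P i) frob B (f i).
Proof. by rewrite frobC frob_suml; apply: eq_bigr => i _; exact: frobC. Qed.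

End selfadj_closed.
End adjoint.

(** * Orthogonality and completeness of the eigenprojections *)

Section observable_projections.
Context {R : realType} {k : field_kind} {q : nat} (O : observable R k q).
Local Notation F := (rcfld R k).
Local Notation rc := (@rc_of_real R k).
Local Notation Pi := (obs_proj O).

Let projA j : Pi j *m obs_mx O = rc (obs_val O j) *: Pi j.
Proof. by apply/eigenspaceP; rewrite obs_proj_eigenspace. Qed.

Let Aproj j : obs_mx O *m Pi j = rc (obs_val O j) *: Pi j.
Proof.
have := congr1 (@adjmx R k q q) (projA j).
by rewrite adjmxM adjmxZ rc_conj_real obs_proj_selfadj obs_selfadj.
Qed.

(** Pi_i A Pi_j is both lambda_i and lambda_j times Pi_i Pi_j, and the eigenvalues differ. *)
Lemma obs_proj_orthogonal i j : i != j -> Pi i *m Pi j = 0.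
Proof.
move=> ij; have : (rc (obs_val O i) - rc (obs_val O j)) *: (Pi i *m Pi j) = 0.
  by rewrite scalerBl scalemxAl -projA scalemxAr -Aproj mulmxA subrr.
move=> /eqP; rewrite scaler_eq0 => /orP[|/eqP//].
rewrite subr_eq0 => /eqP /(congr1 (@rc_re R k)); rewrite !rc_re_of_real.
by move=> /obs_val_inj e; rewrite e eqxx in ij.
Qed.

(* [N] is the projection onto the complement of the eigenspaces: it is killed by
   the matrix, so its rows lie in the eigenspace of the eigenvalue [0], to which
   it is orthogonal. *)
Lemma sum_obs_proj : \sum_j Pi j = 1%:M.
Proof.
pose Q := \sum_j Pi j; pose N := 1%:M - Q.
have QP j : Q *m Pi j = Pi j.
  rewrite /Q mulmx_suml (bigD1 j)//= obs_proj_idem big1 ?addr0// => i ij.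
  exact: obs_proj_orthogonal.
have NA : N *m obs_mx O = 0.
  rewrite obs_spectral mulmx_sumr big1// => j _.
  by rewrite -scalemxAr mulmxBl mul1mx QP subrr scaler0.
suff N0 : N = 0 by apply/eqP; rewrite eq_sym -subr_eq0 -/Q -/N N0.
apply/eqP/negPn/negP => N0.
have N_eigen : (N <= eigenspace (obs_mx O) 0)%MS.
  by apply/eigenspaceP; rewrite NA scale0r.
have : eigenvalue (obs_mx O) 0.
  by apply: contra N0 => /eqP e0; move: N_eigen; rewrite e0 submx0.
move=> /obs_eigenvalue[j j0].
move: N_eigen; rewrite j0 -obs_proj_eigenspace => /submxP[D ND].
have : N *m Pi j = N by rewrite ND -mulmxA obs_proj_idem.
by rewrite mulmxBl mul1mx QP subrr => /esym/eqP; rewrite (negbTE N0).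
Qed.

Lemma sum_outcome_prob (S : 'M[F]_q) : \sum_j outcome_prob O j S = frob S 1%:M.
Proof. by rewrite -frob_sumr sum_obs_proj. Qed.

End observable_projections.

(** Fredholm alternative: a row lies in a row space as soon as it annihilates the orthogonal
    complement. *)
Lemma solve_row (F : fieldType) (N : nat) (M : 'M[F]_N) (s : 'rV[F]_N) :
  (forall z : 'rV_N, z *m M = 0 -> z *m s^T = 0) -> exists y : 'rV_N, y *m M^T = s.
Proof.
move=> h; suff /submxP[y ->] : (s <= M^T)%MS by exists y.
rewrite submxE; apply/eqP/trmx_inj; rewrite trmx_mul trmx0.
apply/row_matrixP => i; rewrite row0 row_mul; apply: h.
by rewrite -row_mul -[X in row i (_ *m X)]trmxK -trmx_mul mulmx_coker trmx0 row0.
Qed.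

Section kernel_operator.
Context {R : realType} {k : field_kind} {q n : nat}.
Local Notation F := (rcfld R k).
Local Notation rc := (@rc_of_real R k).
Local Notation sa := (selfadj R k q).
Variables (O : 'I_n -> observable R k q) (K : R -> R -> F).
Hypotheses (hq : (2 <= q)%N) (hO : complete_design O)
  (hK2 : strictly_pos_definite (abs_sq_kernel K)).
Local Notation H := (kernel_H O K).
Local Notation Hinv := (kernel_Hinv O K).
Implicit Types S Z : 'M[F]_q.

Let Om i := kernel_Omega K (O i).

Let Om_pos i : pos_definite (Om i).
Proof. exact: hK2 (@obs_val_inj _ _ _ (O i)). Qed.

Let Om_sym i j j' : Om i j j' = Om i j' j.
Proof. by have [h _] := Om_pos i; rewrite -{1}h mxE. Qed.

Let dd i j S := outcome_prob (O i) j S.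

Let natr_rc : (n%:R^-1 : F) = rc n%:R^-1.
Proof. by rewrite fmorphV rmorph_nat. Qed.

(** Without observables, completeness would force the nonzero traceless matrix E_00 - E_11 to
    vanish. *)
Let num_gt0 : (0 < n)%N.
Proof.
rewrite lt0n; apply/negP => /eqP n0.
have q0 : (0 < q)%N by exact: leq_trans hq.
pose i0 := Ordinal q0; pose i1 := Ordinal hq.
pose D : 'M[F]_q := delta_mx i0 i0 - delta_mx i1 i1.
have sd i : sa (delta_mx i i).
  by rewrite /selfadj/= /adjmx trmx_delta map_delta_mx.
have D0 : D = 0.
  apply/(hO (selfadjB (sd i0) (sd i1))).
    by rewrite raddfB/= -(mul_delta_mx i1) mxtrace_mulC mul_delta_mx subrr.
  by move=> i; exfalso; move: i; rewrite n0 => -[].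
have := congr1 (fun A : 'M[F]_q => A i0 i0) D0.
by rewrite !mxE/= subr0 => /eqP; rewrite oner_eq0.
Qed.

(** The trace condition comes for free: the trace is the sum of the outcome values of any one
    observable. *)
Lemma complete_design_eq0 S : sa S -> (forall i j, outcome_prob (O i) j S = 0) -> S = 0.
Proof.
move=> hS dS; apply/(hO hS) => //.
rewrite selfadj_trace// -(sum_outcome_prob (O (Ordinal num_gt0))).
by rewrite big1 ?rmorph0// => j _; exact: dS.
Qed.

Lemma frob_kernel_P (p : forall i, 'I_(obs_num (O i)) -> R) Z :
  frob (kernel_P K p) Z =
  n%:R^-1 * \sum_i \sum_j \sum_j' Om i j j' * p i j * dd j' Z.
Proof.
rewrite /kernel_P natr_rc frobZl frob_suml; congr (_ * _); apply: eq_bigr => i _.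
rewrite frob_suml; apply: eq_bigr => j _; rewrite frob_suml; apply: eq_bigr => j' _.
by rewrite frobZl /dd /outcome_prob [frob Z _]frobC.
Qed.

Lemma kernel_HE S : H S = kernel_P K (fun i j => outcome_prob (O i) j S).
Proof. by []. Qed.

Lemma frob_kernel_HC S Z : frob (H S) Z = frob S (H Z).
Proof.
rewrite [RHS]frobC !kernel_HE !frob_kernel_P; congr (_ * _); apply: eq_bigr => i _.
rewrite exchange_big/=; apply: eq_bigr => j _; apply: eq_bigr => j' _.
by rewrite Om_sym mulrAC.
Qed.

Lemma selfadj_kernel_P (p : forall i, 'I_(obs_num (O i)) -> R) : sa (kernel_P K p).
Proof.
rewrite /kernel_P natr_rc; apply: selfadjZ.
do 3 (apply: selfadj_sum => ? _).
by apply: selfadjZ; exact: obs_proj_selfadj.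
Qed.

Lemma selfadj_kernel_H S : sa (H S).
Proof. exact: selfadj_kernel_P. Qed.

Lemma kernel_P_linear a (p p' : forall i, 'I_(obs_num (O i)) -> R) :
  kernel_P K (fun i j => a * p i j + p' i j) = rc a *: kernel_P K p + kernel_P K p'.
Proof.
rewrite /kernel_P scalerA mulrC -scalerA -scalerDr; congr (_ *: _).
rewrite scaler_sumr -big_split; apply: eq_bigr => i _ /=.
rewrite scaler_sumr -big_split; apply: eq_bigr => j _ /=.
rewrite scaler_sumr -big_split; apply: eq_bigr => j' _ /=.
by rewrite scalerA -scalerDl -rmorphM -rmorphD mulrDr mulrCA.
Qed.

Lemma kernel_H_linear a S Z : H (rc a *: S + Z) = rc a *: H S + H Z.
Proof.
rewrite !kernel_HE -kernel_P_linear; congr (kernel_P K _).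
apply: functional_extensionality_dep => i; apply/funext => j.
by rewrite /outcome_prob frobDl frobZl.
Qed.

(** The form is the mean over i of the positive definite forms Omega_i at the vectors d_i[S]; if it
    vanishes, so do all d_ik[S], and completeness concludes. *)
Lemma kernel_H_definite S : sa S -> 0 <= frob (H S) S /\ (frob (H S) S = 0 -> S = 0).
Proof.
move=> hS; rewrite kernel_HE frob_kernel_P.
pose c i : 'cV[R]_(obs_num (O i)) := \col_j dd j S.
have qE i : \sum_j \sum_j' Om i j j' * dd j S * dd j' S = ((c i)^T *m Om i *m c i) 0 0.
  rewrite mxE exchange_big/=; apply: eq_bigr => j' _.
  rewrite !mxE mulr_suml; apply: eq_bigr => j _; rewrite !mxE; congr (_ * _).
  exact: mulrC.
have q0 i : 0 <= ((c i)^T *m Om i *m c i) 0 0.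
  have [->|c0] := eqVneq (c i) 0; first by rewrite mulmx0 mxE.
  by have [_ /(_ _ c0)/ltW] := Om_pos i.
under eq_bigr do rewrite qE.
have n0 : 0 < n%:R^-1 :> R by rewrite invr_gt0 ltr0n num_gt0.
split; first by rewrite mulr_ge0 ?sumr_ge0// ltW.
move/eqP; rewrite mulf_eq0 gt_eqF//= psumr_eq0// => /allP h.
apply: complete_design_eq0 => // i j.
have /h/eqP ci0 : i \in index_enum 'I_n by exact: mem_index_enum.
have [c0|c0] := eqVneq (c i) 0.
  by have := congr1 (fun v : 'cV[R]_(obs_num (O i)) => v j 0) c0; rewrite !mxE.
by have [_ /(_ _ c0)] := Om_pos i; rewrite ci0 ltxx.
Qed.

Lemma kernel_H_inj S Z : sa S -> sa Z -> H S = H Z -> S = Z.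
Proof.
move=> hS hZ e; apply/eqP; rewrite -subr_eq0; apply/eqP.
have [_] := kernel_H_definite (selfadjB hS hZ); apply.
have -> : S - Z = rc (-1) *: Z + S by rewrite rmorphN1 scaleN1r addrC.
by rewrite kernel_H_linear e rmorphN1 scaleN1r addNr frob0l.
Qed.

Let idx := {i : 'I_n & 'I_(obs_num (O i))}.
Let PI (a : 'I_#|{: idx}|) : 'M[F]_q :=
  let ij := enum_val a : idx in obs_proj (O (tag ij)) (tagged ij).

Let saPI a : sa (PI a). Proof. exact: obs_proj_selfadj. Qed.

Let PI_eq0 S : sa S -> (forall a, frob S (PI a) = 0) -> S = 0.
Proof.
move=> hS h; apply: complete_design_eq0 => // i j.
have := h (enum_rank (Tagged (fun i => 'I_(obs_num (O i))) j : idx)).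
by rewrite /PI enum_rankK.
Qed.

Let H_sum (y : 'rV[R]_#|{: idx}|) Z :
  frob (H (\sum_a rc (y 0 a) *: PI a)) Z = \sum_a y 0 a * frob (H (PI a)) Z.
Proof.
rewrite frob_kernel_HC frob_suml; apply: eq_bigr => a _.
by rewrite frobZl frob_kernel_HC.
Qed.

(* Solving for the coordinates of the preimage on the projections avoids a
   dimension count on the real space of self-adjoint matrices. *)
Lemma kernel_H_surj S : sa S -> exists2 Z, sa Z & H Z = S.
Proof.
move=> hS; pose M : 'M[R]_#|{: idx}| := \matrix_(a, b) frob (H (PI b)) (PI a).
pose s : 'rV[R]_#|{: idx}| := \row_b frob S (PI b).
have sasum (y : 'rV[R]_#|{: idx}|) : sa (\sum_a rc (y 0 a) *: PI a).
  by apply: selfadj_sum => a _; exact: selfadjZ.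
have [z zM|y yM] := @solve_row _ _ M s.
  (* A kernel vector gives a combination Z with <H Z, Z> = 0, hence Z = 0; pairing it with S is the
     solvability condition. *)
  pose Z := \sum_a rc (z 0 a) *: PI a.
  have hZ : frob (H Z) Z = 0.
    rewrite H_sum big1// => b _; rewrite frob_sumr.
    have := congr1 (fun v : 'rV[R]_#|{: idx}| => v 0 b) zM; rewrite !mxE => e.
    rewrite (_ : \sum_i _ = 0) ?mulr0//.
    by rewrite -[RHS]e; apply: eq_bigr => a _; rewrite mxE frobZr.
  have [_ /(_ hZ) Z0] := kernel_H_definite (sasum z).
  apply/matrixP => i j; rewrite !mxE !ord1.
  have := frob0l S; rewrite -Z0 frob_suml => e.
  by rewrite -[RHS]e; apply: eq_bigr => a _; rewrite !mxE frobZl [frob S _]frobC.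
exists (\sum_a rc (y 0 a) *: PI a) => //.
apply/eqP; rewrite -subr_eq0; apply/eqP; apply: PI_eq0 => [|b].
  by apply: selfadjB => //; exact: selfadj_kernel_H.
rewrite frobBl H_sum; have := congr1 (fun v : 'rV[R]_#|{: idx}| => v 0 b) yM.
rewrite !mxE => <-; apply/eqP; rewrite subr_eq0; apply/eqP.
by apply: eq_bigr => a _; rewrite !mxE.
Qed.

Lemma kernel_HinvK S : sa S -> sa (Hinv S) /\ H (Hinv S) = S.
Proof.
move=> hS.
have sH : set_surj sa sa H by move=> Z /kernel_H_surj[X hX <-]; exists X.
split; first by apply: (@surjpinv_image_sub _ _ (fun=> 0) sa sa H sH (Hinv S)); exists S.
by apply: (surjpK _ sH); rewrite inE.
Qed.

Lemma kernel_HK S : sa S -> Hinv (H S) = S.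
Proof.
move=> hS; have [h1 h2] := kernel_HinvK (selfadj_kernel_H S).
exact: kernel_H_inj.
Qed.

Lemma kernel_Hinv_linear a S Z : sa S -> sa Z ->
  Hinv (rc a *: S + Z) = rc a *: Hinv S + Hinv Z.
Proof.
move=> hS hZ; have [S1 S2] := kernel_HinvK hS; have [Z1 Z2] := kernel_HinvK hZ.
have hSZ : sa (rc a *: S + Z) by apply: selfadjD => //; exact: selfadjZ.
have [h1 h2] := kernel_HinvK hSZ.
apply: kernel_H_inj => //; first by apply: selfadjD => //; exact: selfadjZ.
by rewrite h2 kernel_H_linear S2 Z2.
Qed.

Lemma frob_kernel_HinvC S Z : sa S -> sa Z -> frob (Hinv S) Z = frob S (Hinv Z).
Proof.
move=> hS hZ; have [S1 S2] := kernel_HinvK hS; have [Z1 Z2] := kernel_HinvK hZ.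
by rewrite -{1}Z2 -frob_kernel_HC S2.
Qed.

Let trJ := frob (Hinv 1%:M) 1%:M.

Local Notation CI := (centered_inversion O K).

Let ci_shift S := frob (Hinv S) 1%:M / trJ.

Let trace_ratio S : sa S -> \tr (Hinv S) / \tr (Hinv 1%:M) = rc (ci_shift S).
Proof.
move=> hS; have [S1 _] := kernel_HinvK hS; have [J1 _] := kernel_HinvK selfadj1.
by rewrite !selfadj_trace// -fmorph_div.
Qed.

Let centered_inversionE S : sa S -> CI S = Hinv S - rc (ci_shift S) *: Hinv 1%:M.
Proof.
move=> hS; rewrite /centered_inversion /centering_adj trace_ratio//.
rewrite addrC -scaleNr -rmorphN kernel_Hinv_linear ?rmorphN ?scaleNr 1?addrC//.
exact: selfadj1.
Qed.

Lemma centered_inversion_linear a S Z : sa S -> sa Z ->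
  CI (rc a *: S + Z) = rc a *: CI S + CI Z.
Proof.
move=> hS hZ; rewrite !centered_inversionE//; last by apply: selfadjD => //; exact: selfadjZ.
rewrite kernel_Hinv_linear// /ci_shift kernel_Hinv_linear// frobDl frobZl mulrDl -mulrA.
rewrite rmorphD rmorphM scalerDl -scalerA opprD scalerBr.
by rewrite addrACA.
Qed.

Lemma selfadj_centered_inversion S : sa S -> sa (CI S).
Proof.
move=> hS; rewrite centered_inversionE//.
have [S1 _] := kernel_HinvK hS; have [J1 _] := kernel_HinvK selfadj1.
by apply: selfadjB => //; exact: selfadjZ.
Qed.

(** By symmetry of the inverse, the correction pairs to the symmetric product <H^-1 S, I> <H^-1 Z,
    I> / <H^-1 I, I>. *)
Lemma frob_centered_inversionC S Z : sa S -> sa Z -> frob (CI S) Z = frob S (CI Z).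
Proof.
move=> hS hZ; rewrite !centered_inversionE// frobBl frobBr frobZl frobZr.
rewrite frob_kernel_HinvC// !(frob_kernel_HinvC selfadj1)// /ci_shift.
rewrite [frob 1%:M _]frobC -(frob_kernel_HinvC hS selfadj1) [frob _ 1%:M]frobC.
rewrite [frob 1%:M (Hinv S)]frobC.
by congr (_ - _); rewrite mulrAC [frob (Hinv Z) _]frobC; ring.
Qed.

Let centered_inversion0 : CI 0 = 0.
Proof.
have := centered_inversion_linear 1 selfadj0 selfadj0.
rewrite rmorph1 !scale1r addr0 => /eqP.
by rewrite -subr_eq0 opprD addrA subrr sub0r oppr_eq0 => /eqP.
Qed.

Lemma centered_inversionZ a S : sa S -> CI (rc a *: S) = rc a *: CI S.
Proof.
move=> hS; rewrite -[rc a *: S]addr0 centered_inversion_linear//; last exact: selfadj0.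
by rewrite centered_inversion0 addr0.
Qed.

Lemma centered_inversion_sum (I : Type) (s : seq I) (f : I -> 'M[F]_q) :
  (forall i, sa (f i)) -> CI (\sum_(i <- s) f i) = \sum_(i <- s) CI (f i).
Proof.
move=> hf; elim: s => [|i s IH]; first by rewrite !big_nil.
have hs : sa (\sum_(j <- s) f j) by apply: selfadj_sum.
rewrite !big_cons -IH -[f i in LHS]scale1r -[1 in LHS](rmorph1 rc).
by rewrite centered_inversion_linear// rmorph1 scale1r.
Qed.

Let kM i j := kernel_M K (O := O) (i := i) j.

Let sakM i (j : 'I_(obs_num (O i))) : sa (kM j).
Proof. by apply: selfadj_sum => j' _; apply: selfadjZ; exact: obs_proj_selfadj. Qed.

(** The partial derivative of the affine map [quark] with respect to the frequency of outcome j of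
    observable i. *)
Definition quark_dir i (j : 'I_(obs_num (O i))) : 'M[F]_q := CI (rc n%:R^-1 *: kM j).

Lemma selfadj_quark_dir i j : sa (@quark_dir i j).
Proof. by apply: selfadj_centered_inversion; exact: selfadjZ. Qed.

(** With D the kernel image of p - d[rho], inversion of P_K gives H^-1 D + rho. As rho has trace 1,
    the trace correction becomes -tr(H^-1 D), exactly the centering in A_K. *)
Lemma quark_subE (rho : 'M[F]_q) (p : forall i, 'I_(obs_num (O i)) -> R) :
  sa rho -> \tr rho = 1 ->
  quark O K p - rho =
  \sum_i \sum_j rc (p i j - outcome_prob (O i) j rho) *: quark_dir j.
Proof.
move=> hrho trrho.
pose D := kernel_P K (fun i j => p i j - outcome_prob (O i) j rho).
have DE : D = \sum_i \sum_j rc (p i j - outcome_prob (O i) j rho) *: (rc n%:R^-1 *: kM j).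
  rewrite /D /kernel_P natr_rc scaler_sumr; apply: eq_bigr => i _.
  rewrite scaler_sumr; apply: eq_bigr => j _.
  rewrite scalerA mulrC -scalerA; congr (_ *: _); rewrite scaler_sumr.
  by apply: eq_bigr => j' _; rewrite scalerA -rmorphM mulrC.
have hD : sa D by exact: selfadj_kernel_P.
have -> : \sum_i \sum_j rc (p i j - outcome_prob (O i) j rho) *: quark_dir j = CI D.
  rewrite DE centered_inversion_sum; last first.
    move=> i; apply: selfadj_sum => j _; do 2 apply: selfadjZ; exact: sakM.
  apply: eq_bigr => i _; rewrite centered_inversion_sum; last first.
    move=> j; do 2 apply: selfadjZ; exact: sakM.
  by apply: eq_bigr => j _; rewrite [RHS]centered_inversionZ//; apply: selfadjZ.
have Pp : kernel_P K p = rc 1 *: D + H rho.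
  rewrite kernel_HE -kernel_P_linear; congr (kernel_P K _).
  apply: functional_extensionality_dep => i; apply/funext => j.
  by rewrite mul1r subrK.
have HH : Hinv (kernel_P K p) = Hinv D + rho.
  by rewrite Pp kernel_Hinv_linear ?rmorph1 ?scale1r ?kernel_HK//; exact: selfadj_kernel_H.
rewrite /quark HH raddfD/= trrho opprD addrCA subrr addr0 centered_inversionE//.
by rewrite mulNr trace_ratio// scaleNr addrAC addrK.
Qed.

Lemma covariance_superop_sym (rho A B : 'M[F]_q) :
  frob (covariance_superop O K rho A) B = frob A (covariance_superop O K rho B).
Proof.
have tC (M X Z : 'M[F]_q) : frob (tensor_square M X) Z = frob X (tensor_square M Z).
  by rewrite /tensor_square frobZl frobZr mulrC [frob M Z]frobC.
have e : (n%:R ^+ 2)^-1 = rc ((n%:R ^+ 2)^-1) :> F.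
  by rewrite fmorphV rmorphXn/= rmorph_nat.
rewrite /covariance_superop e frobZl frobZr; congr (_ * _).
rewrite frob_suml frob_sumr; apply: eq_bigr => i _.
rewrite frobBl frobBr tC; congr (_ - _).
rewrite frob_suml frob_sumr; apply: eq_bigr => j _.
by rewrite frobZl frobZr tC.
Qed.

Lemma selfadj_covariance_superop (rho A : 'M[F]_q) : sa (covariance_superop O K rho A).
Proof.
have e : (n%:R ^+ 2)^-1 = rc ((n%:R ^+ 2)^-1) :> F.
  by rewrite fmorphV rmorphXn/= rmorph_nat.
rewrite /covariance_superop e; apply: selfadjZ; apply: selfadj_sum => i _.
apply: selfadjB.
  by apply: selfadj_sum => j _; do 2 apply: selfadjZ; exact: sakM.
by apply: selfadjZ; apply: selfadj_sum => j _; apply: selfadjZ; exact: sakM.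
Qed.

(** Puts the claimed covariance into the form of [gsteps_functional]: a sum of squares over centered
    directions weighted by their probabilities. *)
Lemma quark_covarianceE (rho A : 'M[F]_q) : sa A -> frob rho 1%:M = 1 ->
  frob A (CI (covariance_superop O K rho (CI A))) =
  \sum_i \sum_j outcome_prob (O i) j rho *
    frob (quark_dir j - \sum_j' rc (outcome_prob (O i) j' rho) *: quark_dir j') A ^+ 2.
Proof.
move=> hA trrho; rewrite -frob_centered_inversionC//; last exact: selfadj_covariance_superop.
set B := CI A; have hB : sa B by exact: selfadj_centered_inversion.
have e : (n%:R ^+ 2)^-1 = rc ((n%:R ^+ 2)^-1) :> F.
  by rewrite fmorphV rmorphXn/= rmorph_nat.
have tB (M : 'M[F]_q) : frob B (tensor_square M B) = frob M B ^+ 2.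
  by rewrite /tensor_square frobZr expr2 [frob B M]frobC.
have dirA i (j : 'I_(obs_num (O i))) : frob (quark_dir j) A = n%:R^-1 * frob (kM j) B.
  by rewrite /quark_dir centered_inversionZ// frobZl frob_centered_inversionC.
rewrite /covariance_superop e frobZr frob_sumr mulr_sumr; apply: eq_bigr => i _.
rewrite frobBr tB frob_sumr frob_suml.
pose p j := outcome_prob (O i) j rho; pose x j := frob (kM (i := i) j) B.
have p1 : \sum_j p j = 1 by rewrite sum_outcome_prob.
set m := \sum_j p j * x j.
have -> : \sum_j frob (rc (outcome_prob (O i) j rho) *: kernel_M K j) B = m.
  by apply: eq_bigr => j _; rewrite frobZl.
have -> : \sum_j frob B (rc (outcome_prob (O i) j rho) *: tensor_square (kernel_M K j) B) =
    \sum_j p j * x j ^+ 2.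
  by apply: eq_bigr => j _; rewrite frobZr tB.
transitivity (\sum_j p j * (n%:R^-1 * (x j - m)) ^+ 2); last first.
  apply: eq_bigr => j _; rewrite frobBl dirA; congr (_ * _ ^+ 2).
  rewrite mulrBr; congr (_ - _); rewrite frob_suml /m mulr_sumr; apply: eq_bigr => j1 _.
  by rewrite frobZl dirA mulrCA.
(* Second moment minus squared mean is the centered second moment, because the p_j add up to 1. *)
transitivity (n%:R^-1 ^+ 2 * \sum_j (p j * x j ^+ 2 - 2 * m * (p j * x j) + m ^+ 2 * p j)).
  rewrite exprVn; congr (_ * _).
  rewrite big_split sumrB -mulr_sumr -mulr_sumr p1 -/m /=; ring.
by rewrite mulr_sumr; apply: eq_bigr => j _; ring.
Qed.

End kernel_operator.

(** * The limit law of the estimator *)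

Section borel_maps.
Context {R : realType}.

Lemma measurable_continuous_map (V W : ptopologicalType) (h : V -> W) :
  continuous h -> measurable_fun setT (h : borel V -> borel W).
Proof.
move=> ch.
apply: (@measurability _ _ (borel V) (borel W) setT h (@open W)) => // _ [A oA <-].
rewrite setTI; apply: sub_sigma_algebra.
by apply: open_comp => // x _; exact: ch.
Qed.

Lemma continuous_image_law (V W : ptopologicalType) (h : V -> W)
    (P : probability (borel V) R) : continuous h ->
  exists Q : probability (borel W) R, forall B, Q B = P (h @^-1` B).
Proof.
move=> ch; pose X : {mfun borel V >-> borel W} :=
  HB.pack (h : borel V -> borel W)
    (isMeasurableFun.Build _ _ _ _ (h : borel V -> borel W) (measurable_continuous_map ch)).
by exists (distribution P X).
Qed.

(** Adds one scaled fixed vector at a time, so that [measurable_add_scale] suffices and addition on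
    V x V never enters. *)
Lemma measurable_add_lincomb (V : normedModType R) d (T : measurableType d) (J : Type)
    (s : seq J) (zeta : J -> T -> R) (e : J -> V) (G : T -> V) :
  measurable_fun setT (G : T -> borel V) ->
  (forall j, measurable_fun setT (zeta j)) ->
  measurable_fun setT ((fun w => G w + \sum_(j <- s) zeta j w *: e j) : T -> borel V).
Proof.
move=> mG mz; elim: s => [|j s IH].
  rewrite [X in measurable_fun _ X](_ : _ = G)//.
  by apply/funext => w; rewrite big_nil addr0.
rewrite [X in measurable_fun _ X](_ : _ =
   (fun w => add_scale (e j) ((G w + \sum_(j <- s) zeta j w *: e j : borel V), zeta j w))).
  apply: (measurableT_comp (measurable_add_scale (e j))).
  exact: measurable_fun_pair.
by apply/funext => w; rewrite big_cons /add_scale/= -addrA; congr (_ + _); exact: addrC.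
Qed.

Lemma gauss_law_functional (V : normedModType R) (ws : seq V) (l : V -> R) (B : set R) :
  (forall y z w, l (y + z *: w) = l y + z * l w) -> continuous l -> measurable B ->
  gauss_law ws (l @^-1` B) = normal_law 0 (\sum_(w <- ws) l w ^+ 2) B.
Proof.
move=> ll cl mB; set v := \sum_(w <- ws) _.
have v0 : 0 <= v by apply: sumr_ge0 => w _; exact: sqr_ge0.
have l0 : l 0 = 0 by have := ll 0 (-1) 0; rewrite scaler0 addr0; lra.
have b1 : bmeas (\1_B : R -> R).
  split; first exact: measurable_indic.
  by exists 1 => x; rewrite indicE; case: (_ \in _); rewrite ?normr1 ?normr0.
have ml : measurable_fun setT (l : borel V -> R) by exact: measurable_continuous_borel.
have bl : bmeas (\1_B \o l : borel V -> R) by exact: bmeas_comp b1.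
have mlB : measurable (l @^-1` B : set (borel V)).
  by rewrite -[X in measurable X]setTI; exact: ml.
have mz : measurable_fun setT (fun z : R => Num.sqrt v * z) by exact: measurable_funM.
have := Rintegral_gauss_law ws bl; rewrite gsteps_functional// l0.
have -> : \int[gauss_law ws]_x (\1_B \o l) x = fine (gauss_law ws (l @^-1` B)).
  rewrite /Rintegral; congr fine.
  transitivity (\int[gauss_law ws]_x (\1_(l @^-1` B) x)%:E)%E; first exact: eq_integral.
  by rewrite integral_indic// setIT.
set G := @normal_prob R 0 1.
have -> : \int[G]_z \1_B (0 + z * Num.sqrt v) = fine (G ((fun z => Num.sqrt v * z) @^-1` B)).
  rewrite /Rintegral; congr fine.
  transitivity (\int[G]_x (\1_((fun z => Num.sqrt v * z) @^-1` B) x)%:E)%E.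
    by apply: eq_integral => z _; rewrite add0r mulrC.
  by rewrite integral_indic ?setIT// -[X in measurable X]setTI; exact: mz.
move=> e.
have -> : gauss_law ws (l @^-1` B) = G ((fun z => Num.sqrt v * z) @^-1` B).
  rewrite -[LHS]fineK; last exact: fin_num_measure.
  rewrite e fineK//; apply: fin_num_measure.
  by rewrite -[X in measurable X]setTI; exact: mz.
(* For zero variance the image of the standard law is the Dirac mass at 0, as in [normal_law]. *)
rewrite /normal_law; case: ifPn => [/eqP v00|vn0].
  rewrite v00 sqrtr0 diracE; case: (boolP (0 \in B)) => [/set_mem B0|/negP B0].
    have -> : (fun z : R => 0 * z) @^-1` B = setT.
      by apply/seteqP; split => // z _ /=; rewrite mul0r.
    exact: (probability_setT G).
  have -> : (fun z : R => 0 * z) @^-1` B = set0; last exact: (measure0 G).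
  by apply/seteqP; split => // z /=; rewrite mul0r => zB; apply: B0; rewrite inE.
by apply: gauss_scale => //; rewrite gt_eqF// sqrtr_gt0 lt_neqAle eq_sym vn0.
Qed.

End borel_maps.

Section rcfld_topology.
Context {R : realType} {k : field_kind}.
Local Notation F := (rcfld R k).
Local Notation rc := (@rc_of_real R k).

Lemma rc_norm (x : R) : `|rc x| = rc `|x|.
Proof. by case: k => //=; rewrite normc_def/= expr0n addr0 sqrtr_sqr. Qed.

Lemma rc_lt (x y : R) : (rc x < rc y) = (x < y).
Proof. by case: k => //=; rewrite ltcR. Qed.

Lemma rc_pos (e : F) : 0 < e -> exists2 e' : R, 0 < e' & e = rc e'.
Proof.
case: k e => /= [e e0|[a b]]; first by exists e.
by rewrite ltcE/= => /andP[/eqP -> a0]; exists a.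
Qed.

Lemma rc_continuous : continuous rc.
Proof.
move=> x; apply/cvgrPdist_lt => _ /rc_pos[e e0 ->]; near=> y.
rewrite -rmorphB rc_norm rc_lt; near: y.
exact: cvgr_dist_lt.
Unshelve. all: by end_near. Qed.

Lemma rc_conj_continuous : continuous (@rc_conj R k).
Proof.
move=> x; apply/(@cvgrPdist_lt _ _ _ (nbhs x) (nbhs_filter x)) => e e0; near=> y.
rewrite -rmorphB (_ : `|_| = `|x - y|).
  by near: y; apply: (@cvgr_dist_lt _ _ _ (nbhs x) (nbhs_filter x) id x).
by case: k (x - y) => //= z; exact: normcJ.
Unshelve. all: by end_near. Qed.

Lemma cvg_mx (T : Type) (E : set_system T) (FE : Filter E) m n (G : T -> 'M[F]_(m, n)) (M : 'M[F]_(m, n)) :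
  (forall i j, G t i j @[t --> E] --> M i j) -> G @ E --> M.
Proof.
move=> h A [P MP sPA]; apply: (@filterS _ E _ (fun t => forall ij : 'I_m * 'I_n, P ij.1 ij.2 (G t ij.1 ij.2))).
  by move=> t Pt; apply: sPA => i j; exact: (Pt (i, j)).
by apply: filter_forall => -[i j]; exact: (h i j _ (MP i j)).
Qed.

Lemma adjmx_continuous m n : continuous (@adjmx R k m n).
Proof.
move=> A; apply: (@cvg_mx _ (nbhs A) (nbhs_filter A)) => i j; rewrite mxE mxE.
under eq_fun do rewrite mxE mxE.
by apply: (cvg_comp _ _ (@coord_continuous F _ _ j i A)); exact: rc_conj_continuous.
Qed.

Lemma measurable_selfadj q : measurable (selfadj R k q : set (borel 'M[F]_q)).
Proof.
have cB : continuous (fun S : 'M[F]_q => adjmx S - S).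
  by move=> S; apply: (@cvgB _ _ _ (nbhs S) (nbhs_filter S)); [exact: (@adjmx_continuous q q S)|exact: cvg_id].
have -> : selfadj R k q = (fun S : 'M[F]_q => adjmx S - S) @^-1` [set 0].
  apply/seteqP; split => S /=; first by move=> ->; rewrite subrr.
  by move=> /eqP; rewrite subr_eq0 => /eqP.
rewrite -[X in measurable X]setCK; apply: measurableC; apply: sub_sigma_algebra.
apply: closed_openC; apply: (closed_comp (fun x _ => cB x)).
by apply: accessible_closed_set1; apply: hausdorff_accessible; exact: norm_hausdorff.
Qed.

End rcfld_topology.

Lemma continuous_sum (F : numFieldType) (V : topologicalType) (W : normedModType F)
    (I : Type) (s : seq I) (f : I -> V -> W) :
  (forall i, continuous (f i)) -> continuous (fun x => \sum_(i <- s) f i x).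
Proof.
move=> cf; elim: s => [|i s IH].
  rewrite (_ : (fun x => _) = cst 0); first by move=> x; exact: cvg_cst.
  by apply/funext => y; rewrite big_nil.
rewrite (_ : (fun x => _) = fun y => f i y + \sum_(j <- s) f j y).
  by move=> x; apply: (@cvgD _ _ _ (nbhs x) (nbhs_filter x)); [exact: cf|exact: IH].
by apply/funext => y; rewrite big_cons.
Qed.

(** * The linear map from outcome vectors to matrices *)

Section quark_map.
Context {R : realType} {k : field_kind} {q n : nat}.
Local Notation F := (rcfld R k).
Local Notation rc := (@rc_of_real R k).
Local Notation sa := (selfadj R k q).
Variables (O : 'I_n -> observable R k q) (K : R -> R -> F).
Variable p : forall i, 'I_(obs_num (O i)) -> R.
Arguments p : clear implicits.
Hypothesis p1 : forall i, \sum_j p i j = 1.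

Let idx := {i : 'I_n & 'I_(obs_num (O i))}.
Local Notation V := ('rV[R]_#|{: idx}|).

Definition outcome_index i (j : 'I_(obs_num (O i))) : 'I_#|{: idx}| :=
  enum_rank (Tagged (fun i => 'I_(obs_num (O i))) j : idx).

(** The central limit theorem is applied in a real coordinate space with one axis per outcome of
    each observable, whichever the field of the matrices. *)
Definition outcome_vec i (j : 'I_(obs_num (O i))) : V := delta_mx 0 (outcome_index j).

Definition centered_outcome_vec i (j : 'I_(obs_num (O i))) : V :=
  outcome_vec j - \sum_j' p i j' *: outcome_vec j'.

Definition quark_map (x : V) : 'M[F]_q :=
  \sum_i \sum_(j < obs_num (O i)) rc (x 0 (outcome_index j)) *: quark_dir K j.

Lemma quark_map_linear a x y : quark_map (a *: x + y) = rc a *: quark_map x + quark_map y.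
Proof.
rewrite /quark_map scaler_sumr -big_split; apply: eq_bigr => i _ /=.
rewrite scaler_sumr -big_split; apply: eq_bigr => j _ /=.
by rewrite !mxE rmorphD rmorphM scalerDl scalerA.
Qed.

Lemma quark_map0 : quark_map 0 = 0.
Proof.
have := quark_map_linear 1 0 0; rewrite rmorph1 !scale1r addr0 => /eqP.
by rewrite -subr_eq0 opprD addrA subrr sub0r oppr_eq0 => /eqP.
Qed.

Lemma quark_mapZ a x : quark_map (a *: x) = rc a *: quark_map x.
Proof. by rewrite -[a *: x]addr0 quark_map_linear quark_map0 addr0. Qed.

Lemma quark_mapD x y : quark_map (x + y) = quark_map x + quark_map y.
Proof. by rewrite -[x]scale1r quark_map_linear rmorph1 !scale1r. Qed.

Lemma quark_map_sum (I : Type) (s : seq I) (f : I -> V) :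
  quark_map (\sum_(i <- s) f i) = \sum_(i <- s) quark_map (f i).
Proof. exact: (big_morph quark_map quark_mapD quark_map0). Qed.

Lemma quark_map_outcome_vec i j : quark_map (@outcome_vec i j) = quark_dir K j.
Proof.
rewrite /quark_map (bigD1 i)//= (bigD1 j)//= !mxE !eqxx rmorph1 scale1r.
rewrite big1 ?addr0 => [|j' j'j].
  rewrite big1 ?addr0// => i' i'i; rewrite big1// => j' _.
  rewrite !mxE eqxx /= (inj_eq enum_rank_inj) -tag_eqE /tag_eq/= (negbTE i'i).
  by rewrite rmorph0 scale0r.
rewrite !mxE eqxx /= (inj_eq enum_rank_inj) eq_Tagged/= (negbTE j'j).
by rewrite rmorph0 scale0r.
Qed.

Lemma quark_map_centered i j : quark_map (@centered_outcome_vec i j) =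
  quark_dir K j - \sum_j' rc (p i j') *: quark_dir K j'.
Proof.
rewrite /centered_outcome_vec -scaleN1r addrC quark_map_linear rmorphN1 scaleN1r.
rewrite quark_map_outcome_vec addrC; congr (_ - _); rewrite quark_map_sum.
by apply: eq_bigr => j' _; rewrite quark_mapZ quark_map_outcome_vec.
Qed.

Lemma sum_centered_outcome_vec i : \sum_j p i j *: @centered_outcome_vec i j = 0.
Proof.
rewrite /centered_outcome_vec; under eq_bigr do rewrite scalerBr.
by rewrite sumrB -scaler_suml p1 scale1r subrr.
Qed.

Lemma quark_map_continuous : continuous quark_map.
Proof.
do 2 (apply: continuous_sum => ?); move=> x.
apply: (@cvgZr_tmp _ _ _ (nbhs x) (nbhs_filter x)).
apply: (cvg_comp _ _ (@coord_continuous R _ _ 0 _ x)).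
exact: rc_continuous.
Qed.

(** Defined for every real outcome, listed or not, so that the sum over trials reproduces the
    frequencies at every sample point and not just almost surely. *)
Definition centered_indicator r (Y : 'I_n -> 'I_r -> R) (a : 'I_n * 'I_r) : V :=
  \sum_j ((Y a.1 a.2 == obs_val (O a.1) j)%:R - p a.1 j) *: outcome_vec j.

Lemma centered_indicatorE r (Y : 'I_n -> 'I_r -> R) (a : 'I_n * 'I_r) j :
  Y a.1 a.2 = obs_val (O a.1) j -> centered_indicator Y a = centered_outcome_vec j.
Proof.
move=> Yj; rewrite /centered_indicator /centered_outcome_vec.
under eq_bigr do rewrite scalerBl; rewrite sumrB; congr (_ - _).
rewrite (bigD1 j)//= Yj eqxx scale1r big1 ?addr0// => j' j'j.
by rewrite (inj_eq (@obs_val_inj _ _ _ _)) eq_sym (negbTE j'j) scale0r.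
Qed.

(** For each outcome, r^(-1/2) (count - r p) = sqrt r (count / r - p). *)
Lemma quark_map_trials r (Y : 'I_n -> 'I_r -> R) : (0 < r)%N ->
  quark_map (Num.sqrt (r%:R^-1) *: \sum_(a <- trials r) centered_indicator Y a) =
  rc (Num.sqrt r%:R) *: \sum_i \sum_(j < obs_num (O i))
    rc (#|[pred l | Y i l == obs_val (O i) j]|%:R / r%:R - p i j) *: quark_dir K j.
Proof.
move=> r0; rewrite quark_mapZ quark_map_sum big_allpairs/=.
rewrite !scaler_sumr; apply: eq_bigr => i _.
under eq_bigr => l _ do (rewrite /centered_indicator/= quark_map_sum;
  under eq_bigr => j _ do rewrite quark_mapZ quark_map_outcome_vec).
rewrite exchange_big/= !scaler_sumr; apply: eq_bigr => j _.
rewrite -scaler_suml !scalerA -rmorph_sum -!rmorphM; congr (rc _ *: _).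
rewrite sumrB sumr_const card_ord -natr_sum -[in RHS]sum1_card.
rewrite [in RHS]big_mkcond/=.
have -> : (\sum_(l < r) (Y i l == obs_val (O i) j))%N =
    (\sum_(l < r) (if l \in [pred l | Y i l == obs_val (O i) j] then 1 else 0))%N.
  by apply: eq_bigr => l _; rewrite inE; case: eqP.
set m := (\sum_(l < r) _)%N.
have r0' : 0 < r%:R :> R by rewrite ltr0n.
have sr : Num.sqrt r%:R != 0 :> R by rewrite gt_eqF// sqrtr_gt0.
have e : r%:R = Num.sqrt r%:R ^+ 2 :> R by rewrite sqr_sqrtr.
rewrite sqrtrV// -[p i j *+ r]mulr_natr; set s := Num.sqrt r%:R in sr e *.
by rewrite e; field.
Qed.

End quark_map.

Theorem theorem4p24 (R : realType) (k : field_kind) (q n : nat)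
    (hq : (2 <= q)%N)
    (O : 'I_n -> observable R k q) (hO : complete_design O)
    (K : R -> R -> rcfld R k) (hK : reproducing_kernel K)
    (hK2 : strictly_pos_definite (abs_sq_kernel K))
    (rho : 'M[rcfld R k]_q) (hrho : density_matrix rho)
    (d : nat -> measure_display) (T : forall r, measurableType (d r))
    (P : forall r, probability (T r) R)
    (Y : forall r, 'I_n -> 'I_r -> {RV (P r) >-> R})
    (hY : forall r, measurements O rho (Y r)) :
  exists mu : probability (borelMx R k q) R,
    centered_gaussian
      (fun S => centered_inversion O K
                  (covariance_superop O K rho (centered_inversion O K S)))
      mu /\
    cvg_in_distribution P
      (fun r w => rc_of_real k (Num.sqrt r%:R) *:
                    (quark O K (outcome_freq O (fun i l => Y r i l) w) - rho))
      mu.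
Proof.
have [[hrho_sa _] trrho] := hrho.
pose p i j := outcome_prob (O i) j rho.
have frho1 : frob rho 1%:M = 1.
  by rewrite /frob mulmx1 trrho -(rmorph1 (@rc_of_real R k)) rc_re_of_real.
have p1 i : \sum_j p i j = 1 by rewrite sum_outcome_prob.
(* With a single repetition, p i j is the probability of an event. *)
have p0 i j : 0 <= p i j.
  by have [_ h] := hY 1%N; rewrite -lee_fin -(h i ord0 j) measure_ge0.
pose u := @centered_outcome_vec R k q n O p.
have du i : \sum_j p i j *: u i j = 0 by exact: sum_centered_outcome_vec.
pose L := quark_map (O := O) K.
have saL x : selfadj R k q (L x).
  apply: selfadj_sum => i _; apply: selfadj_sum => j _; apply: selfadjZ.
  exact: selfadj_quark_dir.
have cL : continuous L by exact: quark_map_continuous.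
pose ws := clt_dirs p u.
have [mu muE] := continuous_image_law (gauss_law ws) cL.
have saX r p' : selfadj R k q (rc_of_real k (Num.sqrt r%:R) *: (quark O K p' - rho)).
  rewrite quark_subE//; apply: selfadjZ; apply: selfadj_sum => i _.
  by apply: selfadj_sum => j _; apply: selfadjZ; exact: selfadj_quark_dir.
exists mu; split; split.
- rewrite muE (_ : _ @^-1` _ = setT) ?probability_setT//.
  by apply/seteqP; split => // x _; exact: saL.
- move=> A hA; apply: selfadj_centered_inversion => //.
  exact: selfadj_covariance_superop.
- move=> A B hA hB.
  have h S := @selfadj_covariance_superop R k q n O K rho S.
  by rewrite !frob_centered_inversionC// ?covariance_superop_sym//;
    rewrite -?frob_centered_inversionC//; exact: selfadj_centered_inversion.
- move=> A hA.
  pose l x := frob (L x) A.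
  have ll y z w : l (y + z *: w) = l y + z * l w.
    by rewrite /l /L [y + _]addrC quark_map_linear frobDl frobZl; exact: addrC.
  have lZ a w : l (a *: w) = a * l w by rewrite /l /L quark_mapZ frobZl.
  have cl : continuous l.
    have -> : l = fun x => \sum_i \sum_(j < obs_num (O i)) x 0 (outcome_index j) *
        frob (quark_dir K j) A.
      apply/funext => x; rewrite /l /L /quark_map frob_suml; apply: eq_bigr => i _.
      by rewrite frob_suml; apply: eq_bigr => j _; rewrite frobZl.
    do 2 (apply: continuous_sum => ?); move=> x.
    by apply: (@cvgMr_tmp _ _ (nbhs x) (nbhs_filter x)); exact: coord_continuous.
  (* The variance of the marginal along A is the sum of squares of [l] over the Gaussian
     directions. *)
  have lE : frob A (centered_inversion O K (covariance_superop O K rho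
      (centered_inversion O K A))) = \sum_(w <- ws) l w ^+ 2.
    rewrite quark_covarianceE// /ws /clt_dirs big_flatten/= big_map.
    apply: eq_bigr => i _; rewrite big_map; apply: eq_bigr => j _.
    by rewrite lZ exprMn sqr_sqrtr// /l /L quark_map_centered.
  rewrite lE; split; first by apply: sumr_ge0 => w _; exact: sqr_ge0.
  move=> B mB; rewrite muE; exact: (gauss_law_functional ws ll cl mB).
- by move=> r w; exact: saX.
move=> f /subspace_continuousP cf [C fC].
(* [f] is continuous only relative to the self-adjoint matrices, but [L] takes all its values
   there. *)
have cfL : continuous (f \o L).
  move=> x B hB.
  have /cL h : nbhs (L x) [set S | selfadj R k q S -> B (f S)] by exact: (cf _ (saL x) B hB).
  by apply: (@filterS _ (nbhs x) (nbhs_filter x) _ _ _ h) => y /= hy; exact: hy (saL y).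
have fLC x : `|(f \o L) x| <= C by exact: fC.
have bfL : bmeas (f \o L : borel _ -> R).
  by split; [exact: measurable_continuous_borel|exists C].
have -> : (\int[mu]_(S in selfadj R k q) (f S)%:E = (\int[gauss_law ws]_x (f \o L) x)%:E)%E.
  (* Off the self-adjoint matrices [f] may fail to be measurable. Composing with the self-adjoint
     part of S gives a continuous function on all matrices that agrees with [f] on the subspace. *)
  pose proj (S : 'M[rcfld R k]_q) := rc_of_real k 2^-1 *: (S + adjmx S).
  have projE S : selfadj R k q S -> proj S = S.
    move=> hS; rewrite /proj hS -mulr2n -scalerMnr -scaler_nat scalerA.
    by rewrite -(rmorph_nat (@rc_of_real R k)) -rmorphM divff ?rmorph1 ?scale1r// pnatr_eq0.
  have saproj S : selfadj R k q (proj S).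
    by apply: selfadjZ; rewrite /selfadj/= adjmxD adjmxK addrC.
  have cproj : continuous proj.
    move=> S; apply: (@cvgZl_tmp _ _ _ (nbhs S) (nbhs_filter S)).
    apply: (@cvgD _ _ _ (nbhs S) (nbhs_filter S)); first exact: cvg_id.
    exact: adjmx_continuous.
  have cfp : continuous (f \o proj).
    move=> S B hB.
    have /cproj h : nbhs (proj S) [set S' | selfadj R k q S' -> B (f S')].
      exact: (cf _ (saproj S) B hB).
    by apply: (@filterS _ (nbhs S) (nbhs_filter S) _ _ _ h) => S' /= hS; exact: hS (saproj S').
  have mfp : measurable_fun setT (EFin \o (f \o proj) : borelMx R k q -> \bar R).
    by apply/measurable_EFinP; exact: measurable_continuous_borel.
  pose Q : {measure set (borelMx R k q) -> \bar R} :=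
    measure_function_pushforward__canonical__measure_function_Measure
      (gauss_law ws) (measurable_continuous_map cL).
  transitivity (\int[Q]_(S in selfadj R k q) ((f \o proj) S)%:E)%E.
    transitivity (\int[mu]_(S in selfadj R k q) ((f \o proj) S)%:E)%E.
      by apply: eq_integral => S /set_mem hS /=; rewrite projE.
    by apply: eq_measure_integral => B mB _; exact: muE.
  have LT : L @^-1` selfadj R k q = setT.
    by apply/seteqP; split => // x _; exact: saL.
  have fpL : (EFin \o (f \o proj)) \o L = EFin \o (f \o L).
    by apply/funext => x /=; rewrite projE.
  rewrite (integral_pushforward (measurable_continuous_map cL))//; last 2 first.
  - by rewrite LT fpL; exact: bmeas_integrable.
  - exact: measurable_selfadj.
  by rewrite LT fpL EFin_Rintegral//; exact: bmeas_integrable.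
have clt := central_limit p0 p1 du cfL fLC.
have cE : EFin (titer p u (trials r) (Num.sqrt (r%:R^-1)) (f \o L) 0) @[r --> \oo] -->
   (\int[gauss_law ws]_x (f \o L) x)%:E.
  by apply: cvg_EFin; [exact: nearW|exact: clt].
apply: (cvg_trans _ cE); apply: near_eq_cvg; near=> r.
have r0 : (0 < r)%N by near: r; exists 1%N.
have [indY lawY] := hY r.
pose U a w : 'rV_#|{: {i : 'I_n & 'I_(obs_num (O i))}}| :=
  centered_indicator p (fun i l => Y r i l w) a.
(* Each centered indicator is a combination of fixed vectors with measurable scalar coefficients, so
   trials are added by [measurable_add_lincomb]. *)
have mU s x : bmeas (fun w => (f \o L) (x + Num.sqrt (r%:R^-1) *: \sum_(a <- s) U a w)).
  apply: (@bmeas_comp _ _ _ _ (borel _) (fun w => x + Num.sqrt (r%:R^-1) *: \sum_(a <- s) U a w)) bfL.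
  elim: s => [|a s IH].
    rewrite [X in measurable_fun _ X](_ : _ = cst x); first exact: measurable_cst.
    by apply/funext => w; rewrite big_nil scaler0 addr0.
  rewrite [X in measurable_fun _ X](_ : _ = fun w =>
      (x + Num.sqrt (r%:R^-1) *: \sum_(a <- s) U a w) +
      \sum_j (Num.sqrt (r%:R^-1) * ((Y r a.1 a.2 w == obs_val (O a.1) j)%:R - p a.1 j))
        *: outcome_vec j); last first.
    apply/funext => w; rewrite big_cons scalerDr addrCA addrC; congr (_ + _).
    by rewrite /U /centered_indicator scaler_sumr; apply: eq_bigr => j _; rewrite scalerA.
  apply: measurable_add_lincomb => // j; apply: measurable_funM => //.
  apply: measurable_funB => //.
  rewrite [X in measurable_fun _ X](_ : _ = \1_(Y r a.1 a.2 @^-1` [set obs_val (O a.1) j])).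
    apply: measurable_indic; rewrite -[X in measurable X]setTI.
    by apply: measurable_funP => //; exact: measurable_set1.
  apply/funext => w; rewrite indicE; congr (nat_of_bool _)%:R.
  by apply/eqP/idP; rewrite inE.
have UE a j w : Y r a.1 a.2 w = obs_val (O a.1) j -> U a w = u a.1 j.
  by move=> Yj; exact: centered_indicatorE.
rewrite -(@expectation_titer R _ _ _ p u p1 _ _ (P r) r (fun a => Y r a.1 a.2)
  (fun i => obs_val (O i)) (fun i => @obs_val_inj _ _ _ (O i)) indY
  (fun a j => lawY a.1 a.2 j) U UE _ _ mU 0).
rewrite EFin_Rintegral; last exact: bmeas_integrable.
apply: eq_integral => w _; congr (EFin (f _)).
by rewrite add0r /L quark_map_trials// quark_subE.
Unshelve. all: by end_near.
Qed.
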